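(* Let $\Gamma$ be a fixed sentence of the two-variable fragment of first-order logic (variables $x,y$ only), and let $$\Upsilon=\bigwedge_{j=1}^{m}(|R_{i_j}|\bowtie_j c_j)\ \wedge\ \bigwedge_{j=1}^{m'}\big(\forall x\,\exists_{=k_j}y:\psi_j(x,y)\big)\ \wedge\ \bigwedge_{j=1}^{m''}\big(\exists_{=k'_j}x\,\forall y:\varphi_j(x,y)\big),$$ where each $\bowtie_j\in\{=,\le,\ge,<,>\}$, $c_j,k_j,k'_j$ are fixed natural numbers, $R_{i_j}$ are predicates, and $\psi_j,\varphi_j$ are two-variable first-order formulas with free variables among $x,y$. Then computing the WFOMC of $\Gamma\wedge\Upsilon$ is domain-liftable: there is an algorithm which, given a finite domain $\Delta$ and rational weight functions $w,\overline{w}$ on the predicates, computes $\mathrm{WFOMC}(\Gamma\wedge\Upsilon,w,\overline{w},\Delta)$ in time polynomial in $|\Delta|$ and the number of bits needed to encode the weights.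
   Context: Fix a function-free first-order language with a finite set $\mathcal{R}$ of predicates. A domain $\Delta$ is a finite set. A possible world $\omega$ on $\Delta$ is a set of ground atoms over $\mathcal{R}$ and $\Delta$; $\Omega_\Delta$ is the set of all of them. $N(R,\omega)$ is the number of ground atoms of $R$ true in $\omega$. $\mathrm{WFOMC}(\Gamma,w,\overline{w},\Delta)=\sum_{\omega\in\Omega_\Delta,\,\omega\models\Gamma}\prod_{R\in\mathcal{R}} w(R)^{N(R,\omega)}\overline{w}(R)^{|\Delta|^{\mathrm{arity}(R)}-N(R,\omega)}$. A cardinality constraint $|R|\bowtie c$ is an atomic formula that holds in $\omega$ iff $N(R,\omega)\bowtie c$. The counting quantifier $\exists_{=k}$ means ''there exist exactly $k$ distinct domain elements such that''. *)

(* Defs.v *)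
From HB Require Import structures.
From mathcomp Require Import all_boot all_order all_algebra.
Set Implicit Arguments.
Unset Strict Implicit.
Unset Printing Implicit Defensive.
Import Order.TTheory GRing.Theory Num.Theory.

Definition var := bool.
Definition vx : var := false.
Definition vy : var := true.

Section Logic.
Variables (r : nat) (ar : 'I_r -> nat).

Inductive fo2 : Type :=
  | FAtom (R : 'I_r) (args : (ar R).-tuple var)
  | FEq (u v : var)
  | FNeg (f : fo2)
  | FAnd (f g : fo2)
  | FOr (f g : fo2)
  | FEx (v : var) (f : fo2)
  | FAll (v : var) (f : fo2).

Fixpoint free (f : fo2) (v : var) : bool :=
  match f with
  | FAtom _ args => v \in (args : seq var)
  | FEq a b => (v == a) || (v == b)
  | FNeg g => free g v
  | FAnd g h | FOr g h => free g v || free h v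
  | FEx u g | FAll u g => (v != u) && free g v
  end.

Definition sentence (f : fo2) : bool := ~~ free f vx && ~~ free f vy.

Inductive cmp : Type := CEq | CLe | CGe | CLt | CGt.

Definition cmp_eval (o : cmp) (a b : nat) : bool :=
  match o with
  | CEq => a == b | CLe => a <= b | CGe => a >= b | CLt => a < b | CGt => a > b
  end.

Section Semantics.
Variable n : nat.   (* the domain Delta = 'I_n, |Delta| = n *)

Definition gatom := {R : 'I_r & (ar R).-tuple 'I_n}.
Definition world := {set gatom}.

Definition Ncount (R : 'I_r) (w : world) : nat := #|[set a in w | tag a == R]|.

Definition env := var -> option 'I_n.
Definition upd (e : env) (v : var) (a : 'I_n) : env :=
  fun u => if u == v then Some a else e u.

Fixpoint eval (w : world) (e : env) (f : fo2) : bool :=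
  match f with
  | FAtom R args =>
      [exists t : (ar R).-tuple 'I_n,
         (Tagged (fun R => (ar R).-tuple 'I_n) t \in w) &&
         [forall i, e (tnth args i) == Some (tnth t i)]]
  | FEq a b => (e a != None) && (e a == e b)
  | FNeg g => ~~ eval w e g
  | FAnd g h => eval w e g && eval w e h
  | FOr g h => eval w e g || eval w e h
  | FEx v g => [exists a : 'I_n, eval w (upd e v a) g]
  | FAll v g => [forall a : 'I_n, eval w (upd e v a) g]
  end.

Definition env0 : env := fun _ => None.
Definition envxy (a b : 'I_n) : env := fun v => Some (if v then b else a).

Definition sat_card (w : world) (cc : 'I_r * cmp * nat) : bool :=
  cmp_eval cc.1.2 (Ncount cc.1.1 w) cc.2.
Definition sat_fa_excount (w : world) (kp : nat * fo2) : bool :=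
  [forall a : 'I_n, #|[set b : 'I_n | eval w (envxy a b) kp.2]| == kp.1].
Definition sat_excount_fa (w : world) (kp : nat * fo2) : bool :=
  #|[set a : 'I_n | [forall b : 'I_n, eval w (envxy a b) kp.2]]| == kp.1.

Definition sat_all (Gamma : fo2) (cards : seq ('I_r * cmp * nat))
  (cnts ecnts : seq (nat * fo2)) (w : world) : bool :=
  [&& eval w env0 Gamma, all (sat_card w) cards,
      all (sat_fa_excount w) cnts & all (sat_excount_fa w) ecnts].

Definition weight (wt wbar : 'I_r -> rat) (w : world) : rat :=
  \prod_(R : 'I_r) (wt R ^+ Ncount R w * wbar R ^+ (n ^ ar R - Ncount R w)).

Definition WFOMC (Gamma : fo2) (cards : seq ('I_r * cmp * nat))
  (cnts ecnts : seq (nat * fo2)) (wt wbar : 'I_r -> rat) : rat :=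
  \sum_(w : world | sat_all Gamma cards cnts ecnts w) weight wt wbar w.

End Semantics.
End Logic.

(* 2. Computation model: deterministic Turing machines with a two-way
      infinite single tape over the alphabet {blank, separator, 0, 1}.  *)

Definition sym := option (option bool).
Definition blank : sym := None.
Definition sepS : sym := Some None.
Definition bitS (b : bool) : sym := Some (Some b).

Record TM := MkTM {
  nstates : nat;   (* states are 'I_nstates.+1, start state ord0 *)
  delta : 'I_nstates.+1 -> sym -> option ('I_nstates.+1 * sym * bool)
  (* None = halt; the bool is the head move: true = right, false = left *)
}.

(* configuration: state, reversed left part, scanned symbol, right part *)
Record config (M : TM) := Cfg {
  cstate : 'I_(nstates M).+1; cleft : seq sym; chead : sym; cright : seq sym }.

Definition uncons (s : seq sym) : sym * seq sym :=
  if s is a :: s' then (a, s') else (blank, [::]).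

Definition step (M : TM) (c : config M) : config M :=
  match delta (cstate c) (chead c) with
  | None => c
  | Some (q, s, true) =>
      let hr := uncons (cright c) in Cfg q (s :: cleft c) hr.1 hr.2
  | Some (q, s, false) =>
      let hl := uncons (cleft c) in Cfg q hl.2 hl.1 (s :: cright c)
  end.

Definition halted (M : TM) (c : config M) : bool :=
  delta (cstate c) (chead c) == None.

Definition init (M : TM) (inp : seq sym) : config M :=
  Cfg ord0 [::] (uncons inp).1 (uncons inp).2.

Definition output (M : TM) (c : config M) : seq sym :=
  let s := chead c :: cright c in take (find (pred1 blank) s) s.

(* little-endian binary digits of m (fuel-bounded, fuel m suffices) *)
Fixpoint bin_fuel (fuel m : nat) : seq bool :=
  match fuel with
  | 0 => [::]
  | fuel'.+1 => if m == 0 then [::] else odd m :: bin_fuel fuel' m./2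
  end.
Definition bin (m : nat) : seq bool := bin_fuel m m.

Definition enc_nat (m : nat) : seq sym := map bitS (bin m).
Definition enc_int (z : int) : seq sym :=
  match z with
  | Posz k => bitS false :: enc_nat k
  | Negz k => bitS true :: enc_nat k.+1
  end.
Definition enc_rat (q : rat) : seq sym :=
  enc_int (numq q) ++ sepS :: enc_nat `|denq q|%N.

Definition wfomc_input (r n : nat) (wt wbar : 'I_r -> rat) : seq sym :=
  nseq n (bitS true) ++
  flatten [seq sepS :: enc_rat (wt R) ++ sepS :: enc_rat (wbar R) | R <- enum 'I_r].

Definition computes_within (M : TM) (inp out : seq sym) (t : nat) : Prop :=
  exists t', t' <= t /\ halted (iter t' (@step M) (init M inp))
             /\ output (iter t' (@step M) (init M inp)) = out.

(* Main.v *)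
Require Import Defs.
From HB Require Import structures.
From mathcomp Require Import all_boot all_order all_algebra.
From mathcomp Require Import zify.
Set Implicit Arguments.
Unset Strict Implicit.
Unset Printing Implicit Defensive.

(* Every domain element receives a cell, namely the truth values of the atoms that mention it alone
   and a guessed truth value for every quantified subformula, whose only possible free variable is then
   read at that element. Given the guesses, each formula at a pair of elements is propositional in the
   atoms over that pair, so the guesses are correct, and the counting quantifiers hold, iff for each
   element certain numbers of partners, cut off at a constant, have the right values. Adding the
   elements one by one, a world is therefore summarised by the histogram of pairs (cell, partner numbers)
   together with finitely many saturating global counters: polynomially many states in the domain size.
   Atoms over three or more elements are seen by the cardinality constraints only, and are processed as
   anonymous units. The weights are scaled to integers with a common denominator, a difference of
   naturals representing each of them, and the quotient is reduced at the end. Finally, polynomial time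
   is understood on a single-tape machine that keeps a fixed number of binary stacks side by side on its
   tape, the data being encoded as binary trees on one of the stacks. *)

(** * Fragments of Turing machines, and stacks laid out on the tape *)

(** The guess bits do not change the sum because every world admits exactly one consistent
    assignment of them: from the innermost subformulas outwards, local consistency forces each bit.
    The cut-off [CAP] exceeds every constant of the constraints, and capping commutes with addition,
    so counters can be updated stepwise in any order without losing what the constraints compare. A
    histogram forgets which element is which, hence a new element meets the old ones grouped by
    class; this agrees with the sum over worlds because the updates for different partners commute.
    The atoms of nullary predicates belong to no element and are summed over outside the program.
    Two bounds keep the tables polynomial. Merging equal keys bounds their length by the number of
    histograms, whose dimension depends on the fixed sentence only; the mass of a table, the total
    of both parts of its weights, bounds the bit lengths, since no cancellation occurs in it.
    Iterating a polynomial-time step is not polynomial in general, so every loop carries a bound on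
    its intermediate states. *)

Definition tape := (seq sym * sym * seq sym)%type.

(** Everything from the head onwards is one list, the scanned symbol being its first entry, or a
    blank if there is none; passes over the tape thus become inductions on lists. *)
Definition mktp (L str : seq sym) : tape := (L, (uncons str).1, (uncons str).2).

Definition mv (tp : tape) (s : sym) (d : bool) : tape :=
  let: (l, h, r) := tp in
  if d then mktp (s :: l) r else ((uncons l).2, (uncons l).1, s :: r).

Lemma mv_left x L str s : mv (mktp (x :: L) str) s false = mktp L (x :: s :: behead str).
Proof. by case: str. Qed.

Lemma mv_left_nil str s : mv (mktp [::] str) s false = mktp [::] (blank :: s :: behead str).
Proof. by case: str. Qed.

(* A machine with several halting states: the type E of exits plays the role of a return value. *)
Record frag (E : finType) := Frag {
  fQ : finType; fq0 : fQ; fd : fQ -> sym -> (fQ + E) * sym * bool }.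

Section Frag.
Variables (E : finType) (F : frag E).

Definition fstep (st : (fQ F + E) * tape) : (fQ F + E) * tape :=
  match st.1 with
  | inl q => let: (q', s, d) := fd q st.2.1.2 in (q', mv st.2 s d)
  | inr _ => st
  end.

(** Exits are absorbing for [fstep], so [t] is in effect an upper bound on the running time. *)
Definition runs (tp : tape) (t : nat) (e : E) (tp' : tape) : Prop :=
  iter t fstep (inl (fq0 F), tp) = (inr e, tp').

Lemma iter_fstep_exit t e tp : iter t fstep (inr e, tp) = (inr e, tp).
Proof. by elim: t => //= t ->. Qed.

Lemma runs_le tp t t' e tp' : t <= t' -> runs tp t e tp' -> runs tp t' e tp'.
Proof. by move=> /subnK <-; rewrite /runs iterD => ->; rewrite iter_fstep_exit. Qed.

End Frag.

Section Bind.
Variables (E1 E2 : finType) (F : frag E1) (G : E1 -> frag E2).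

Definition bindQ : finType := (fQ F + {e : E1 & fQ (G e)})%type.
Definition bind_enter (e : E1) : bindQ := inr (Tagged (fun e => fQ (G e)) (fq0 (G e))).
Definition bind_d (q : bindQ) (s : sym) : (bindQ + E2) * sym * bool :=
  match q with
  | inl q => let: (x, s', d) := fd q s in
      (match x with inl q' => inl (inl q') | inr e => inl (bind_enter e) end, s', d)
  | inr (existT e q) => let: (x, s', d) := fd q s in
      (match x with
       | inl q' => inl (inr (Tagged (fun e => fQ (G e)) q')) | inr e' => inr e' end, s', d)
  end.
Definition bindF : frag E2 := Frag (inl (fq0 F) : bindQ) bind_d.

Let emb1 (st : (fQ F + E1) * tape) : (fQ bindF + E2) * tape :=
  (match st.1 with inl q => inl (inl q) | inr e => inl (bind_enter e) end, st.2).
Let emb2 (e : E1) (st : (fQ (G e) + E2) * tape) : (fQ bindF + E2) * tape :=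
  (match st.1 with
   | inl q => inl (inr (Tagged (fun e => fQ (G e)) q)) | inr e' => inr e' end, st.2).

(** [F] may have reached its exit before time [t] and idled there, whereas the composite enters
    [G e] at once; hence only some [t' <= t]. *)
Lemma bind_sim1 t st e tp' : iter t (@fstep _ F) st = (inr e, tp') ->
  exists2 t', t' <= t & iter t' (@fstep _ bindF) (emb1 st) = (inl (bind_enter e), tp').
Proof.
elim: t st => [|t IH] st; first by move=> /= ->; exists 0.
rewrite iterSr; case: st => [[q|e0] tp] h; last first.
  by exists 0 => //; move: h; rewrite iter_fstep_exit => -[-> ->].
have [t' le_t' eq_t'] := IH _ h; exists t'.+1 => //.
rewrite iterSr -eq_t'; congr (iter _ _ _).
by rewrite /fstep /emb1 /=; case: (fd q tp.1.2) => [[[q'|e'] s] d].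
Qed.

Lemma bind_sim2 t e st : iter t (@fstep _ bindF) (emb2 st) = emb2 (iter t (@fstep _ (G e)) st).
Proof.
elim: t => //= t ->; case: (iter t _ st) => [[q|e0] tp] //=.
by rewrite /fstep /emb2 /=; case: (fd q tp.1.2) => [[[q'|e'] s] d].
Qed.

Lemma runs_bind tp t1 e tp1 t2 e2 tp2 :
  runs F tp t1 e tp1 -> runs (G e) tp1 t2 e2 tp2 -> runs bindF tp (t1 + t2) e2 tp2.
Proof.
move=> /bind_sim1[t' le_t' h1] h2; apply: (@runs_le _ _ _ (t2 + t')); first by lia.
rewrite /runs iterD h1.
have -> : (inl (bind_enter e), tp1) = emb2 (inl (fq0 (G e)), tp1) by [].
by rewrite bind_sim2 h2.
Qed.

End Bind.

Section Loop.
Variables (E : finType) (F : frag (option E)).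

(** The exit [None] asks for another round. The jump is part of the last transition and costs no
    step of its own. *)
Definition loop_d (q : fQ F) (s : sym) : (fQ F + E) * sym * bool :=
  let: (x, s', d) := fd q s in
  (match x with inl q' => inl q' | inr None => inl (fq0 F) | inr (Some e) => inr e end, s', d).
Definition loopF : frag E := Frag (fq0 F) loop_d.

Let emb (st : (fQ F + option E) * tape) : (fQ loopF + E) * tape :=
  (match st.1 with inl q => inl q | inr None => inl (fq0 F) | inr (Some e) => inr e end, st.2).

Lemma loop_sim t st e tp' : iter t (@fstep _ F) st = (inr e, tp') ->
  exists2 t', t' <= t & iter t' (@fstep _ loopF) (emb st) = emb (inr e, tp').
Proof.
elim: t st => [|t IH] st; first by move=> /= ->; exists 0.
rewrite iterSr; case: st => [[q|e0] tp] h; last first.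
  by exists 0 => //; move: h; rewrite iter_fstep_exit => -[-> ->].
have [t' le_t' eq_t'] := IH _ h; exists t'.+1 => //.
rewrite iterSr -eq_t'; congr (iter _ _ _).
by rewrite /fstep /emb /= /loop_d; case: (fd q tp.1.2) => [[[q'|[e'|]] s] d].
Qed.

Lemma runs_loop_exit tp t e tp' : runs F tp t (Some e) tp' -> runs loopF tp t e tp'.
Proof. by move=> /loop_sim[t' le_t' h]; apply: (runs_le le_t'). Qed.

Lemma runs_loop_again tp t tp1 t2 e tp2 :
  runs F tp t None tp1 -> runs loopF tp1 t2 e tp2 -> runs loopF tp (t + t2) e tp2.
Proof.
move=> /loop_sim[t' le_t' h] h2; apply: (@runs_le _ _ _ (t2 + t')); first by lia.
by rewrite /runs iterD h.
Qed.

End Loop.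

(** * Layout of several stacks on the tape; push and pop *)

Definition lay' (ss : seq (seq bool)) : seq sym := flatten [seq sepS :: map bitS s | s <- ss].
Definition lay (ss : seq (seq bool)) : seq sym := behead (lay' ss).
Definition lsz ss := size (lay ss).

Lemma lay_cons s ss : lay (s :: ss) = map bitS s ++ lay' ss. Proof. by []. Qed.

(** Blanks on both sides are left unspecified: the passes of [pushF] and [popF] may leave some
    behind and may displace the whole layout by a cell. *)
Definition Rep (ss : seq (seq bool)) (tp : tape) : Prop :=
  exists a b, tp = mktp (nseq a blank) (lay ss ++ nseq b blank).

Lemma blank_bits s : blank \notin map bitS s.
Proof. by apply/mapP => -[]. Qed.

Lemma blank_lay' ss : blank \notin lay' ss.
Proof.
elim: ss => //= s ss IH.
by rewrite /lay' /= in_cons mem_cat negb_or /= negb_or blank_bits IH.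
Qed.

Lemma count_sep_bits s : count_mem sepS (map bitS s) = 0.
Proof. by elim: s => //= b s ->. Qed.

(** A machine finds the stack by counting: [u] contains [i] separators and ends with the last of
    them. The default value of [last] covers [i = 0], where [u] is empty. *)
Lemma lay_split ss i : i < size ss ->
  exists u v, [/\ lay ss = u ++ map bitS (nth [::] ss i) ++ v,
    forall s, lay (set_nth [::] ss i s) = u ++ map bitS s ++ v,
    count_mem sepS u = i, last sepS u = sepS & blank \notin u ++ v /\ ohead v \in [:: None; Some sepS]].
Proof.
elim: i ss => [|i IH] [|s0 ss] //= hi.
  exists [::], (lay' ss); split=> //; split; first by rewrite blank_lay'.
  by case: (ss).
have [u [v [e1 e2 e3 e4 [e5 e6]]]] := IH _ hi.
have hss x l : lay' (x :: l) = sepS :: lay (x :: l) by [].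
exists (map bitS s0 ++ sepS :: u), v; split.
- by rewrite lay_cons; case: ss hi e1 {e2 IH} => // x l _; rewrite hss -catA => -> .
- move=> s /=; rewrite lay_cons -catA /= -e2.
  by case: ss hi {e1 e2 IH} => // x l _; case: (i).
- by rewrite count_cat /= count_sep_bits e3.
- by rewrite last_cat.
- split=> //; move: e5; rewrite !mem_cat in_cons !negb_or blank_bits /=.
  by case/andP=> -> ->.
Qed.

(* A pass moving right and carrying a symbol ends on the first blank cell; from there the head
   walks left to the blank before the layout. *)
Lemma back_run (E : finType) (F : frag E) (qb : fQ F) e :
  (forall c, fd qb c = if c == blank then (inr e, blank, true) else (inl qb, c, false)) ->
  forall u a str c', blank \notin u -> exists a', 
  iter (size u).+1 (@fstep _ F) (inl qb, mv (mktp (rev u ++ nseq a blank) str) c' false)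
  = (inr e, mktp (nseq a' blank) (u ++ c' :: behead str)).
Proof.
move=> hd; elim/last_ind => [|u x IH] a str c' hu.
  exists a.-1.+1; case: a => [|a].
    by rewrite mv_left_nil /= /fstep /= hd eqxx.
  by rewrite mv_left /= /fstep /= hd eqxx.
rewrite mem_rcons in_cons negb_or eq_sym in hu; case/andP: hu => hx hu.
have [a' h] := IH a (c' :: c' :: behead str) x hu; exists a'.
rewrite rev_rcons cat_cons mv_left size_rcons iterSr cat_rcons -h.
congr (iter _ _ _); rewrite /fstep /= hd (negbTE hx).
by case: (rev u ++ nseq a blank).
Qed.

(** A shift by one cell to the right: the state holds the symbol displaced from the previous cell,
    and the blank that ends the pass receives the last one. *)
Lemma ins_run (E : finType) (F : frag E) (qi : sym -> fQ F) (qb : fQ F) :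
  (forall c0 c, fd (qi c0) c = if c == blank then (inl qb, c0, false) else (inl (qi c), c0, true)) ->
  forall v L c0 b, blank \notin v ->
  iter (size v).+1 (@fstep _ F) (inl (qi c0), mktp L (v ++ nseq b blank))
  = (inl qb, mv (mktp (rev (belast c0 v) ++ L) (nseq b blank)) (last c0 v) false).
Proof.
move=> hd; elim => [|x v IH] L c0 b hv.
  by rewrite /= /fstep /= hd; case: b.
rewrite in_cons negb_or eq_sym in hv; case/andP: hv => hx hv.
rewrite iterSr {2}/fstep /= hd (negbTE hx) rev_cons cat_rcons.
exact: IH.
Qed.

Lemma belast_last (T : Type) (x : T) v : belast x v ++ [:: last x v] = x :: v.
Proof. by rewrite cats1 -lastI. Qed.

Section Push.
Variables (i : nat) (b : bool).

Definition push_ins (c0 c : sym) : ('I_i.+1 + option sym + unit) * sym * bool :=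
  if c == blank then (inl (inr None), c0, false) else (inl (inr (Some c)), c0, true).

(** In state [inl j], [j] separators remain to be passed; the bit is then inserted by shifting all
    that follows, and the head walks back. *)
Definition push_d (q : 'I_i.+1 + option sym) (c : sym) :
    ('I_i.+1 + option sym + unit) * sym * bool :=
  match q with
  | inl j => if val j == 0 then push_ins (bitS b) c
             else (inl (inl (inord (j - (c == sepS)))), c, true)
  | inr (Some c0) => push_ins c0 c
  | inr None => if c == blank then (inr tt, blank, true) else (inl (inr None), c, false)
  end.

Definition pushF : frag unit := Frag (inl ord_max : 'I_i.+1 + option sym)%type push_d.

Lemma push_skip u L str j : j <= i -> count_mem sepS u = j -> last sepS u = sepS -> blank \notin u ->
  iter (size u) (@fstep _ pushF) (inl (inl (inord j)), mktp L (u ++ str))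
  = (inl (inl (inord 0)), mktp (rev u ++ L) str).
Proof.
elim: u L j => [|c u IH] L j hj; first by move=> /= <-.
rewrite [last _ _]/= in_cons negb_or => hc hl /andP[_ hb].
(* A nonempty prefix ends with a separator, so at least one is still to be counted. *)
have j0 : j != 0.
  apply/negP => /eqP e0; move: hc hl; rewrite e0 /=.
  case: eqP => // hcs; rewrite add0n => /count_memPn hn hl.
  case: u hn hl {IH hb} => [_ /= hl|y u hn /= hl]; first exact: hcs.
  by move: hn; rewrite -hl mem_last.
rewrite iterSr {2}/fstep /= inordK ?ltnS // (negbTE j0).
rewrite rev_cons cat_rcons; apply: IH => //; first by lia.
  by rewrite -hc /= ; lia.
by case: (u) hc hl => //=.
Qed.

Lemma push_run ss tp : i < size ss -> Rep ss tp ->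
  exists2 tp', Rep (set_nth [::] ss i (b :: nth [::] ss i)) tp' &
    runs pushF tp (2 * lsz ss + 4) tt tp'.
Proof.
move=> hi [a [n ->]].
have [u [v [e1 e2 e3 e4 [e5 _]]]] := lay_split hi.
move: e5; rewrite mem_cat negb_or => /andP[hu hv].
set w := map bitS (nth [::] ss i) ++ v.
have hw : blank \notin w by rewrite mem_cat negb_or blank_bits.
have e0 : (inl (fq0 pushF), mktp (nseq a blank) (lay ss ++ nseq n blank))
   = (inl (inl (inord i)), mktp (nseq a blank) (u ++ (w ++ nseq n blank))) :> ((fQ pushF + unit) * tape).
  rewrite e1 /w !catA; congr (inl (inl _), _); apply: val_inj; by rewrite /= inordK.
have h1 := push_skip (nseq a blank) (w ++ nseq n blank) (leqnn i) e3 e4 hu.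
have h2 : iter (size w).+1 (@fstep _ pushF) (inl (inl (inord 0)), mktp (rev u ++ nseq a blank) (w ++ nseq n blank))
  = (inl (inr None), mv (mktp (rev (belast (bitS b) w) ++ (rev u ++ nseq a blank)) (nseq n blank))
    (last (bitS b) w) false).
  rewrite -(@ins_run _ pushF (fun c => inr (Some c)) (inr None)) // !iterSr.
  by congr (iter _ _ _); rewrite /fstep /= inordK.
have hub : blank \notin u ++ belast (bitS b) w.
  rewrite mem_cat negb_or hu; apply/negP => /mem_belast; rewrite in_cons /=.
  by apply/negP.
have [a' h3] := @back_run _ pushF (inr None) tt (fun c => erefl) _ a (nseq n blank) (last (bitS b) w) hub.
exists (mktp (nseq a' blank) ((u ++ belast (bitS b) w) ++ last (bitS b) w :: behead (nseq n blank))).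
  exists a', n.-1; congr mktp; rewrite e2 /= -[last _ _ :: _]cat1s !catA -(catA u) belast_last.
  by rewrite /w /= -!catA /=; case: (n).
apply: (@runs_le _ _ _ ((size (u ++ belast (bitS b) w)).+1 + ((size w).+1 + size u))).
  by rewrite /lsz e1 !size_cat size_belast /w !size_cat; lia.
rewrite /runs e0 iterD iterD h1 h2 -h3 rev_cat catA; exact: erefl.
Qed.

End Push.

Section Pop.
Variable i : nat.

(** The top of a stack is deleted by shifting what precedes it one cell to the right, over it:
    [inl (j, k)] has [j] separators to pass and carries the symbol [k] read last, a blank if nothing
    has been passed. If the stack turns out to be empty, the shift goes on to the end and the whole
    layout moves by one cell. *)
Definition popQ : finType := ('I_i.+1 * sym + (sym + option bool))%type.

Definition pop_d (q : popQ) (c : sym) : (popQ + option bool) * sym * bool :=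
  match q with
  | inl (j, k) =>
      if val j == 0 then
        match c with
        | Some (Some b) => if k == blank then (inr (Some b), blank, true)
                           else (inl (inr (inr (Some b))), k, false)
        | _ => if c == blank then (inl (inr (inr None)), k, false)
               else (inl (inr (inl c)), k, true)
        end
      else (inl (inl (inord (j - (c == sepS)), c)), k, true)
  | inr (inl c0) => if c == blank then (inl (inr (inr None)), c0, false)
                    else (inl (inr (inl c)), c0, true)
  | inr (inr e) => if c == blank then (inr e, blank, true) else (inl (inr (inr e)), c, false)
  end.

Definition popF : frag (option bool) := Frag (inl (ord_max, blank) : popQ) pop_d.

Lemma pop_skip u L str j k : j <= i -> count_mem sepS u = j -> last sepS u = sepS -> blank \notin u ->
  iter (size u) (@fstep _ popF) (inl (inl (inord j, k)), mktp L (u ++ str))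
  = (inl (inl (inord 0, last k u)), mktp (rev (belast k u) ++ L) str).
Proof.
elim: u L j k => [|c u IH] L j k hj; first by move=> /= <-.
rewrite [last _ _]/= in_cons negb_or => hc hl /andP[_ hb].
have j0 : j != 0.
  apply/negP => /eqP e0; move: hc hl; rewrite e0 /=.
  case: eqP => // hcs; rewrite add0n => /count_memPn hn hl.
  case: u hn hl {IH hb} => [_ /= hl|y u hn /= hl]; first exact: hcs.
  by move: hn; rewrite -hl mem_last.
rewrite iterSr {2}/fstep /= inordK ?ltnS // (negbTE j0).
rewrite rev_cons cat_rcons; apply: IH => //; first by lia.
  by rewrite -hc /= ; lia.
by case: (u) hc hl => //=.
Qed.

Lemma pop_run ss tp : i < size ss -> Rep ss tp ->
  exists2 tp', Rep (set_nth [::] ss i (behead (nth [::] ss i))) tp' &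
    runs popF tp (2 * lsz ss + 4) (ohead (nth [::] ss i)) tp'.
Proof.
move=> hi [a [n ->]].
have [u [v [e1 e2 e3 e4 [e5 e6]]]] := lay_split hi.
move: e5; rewrite mem_cat negb_or => /andP[hu hv].
set s := nth [::] ss i in e1 *.
have e0 : (inl (fq0 popF), mktp (nseq a blank) (lay ss ++ nseq n blank))
   = (inl (inl (inord i, blank)), mktp (nseq a blank) (u ++ (map bitS s ++ v ++ nseq n blank)))
     :> ((fQ popF + option bool) * tape).
  rewrite e1 !catA; congr (inl (inl (_,_)), _); apply: val_inj; by rewrite /= inordK.
have h1 := pop_skip (nseq a blank) (map bitS s ++ v ++ nseq n blank) blank (leqnn i) e3 e4 hu.
have [hN|[b [s' es]]] : s = [::] \/ exists b s', s = b :: s'.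
  by case: (s) => [|b s']; [left | right; exists b, s'].
- have -> : set_nth [::] ss i (behead s) = ss.
    apply: (@eq_from_nth _ [::]) => [|j hj]; rewrite ?size_set_nth ?(maxn_idPr hi) //.
    by rewrite nth_set_nth /=; case: eqP => // ->; rewrite -/s hN.
  rewrite hN /= in e0 h1 e1 *.
  (* With [v] empty, stack [i] is the last one and the blank behind it ends the shift; otherwise a
     separator follows and the shift continues through [v]. *)
  case: v e6 e1 {e2} e0 h1 hv => [|c v] /= e6 e1 e0 h1 hv.
    have [u1 [a1 [m [hu1 hs hL hm]]]] : exists u1 a1 m, [/\ blank \notin u1, size u1 <= size u,
        rev (belast blank u) ++ nseq a blank = rev u1 ++ nseq a1 blank
        & u1 ++ last blank u :: behead (nseq n blank) = u ++ nseq m blank].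
      case: (u) hu => [|x u'] hu.
        by exists [::], a, n.-1.+1; split => //=; case: (n).
      exists (belast x u'), a.+1, n.-1; rewrite size_belast; split=> //=.
      - by apply/negP => /mem_belast; apply/negP.
      - by rewrite rev_cons cat_rcons.
      by rewrite -cat1s catA belast_last; case: (n).
    have [a' h3] := @back_run _ popF (inr (inr None)) None (fun c => erefl) u1 a1 (nseq n blank)
      (last blank u) hu1.
    exists (mktp (nseq a' blank) (u ++ nseq m blank)).
      by exists a', m; rewrite e1 cats0.
    apply: (@runs_le _ _ _ ((size u1).+1 + (1 + size u))).
      by rewrite /lsz e1 cats0; lia.
    rewrite /runs e0 iterD iterD h1 -hm -h3 -hL; congr (iter _ _ _).
    by rewrite /fstep /= inordK //; case: (n).
  have hc : c = sepS by move: e6; rewrite !inE => /eqP[].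
  rewrite hc in e0 h1 e1 hv.
  have hub : blank \notin u ++ belast sepS v.
    rewrite mem_cat negb_or hu; apply/negP => /mem_belast.
    by apply/negP.
  have [a' h3] := @back_run _ popF (inr (inr None)) None (fun c => erefl) _ a.+1 (nseq n blank)
    (last sepS v) hub.
  exists (mktp (nseq a' blank) ((u ++ belast sepS v) ++ last sepS v :: behead (nseq n blank))).
    exists a', n.-1; congr mktp; rewrite e1 -[last _ _ :: _]cat1s !catA -(catA u) belast_last.
    by rewrite -!catA /=; case: (n).
  apply: (@runs_le _ _ _ ((size (u ++ belast sepS v)).+1 + ((size v).+1 + (1 + size u)))).
    by rewrite /lsz e1 !size_cat size_belast /=; lia.
  rewrite /runs e0 iterD iterD iterD h1 -h3.
  congr (iter _ _ _).
  have -> : mktp (rev (u ++ belast sepS v) ++ nseq a.+1 blank) (nseq n blank) =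
    mktp (rev (belast sepS v) ++ (last blank u :: rev (belast blank u) ++ nseq a blank)) (nseq n blank).
    congr mktp; rewrite rev_cat -catA; congr (_ ++ _).
    rewrite -cat_cons -rev_rcons -lastI rev_cons cat_rcons; congr (_ ++ _).
  have hv' : blank \notin v by move: hv; rewrite in_cons negb_or => /andP[].
  rewrite -(@ins_run _ popF (fun c => inr (inl c)) (inr (inr None)) (fun _ _ => erefl)) //.
  by congr (iter _ _ _); rewrite /fstep /= inordK.
(* If [u] is empty, nothing has to be shifted: the bit is blanked and the layout starts one cell
   further right. *)
case: u hu e0 e1 e2 h1 e4 {e3} => [|x u] hu e0 e1 e2 h1 e4.
  exists (mktp (blank :: nseq a blank) (map bitS s' ++ v ++ nseq n blank)).
    by exists a.+1, n; rewrite e2 es /= -!catA.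
  apply: (@runs_le _ _ _ 1); first by lia.
  have -> : runs popF (mktp (nseq a blank) (lay ss ++ nseq n blank)) 1 (ohead s)
     (mktp (blank :: nseq a blank) ([seq bitS i | i <- s'] ++ v ++ nseq n blank)) =
     (iter 1 (@fstep _ popF) (inl (inl (inord 0, blank)), mktp (nseq a blank) (map bitS s ++ v ++ nseq n blank)) =
    (inr (ohead s), mktp (blank :: nseq a blank) ([seq bitS i | i <- s'] ++ v ++ nseq n blank))).
    by rewrite /runs e0 -h1.
  by rewrite /= /fstep es /= inordK.
have hu1 : blank \notin belast x u by apply/negP => /mem_belast; apply/negP.
have [a' h3] := @back_run _ popF (inr (inr (Some b))) (Some b) (fun c => erefl) _ a.+1
  (map bitS s ++ v ++ nseq n blank) (last x u) hu1.
exists (mktp (nseq a' blank) (belast x u ++ last x u :: behead (map bitS s ++ v ++ nseq n blank))).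
  by exists a', n; congr mktp; rewrite e2 es /= -cat1s catA belast_last -!catA.
apply: (@runs_le _ _ _ ((size (belast x u)).+1 + (1 + size (x :: u)))).
  by rewrite /lsz e1 !size_cat size_belast /=; lia.
rewrite /runs e0 iterD iterD h1 es -es [ohead s]/= {2}es [ohead _]/= -h3.
congr (iter _ _ _); rewrite rev_cons cat_rcons /= /fstep es /= inordK //=.
by move: e4 => /= ->.
Qed.

End Pop.

(** * Programs on stacks *)

Section MapF.
Variables (E1 E2 : finType) (h : E1 -> E2) (F : frag E1).
Definition map_d (q : fQ F) (s : sym) : (fQ F + E2) * sym * bool :=
  let: (x, s', d) := fd q s in (match x with inl q' => inl q' | inr e => inr (h e) end, s', d).
Definition mapF : frag E2 := Frag (fq0 F) map_d.

Lemma runs_map tp t e tp' : runs F tp t e tp' -> runs mapF tp t (h e) tp'.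
Proof.
pose emb (st : (fQ F + E1) * tape) : (fQ mapF + E2) * tape :=
  (match st.1 with inl q => inl q | inr e => inr (h e) end, st.2).
have sim st : iter t (@fstep _ mapF) (emb st) = emb (iter t (@fstep _ F) st).
  elim: t => //= t ->; case: (iter t _ st) => [[q|e0] tp1] //=.
  by rewrite /fstep /emb /= /map_d; case: (fd q tp1.1.2) => [[[q'|e'] s] d].
by rewrite /runs => hr; rewrite -[(inl _, tp)]/(emb (inl (fq0 F), tp)) sim hr.
Qed.
End MapF.

(** [push_run] and [pop_run] take at most [2 * s + 4] steps on a content of size [s], and each
    operation enlarges the content by at most one cell, so [s] stays below [lsz ss + t]. *)
Definition cost ss t := t * (2 * (lsz ss + t) + 4).

(* [t] counts stack operations; each costs a number of machine steps linear in the tape content. *)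
Definition tr (E : finType) (F : frag E) ss t e ss' : Prop :=
  lsz ss' <= lsz ss + t /\
  forall tp, Rep ss tp -> exists2 tp', Rep ss' tp' & runs F tp (cost ss t) e tp'.

Lemma cost_le ss t t' : t <= t' -> cost ss t <= cost ss t'.
Proof. by move=> h; rewrite /cost; apply: leq_mul => //; lia. Qed.

Lemma cost_add ss ss' t t' : lsz ss' <= lsz ss + t -> cost ss t + cost ss' t' <= cost ss (t + t').
Proof. rewrite /cost; move: (lsz ss) (lsz ss') => a b; nia. Qed.

Lemma tr_le (E : finType) (F : frag E) ss t t' e ss' : t <= t' -> tr F ss t e ss' -> tr F ss t' e ss'.
Proof.
move=> h [h1 h2]; split; first by lia.
by move=> tp /h2[tp' r1 r2]; exists tp' => //; apply: runs_le r2; apply: cost_le.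
Qed.

Lemma tr_bind (E1 E2 : finType) (F : frag E1) (G : E1 -> frag E2) ss t1 e1 ss1 t2 e2 ss2 :
  tr F ss t1 e1 ss1 -> tr (G e1) ss1 t2 e2 ss2 -> tr (bindF F G) ss (t1 + t2) e2 ss2.
Proof.
move=> [h1 h2] [h3 h4]; split; first by lia.
move=> tp /h2[tp1 r1 q1]; have [tp2 r2 q2] := h4 _ r1; exists tp2 => //.
by apply: runs_le (runs_bind q1 q2); apply: cost_add.
Qed.

Lemma tr_map (E1 E2 : finType) (h : E1 -> E2) (F : frag E1) ss t e ss' :
  tr F ss t e ss' -> tr (mapF h F) ss t (h e) ss'.
Proof. by move=> [h1 h2]; split=> // tp /h2[tp' r q]; exists tp' => //; apply: runs_map. Qed.

Lemma tr_loop_exit (E : finType) (F : frag (option E)) ss t e ss' :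
  tr F ss t (Some e) ss' -> tr (loopF F) ss t e ss'.
Proof. by move=> [h1 h2]; split=> // tp /h2[tp' r q]; exists tp' => //; apply: runs_loop_exit. Qed.

Lemma tr_loop_again (E : finType) (F : frag (option E)) ss t ss1 t2 e ss2 :
  tr F ss t None ss1 -> tr (loopF F) ss1 t2 e ss2 -> tr (loopF F) ss (t + t2) e ss2.
Proof.
move=> [h1 h2] [h3 h4]; split; first by lia.
move=> tp /h2[tp1 r1 q1]; have [tp2 r2 q2] := h4 _ r1; exists tp2 => //.
by apply: runs_le (runs_loop_again q1 q2); apply: cost_add.
Qed.

Lemma lsz_set ss i s : i < size ss ->
  lsz (set_nth [::] ss i s) + size (nth [::] ss i) = lsz ss + size s.
Proof.
move=> /lay_split[u [v [e1 e2 _ _ _]]].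
by rewrite /lsz e1 e2 !size_cat !size_map; lia.
Qed.

Lemma tr_push ss i b : i < size ss -> tr (pushF i b) ss 1 tt (set_nth [::] ss i (b :: nth [::] ss i)).
Proof.
move=> hi; split; first by have := lsz_set (b :: nth [::] ss i) hi; rewrite /=; lia.
move=> tp /(push_run b hi)[tp' r q]; exists tp' => //.
by apply: runs_le q; rewrite /cost; lia.
Qed.

Lemma tr_pop ss i : i < size ss ->
  tr (popF i) ss 1 (ohead (nth [::] ss i)) (set_nth [::] ss i (behead (nth [::] ss i))).
Proof.
move=> hi; split; first by have := lsz_set (behead (nth [::] ss i)) hi; rewrite size_behead; lia.
move=> tp /(pop_run hi)[tp' r q]; exists tp' => //.
by apply: runs_le q; rewrite /cost; lia.
Qed.

(** A fragment starts in a proper state, never in an exit, so even returning a value takes some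
    work: here a push that is undone by a pop. *)
Definition retF (E : finType) (e : E) : frag E :=
  bindF (pushF 0 true) (fun _ => mapF (fun _ => e) (popF 0)).

Lemma tr_ret (E : finType) (e : E) s ss : tr (retF e) (s :: ss) 2 e (s :: ss).
Proof.
apply: (@tr_bind _ _ _ _ _ 1 tt _ 1 e); first exact: (@tr_push (s :: ss) 0 true).
exact: (tr_map (fun=> e) (@tr_pop ((true :: s) :: ss) 0 isT)).
Qed.

Definition seqF (E : finType) (F : frag unit) (G : frag E) : frag E := bindF F (fun _ => G).

Lemma tr_seq (E : finType) (F : frag unit) (G : frag E) ss t1 ss1 t2 e ss2 :
  tr F ss t1 tt ss1 -> tr G ss1 t2 e ss2 -> tr (seqF F G) ss (t1 + t2) e ss2.
Proof. exact: tr_bind. Qed.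

(** * Binary trees on a stack: parsing, copying, swapping, comparing *)

Inductive tree := Lf | Nd of tree & tree.

(** Preorder notation is prefix-free, so a tree on top of a stack needs no end marker. *)
Fixpoint code (t : tree) : seq bool :=
  if t is Nd a b then true :: code a ++ code b else [:: false].

Definition tsz t := size (code t).

Lemma tsz_gt0 t : 0 < tsz t. Proof. by case: t. Qed.

Lemma tsz_Nd a b : tsz (Nd a b) = (tsz a + tsz b).+1.
Proof. by rewrite /tsz /= size_cat. Qed.

Lemma code_inj a b u v : code a ++ u = code b ++ v -> a = b /\ u = v.
Proof.
elim: a b u v => [|a1 IH1 a2 IH2] [|b1 b2] u v //= [].
  by move->.
by rewrite -!catA => /IH1[-> /IH2[-> ->]].
Qed.

Section Primitives.
Variables (R : seq (seq bool)).

(* The four working stacks: 0 carries the data, 2 is the parsing counter, 1 and 3 are buffers. *)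
Definition wk s0 s1 s2 s3 : seq (seq bool) := [:: s0, s1, s2, s3 & R].

(* Stacks 1 and 3 are interchangeable; the flag says which of them holds u, the other one holds w. *)
Definition pk (third : bool) s0 u w c := if third then wk s0 w c u else wk s0 u c w.

(** Stack 2 holds in unary the number of subtrees still to be read; a node replaces one pending
    subtree by two. *)
Definition parse_body (j : nat) : frag (option unit) :=
  bindF (popF 2) (fun o => if o is None then retF (Some tt) else
  bindF (popF 0) (fun o =>
    if o is Some true
    then seqF (pushF j true) (seqF (pushF 2 true) (seqF (pushF 2 true) (retF None)))
    else seqF (pushF j false) (retF None))).

Definition parseF (third : bool) : frag unit :=
  seqF (pushF 2 true) (loopF (parse_body (if third then 3 else 1))).

Lemma pk_pop2 th s0 u w c : tr (popF 2) (pk th s0 u w c) 1 (ohead c) (pk th s0 u w (behead c)).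
Proof. by case: th; [apply: (@tr_pop (wk s0 w c u) 2) | apply: (@tr_pop (wk s0 u c w) 2)]. Qed.
Lemma pk_push2 th s0 u w c b : tr (pushF 2 b) (pk th s0 u w c) 1 tt (pk th s0 u w (b :: c)).
Proof. by case: th; [apply: (@tr_push (wk s0 w c u) 2) | apply: (@tr_push (wk s0 u c w) 2)]. Qed.
Lemma pk_pop0 th s0 u w c : tr (popF 0) (pk th s0 u w c) 1 (ohead s0) (pk th (behead s0) u w c).
Proof. by case: th; [apply: (@tr_pop (wk s0 w c u) 0) | apply: (@tr_pop (wk s0 u c w) 0)]. Qed.
Lemma pk_push0 th s0 u w c b : tr (pushF 0 b) (pk th s0 u w c) 1 tt (pk th (b :: s0) u w c).
Proof. by case: th; [apply: (@tr_push (wk s0 w c u) 0) | apply: (@tr_push (wk s0 u c w) 0)]. Qed.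
Definition pj (th : bool) := if th then 3 else 1.
Lemma pk_popj th s0 u w c : tr (popF (pj th)) (pk th s0 u w c) 1 (ohead u) (pk th s0 (behead u) w c).
Proof. by case: th; [apply: (@tr_pop (wk s0 w c u) 3) | apply: (@tr_pop (wk s0 u c w) 1)]. Qed.
Lemma pk_pushj th s0 u w c b : tr (pushF (pj th) b) (pk th s0 u w c) 1 tt (pk th s0 (b :: u) w c).
Proof. by case: th; [apply: (@tr_push (wk s0 w c u) 3) | apply: (@tr_push (wk s0 u c w) 1)]. Qed.
Lemma pk_swap th s0 u w c : pk th s0 u w c = pk (~~ th) s0 w u c.
Proof. by case: th. Qed.
Lemma pk_pushj' th s0 u w c b : tr (pushF (pj (~~ th)) b) (pk th s0 u w c) 1 tt (pk th s0 u (b :: w) c).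
Proof. by rewrite !(pk_swap th); apply: pk_pushj. Qed.
Lemma pk_popj' th s0 u w c : tr (popF (pj (~~ th))) (pk th s0 u w c) 1 (ohead w) (pk th s0 u (behead w) c).
Proof. by rewrite !(pk_swap th); apply: pk_popj. Qed.
Lemma pk_ret (E : finType) (e : E) th s0 u w c : tr (retF e) (pk th s0 u w c) 2 e (pk th s0 u w c).
Proof. by case: th; apply: tr_ret. Qed.

(** The remaining run is taken as a hypothesis, so that the induction can chain the two subtrees of
    a node. A bit of the code costs at most 7 operations. *)
Lemma parse_loop th x rest u w c t ss' :
  tr (loopF (parse_body (pj th))) (pk th rest (rev (code x) ++ u) w c) t tt ss' ->
  tr (loopF (parse_body (pj th))) (pk th (code x ++ rest) u w (true :: c)) (t + 7 * tsz x) tt ss'.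
Proof.
elim: x rest u c t => [|a IHa b IHb] rest u c t h.
  apply: (@tr_le _ _ _ (1 + (1 + (1 + 2)) + t)); first by rewrite /tsz /=; lia.
  apply: tr_loop_again h.
  apply: tr_bind; first exact: pk_pop2.
  apply: tr_bind; first exact: pk_pop0.
  by apply: tr_seq; [exact: pk_pushj | exact: pk_ret].
apply: (@tr_le _ _ _ ((1 + (1 + (1 + (1 + (1 + 2))))) + (t + 7 * tsz b + 7 * tsz a))).
  by rewrite tsz_Nd; lia.
apply: (@tr_loop_again _ _ _ _ (pk th (code a ++ code b ++ rest) (true :: u) w [:: true, true & c])).
  apply: tr_bind; first exact: pk_pop2.
  apply: tr_bind; first exact: pk_pop0.
  rewrite /= -catA.
  apply: tr_seq; first exact: pk_pushj.
  apply: tr_seq; first exact: pk_push2.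
  by apply: tr_seq; [exact: pk_push2 | exact: pk_ret].
apply: IHa; apply: IHb; move: h; congr tr.
by rewrite /= rev_cons rev_cat -cats1 -!catA.
Qed.

Lemma tr_parse th x rest u w :
  tr (parseF th) (pk th (code x ++ rest) u w [::]) (7 * tsz x + 4) tt (pk th rest (rev (code x) ++ u) w [::]).
Proof.
apply: (@tr_le _ _ _ (1 + (3 + 7 * tsz x))); first by lia.
apply: tr_seq; first exact: pk_push2.
apply: parse_loop; apply: tr_loop_exit.
by apply: (@tr_bind _ _ _ _ _ 1 _ _ 2); [exact: pk_pop2 | exact: pk_ret].
Qed.

Definition moveF (j l : nat) : frag unit := loopF (bindF (popF j) (fun o =>
  if o is Some b then seqF (pushF l b) (retF None) else retF (Some tt))).

Lemma tr_move0 th s0 u w c : tr (moveF (pj th) 0) (pk th s0 u w c) (4 * size u + 3) tt (pk th (rev u ++ s0) [::] w c).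
Proof.
elim: u s0 => [|b u IH] s0.
  by apply: tr_loop_exit; apply: (@tr_bind _ _ _ _ _ 1 _ _ 2); [exact: pk_popj | exact: pk_ret].
apply: (@tr_le _ _ _ ((1 + (1 + 2)) + (4 * size u + 3))); first by rewrite /=; lia.
rewrite rev_cons cat_rcons; apply: tr_loop_again; last exact: IH.
apply: tr_bind; first exact: pk_popj.
by apply: tr_seq; [exact: pk_push0 | exact: pk_ret].
Qed.

Lemma tr_movej th s0 u w c :
  tr (moveF (pj th) (pj (~~ th))) (pk th s0 u w c) (4 * size u + 3) tt (pk th s0 [::] (rev u ++ w) c).
Proof.
elim: u w => [|b u IH] w.
  by apply: tr_loop_exit; apply: (@tr_bind _ _ _ _ _ 1 _ _ 2); [exact: pk_popj | exact: pk_ret].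
apply: (@tr_le _ _ _ ((1 + (1 + 2)) + (4 * size u + 3))); first by rewrite /=; lia.
rewrite rev_cons cat_rcons; apply: tr_loop_again; last exact: IH.
apply: tr_bind; first exact: pk_popj.
by apply: tr_seq; [exact: pk_pushj' | exact: pk_ret].
Qed.

Definition copy_body : frag (option unit) := bindF (popF (pj false)) (fun o =>
  if o is Some b then seqF (pushF 0 b) (seqF (pushF (pj true) b) (retF None)) else retF (Some tt)).

Lemma tr_copy s0 u w c :
  tr (loopF copy_body) (pk false s0 u w c) (5 * size u + 3) tt (pk false (rev u ++ s0) [::] (rev u ++ w) c).
Proof.
elim: u s0 w => [|b u IH] s0 w.
  by apply: tr_loop_exit; apply: (@tr_bind _ _ _ _ _ 1 _ _ 2); [exact: pk_popj | exact: pk_ret].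
apply: (@tr_le _ _ _ ((1 + (1 + (1 + 2))) + (5 * size u + 3))); first by rewrite /=; lia.
rewrite rev_cons !cat_rcons; apply: tr_loop_again; last exact: IH.
apply: tr_bind; first exact: pk_popj.
apply: tr_seq; first exact: pk_push0.
by apply: tr_seq; [exact: pk_pushj' | exact: pk_ret].
Qed.

Definition ws s0 := wk s0 [::] [::] [::].
Lemma ws_pk th s0 : ws s0 = pk th s0 [::] [::] [::]. Proof. by case: th. Qed.

(** Every transfer reverses its string. Parsing and copying back restore the orientation on stack 0,
    while the second copy lies on stack 3 and needs a detour over stack 1 to arrive the right way
    round. *)
Definition dupF : frag unit :=
  seqF (parseF false) (seqF (loopF copy_body) (seqF (moveF 3 1) (moveF 1 0))).

Lemma tr_dup x rest : tr dupF (ws (code x ++ rest)) (20 * tsz x + 13) tt (ws (code x ++ code x ++ rest)).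
Proof.
apply: (@tr_le _ _ _ ((7 * tsz x + 4) + ((5 * tsz x + 3) + ((4 * tsz x + 3) + (4 * tsz x + 3))))); first by lia.
rewrite !(ws_pk false); apply: tr_seq; first exact: tr_parse.
have e : size (rev (code x) ++ [::]) = tsz x by rewrite cats0 size_rev.
apply: tr_seq; first by rewrite -{1}e; apply: tr_copy.
rewrite cats0 revK cats0 !(pk_swap false) /=.
apply: tr_seq; first exact: (@tr_movej true).
rewrite cats0 -(pk_swap false).
by have := @tr_move0 false (code x ++ rest) (rev (code x)) [::] [::]; rewrite size_rev revK; apply.
Qed.

Definition swapF : frag unit :=
  seqF (parseF false) (seqF (parseF true) (seqF (moveF 1 0) (moveF 3 0))).

Lemma tr_swap x y rest :
  tr swapF (ws (code x ++ code y ++ rest)) (11 * (tsz x + tsz y) + 14) tt (ws (code y ++ code x ++ rest)).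
Proof.
apply: (@tr_le _ _ _ ((7 * tsz x + 4) + ((7 * tsz y + 4) + ((4 * tsz x + 3) + (4 * tsz y + 3))))); first by lia.
rewrite !(ws_pk false); apply: tr_seq; first exact: tr_parse.
rewrite pk_swap; apply: tr_seq; first exact: (@tr_parse true).
rewrite -(pk_swap false) !cats0; apply: tr_seq.
  by have := @tr_move0 false rest (rev (code x)) (rev (code y)) [::]; rewrite size_rev revK; apply.
rewrite !(pk_swap false) /=.
by have := @tr_move0 true (code x ++ rest) (rev (code y)) [::] [::]; rewrite size_rev revK; apply.
Qed.

Definition dropF : frag unit := seqF (parseF false)
  (loopF (bindF (popF 1) (fun o => retF (if o is Some _ then None else Some tt)))).

Lemma tr_clear th s0 u w c :
  tr (loopF (bindF (popF (pj th)) (fun o => retF (if o is Some _ then None else Some tt))))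
     (pk th s0 u w c) (3 * size u + 3) tt (pk th s0 [::] w c).
Proof.
elim: u => [|b u IH].
  by apply: tr_loop_exit; apply: (@tr_bind _ _ _ _ _ 1 _ _ 2); [exact: pk_popj | exact: pk_ret].
apply: (@tr_le _ _ _ ((1 + 2) + (3 * size u + 3))); first by rewrite /=; lia.
apply: tr_loop_again IH.
by apply: tr_bind; [exact: pk_popj | exact: pk_ret].
Qed.

Lemma tr_drop x rest : tr dropF (ws (code x ++ rest)) (10 * tsz x + 7) tt (ws rest).
Proof.
apply: (@tr_le _ _ _ ((7 * tsz x + 4) + (3 * tsz x + 3))); first by lia.
rewrite !(ws_pk false); apply: tr_seq; first exact: tr_parse.
by have := @tr_clear false rest (rev (code x)) [::] [::]; rewrite size_rev cats0; apply.
Qed.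

Definition cmp_body : frag (option bool) := bindF (popF 1) (fun o => bindF (popF 3) (fun o' =>
  retF (match o, o' with
        | None, None => Some true
        | Some b, Some b' => if b == b' then None else Some false
        | _, _ => Some false end))).

(** The comparison stops at the first difference; the remainders [u'] and [w'] are left for [eqF] to
    clear. *)
Lemma tr_cmp s0 u w c : exists u' w', [/\ size u' <= size u, size w' <= size w &
  tr (loopF cmp_body) (pk false s0 u w c) (4 * size u + 4) (u == w) (pk false s0 u' w' c)].
Proof.
elim: u w => [|b u IH] w.
  exists [::], (behead w); split; rewrite ?size_behead ?leq_pred //.
  apply: tr_loop_exit; apply: (@tr_bind _ _ _ _ _ 1 _ _ (1 + 2)); first exact: pk_popj.
  apply: tr_bind; first exact: (@pk_popj' false).
  have -> : Some ([::] == w) = match ohead w with Some _ => Some false | None => Some true end by case: w.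
  exact: pk_ret.
case: w => [|b' w]; first exists u, [::].
  split => //; apply: tr_loop_exit; apply: (@tr_le _ _ _ (1 + (1 + 2))); first by lia.
  apply: (@tr_bind _ _ _ _ _ 1 _ _ (1 + 2)); first exact: pk_popj.
  by apply: tr_bind; [exact: (@pk_popj' false) | exact: pk_ret].
rewrite eqseq_cons.
have step : tr cmp_body (pk false s0 (b :: u) (b' :: w) c) (1 + (1 + 2))
   (if b == b' then None else Some false) (pk false s0 u w c).
  apply: tr_bind; first exact: pk_popj.
  by apply: tr_bind; [exact: (@pk_popj' false) | exact: pk_ret].
case: eqP step => /= _ step.
  have [u' [w' [h1 h2 h3]]] := IH w; exists u', w'; split => //=; try lia.
  apply: (@tr_le _ _ _ (1 + (1 + 2) + (4 * size u + 4))); first by lia.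
  exact: tr_loop_again h3.
exists u, w; split => //; apply: tr_loop_exit; apply: tr_le step; lia.
Qed.

Definition boolt (b : bool) : tree := if b then Nd Lf Lf else Lf.

Definition push_bool (b : bool) : frag unit :=
  if b then seqF (pushF 0 false) (seqF (pushF 0 false) (pushF 0 true)) else pushF 0 false.

Definition clearF j : frag unit :=
  loopF (bindF (popF j) (fun o => retF (if o is Some _ then None else Some tt))).

Definition eqF : frag unit := seqF (parseF false) (seqF (parseF true)
  (bindF (loopF cmp_body) (fun b => seqF (clearF 1) (seqF (clearF 3) (push_bool b))))).

Lemma code_eq x y : (rev (code x) == rev (code y)) = (code x == code y).
Proof. by apply/eqP/eqP => [/(congr1 rev)|->//]; rewrite !revK. Qed.

Lemma tr_push_bool th b s0 u w c : tr (push_bool b) (pk th s0 u w c) 3 tt (pk th (code (boolt b) ++ s0) u w c).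
Proof.
case: b; last by apply: (@tr_le _ _ _ 1) => //; exact: pk_push0.
apply: (@tr_seq _ _ _ _ 1 _ 2); first exact: pk_push0.
by apply: (@tr_seq _ _ _ _ 1 _ 1); exact: pk_push0.
Qed.

Lemma tr_eq x y rest : tr eqF (ws (code x ++ code y ++ rest)) (14 * (tsz x + tsz y) + 21) tt
  (ws (code (boolt (code x == code y)) ++ rest)).
Proof.
rewrite (ws_pk false).
have [u' [w' [h1 h2 h3]]] := tr_cmp rest (rev (code x) ++ [::]) (rev (code y) ++ [::]) [::].
apply: (@tr_le _ _ _ ((7 * tsz x + 4) + ((7 * tsz y + 4) + ((4 * tsz x + 4) +
   ((3 * size u' + 3) + ((3 * size w' + 3) + 3)))))).
  by move: h1 h2; rewrite !cats0 !size_rev -/(tsz _) -/(tsz _); lia.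
apply: tr_seq; first exact: tr_parse.
rewrite pk_swap; apply: tr_seq; first exact: (@tr_parse true).
rewrite -(pk_swap false).
apply: tr_bind; first by move: h3; rewrite !cats0 size_rev; apply.
rewrite code_eq; apply: tr_seq; first exact: (@tr_clear false).
rewrite pk_swap; apply: tr_seq; first exact: (@tr_clear true).
rewrite (ws_pk true); exact: tr_push_bool.
Qed.

End Primitives.

(** * Polynomial-time functions on encoded data *)

(** The base [n.+2] is at least 2 even for [n = 0], so constants and sums are absorbed by raising
    the exponent. *)
Definition polyb (f : nat -> nat) := exists k, forall n, f n <= n.+2 ^ k.

Lemma leq_pexp n j k : j <= k -> n.+2 ^ j <= n.+2 ^ k.
Proof. by move=> h; rewrite leq_exp2l. Qed.

Lemma polyb_le f g : (forall n, f n <= g n) -> polyb g -> polyb f.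
Proof. by move=> h [k hk]; exists k => n; apply: leq_trans (h n) (hk n). Qed.

Lemma leq_expb m n k : m <= n -> m ^ k <= n ^ k.
Proof. by move=> h; case: k => // k; rewrite leq_exp2r. Qed.

Lemma polyb_id : polyb id. Proof. by exists 1 => n; rewrite expn1; lia. Qed.

Lemma polyb_const c : polyb (fun _ => c).
Proof.
exists c => n; apply: (leq_trans (ltnW (ltn_expl c (ltnSn 1)))).
by elim: (c) => // m IH; rewrite !expnS; apply: leq_mul.
Qed.

Lemma polyb_mul f g : polyb f -> polyb g -> polyb (fun n => f n * g n).
Proof. by move=> [j hj] [k hk]; exists (j + k) => n; rewrite expnD; apply: leq_mul. Qed.

Lemma polyb_add f g : polyb f -> polyb g -> polyb (fun n => f n + g n).
Proof.
move=> [j hj] [k hk]; exists (maxn j k).+1 => n; rewrite expnS.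
apply: (@leq_trans (n.+2 ^ maxn j k + n.+2 ^ maxn j k)).
  by apply: leq_add; [apply: leq_trans (hj n) _ | apply: leq_trans (hk n) _];
    apply: leq_pexp; lia.
by rewrite addnn -mul2n leq_mul.
Qed.

Lemma polyb_exp f k : polyb f -> polyb (fun n => f n ^ k).
Proof.
move=> hf; elim: k => [|k IH]; first by apply: polyb_le (polyb_const 1).
by apply: polyb_le (polyb_mul hf IH) => n; rewrite expnS.
Qed.

Lemma polyb_comp f g : polyb f -> polyb g -> polyb (fun n => g (f n)).
Proof.
move=> [j hj] [k hk]; suff: polyb (fun n => (n.+2 ^ j + 2) ^ k).
  by apply: polyb_le => n; apply: leq_trans (hk _) _; apply: leq_expb; have := hj n; lia.
by apply: polyb_exp; apply: polyb_add; [exists j => n | apply: polyb_const].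
Qed.

Lemma polyb_S f : polyb f -> polyb (fun n => (f n).+1).
Proof. by move=> h; apply: polyb_le (polyb_add h (polyb_const 1)) => n; lia. Qed.

Class Enc (A : Type) := enc : A -> tree.
Definition sz (A : Type) {eA : Enc A} (a : A) : nat := tsz (enc a).

(* The argument lies on top of stack 0; what is below it and the further stacks R are left alone. *)
Definition PT (A B : Type) {eA : Enc A} {eB : Enc B} (f : A -> B) : Prop :=
  exists F : frag unit, exists k, forall a rest R,
    tr F (ws R (code (enc a) ++ rest)) ((sz a).+2 ^ k) tt (ws R (code (enc (f a)) ++ rest)).

#[global] Instance Enc_unit : Enc unit := fun _ => Lf.
#[global] Instance Enc_bool : Enc bool := boolt.
#[global] Instance Enc_prod A B {eA : Enc A} {eB : Enc B} : Enc (A * B) := fun p => Nd (enc p.1) (enc p.2).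
Fixpoint enc_seq A (eA : Enc A) (l : seq A) := if l is a :: l' then Nd (enc a) (enc_seq eA l') else Lf.
#[global] Instance Enc_seq A {eA : Enc A} : Enc (seq A) := enc_seq eA.
Fixpoint enc_unary (n : nat) := if n is m.+1 then Nd Lf (enc_unary m) else Lf.
#[global] Instance Enc_nat : Enc nat := enc_unary.

Section PTbasic.
Context {A B C D : Type} {eA : Enc A} {eB : Enc B} {eC : Enc C} {eD : Enc D}.

Lemma sz_pair (a : A) (b : B) : sz (a, b) = (sz a + sz b).+1.
Proof. exact: tsz_Nd. Qed.

Lemma sz_cons (a : A) (l : seq A) : sz (a :: l) = (sz a + sz l).+1.
Proof. exact: tsz_Nd. Qed.

Lemma sz_gt0 (a : A) : 0 < sz a. Proof. exact: tsz_gt0. Qed.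

Lemma PT_intro (f : A -> B) (F : frag unit) (T : nat -> nat) : polyb T ->
  (forall a rest R, tr F (ws R (code (enc a) ++ rest)) (T (sz a)) tt (ws R (code (enc (f a)) ++ rest))) ->
  PT f.
Proof. by move=> [k hk] h; exists F, k => a rest R; apply: tr_le (hk _) (h a rest R). Qed.

Lemma PT_elim (f : A -> B) : PT f -> exists F : frag unit, exists2 T : nat -> nat, polyb T &
  (forall n m, n <= m -> T n <= T m) /\
  forall a rest R, tr F (ws R (code (enc a) ++ rest)) (T (sz a)) tt (ws R (code (enc (f a)) ++ rest)).
Proof.
move=> [F [k h]]; exists F, (fun n => n.+2 ^ k); first by exists k.
by split=> // n m h'; apply: leq_expb.
Qed.

Lemma PT_ext (f g : A -> B) : f =1 g -> PT f -> PT g.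
Proof. by move=> e [F [k h]]; exists F, k => a rest R; rewrite -e. Qed.

Lemma lsz_ws R s : lsz (ws R s) = size s + lsz (ws R [::]).
Proof. by rewrite /lsz /ws /wk !lay_cons !size_cat !size_map. Qed.

(** A stack operation adds at most one cell, so a bound on the time also bounds the growth of the
    data. *)
Lemma PT_size (f : A -> B) : PT f -> exists2 p, polyb p & forall a, sz (f a) <= p (sz a).
Proof.
move=> [F [k h]]; exists (fun n => n + n.+2 ^ k).
  by apply: polyb_add; [apply: polyb_id | exists k].
move=> a; have [+ _] := h a [::] [::]; rewrite !(lsz_ws [::] (_ ++ _)) !cats0.
by rewrite /sz /tsz; lia.
Qed.

(** What is the identity on codes requires no computation; in this way data change their type. *)
Lemma PT_cast (f : A -> B) : (forall a, enc (f a) = enc a) -> PT f.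
Proof.
move=> h; apply: (@PT_intro _ (retF tt) (fun _ => 2)); first exact: polyb_const.
by move=> a rest R; rewrite h; apply: tr_ret.
Qed.

End PTbasic.

Section PTcomb.
Context {A B C D : Type} {eA : Enc A} {eB : Enc B} {eC : Enc C} {eD : Enc D}.

Lemma PT_comp (g : B -> C) (f : A -> B) : PT g -> PT f -> PT (fun x => g (f x)).
Proof.
move=> hg hf; have [p pp hp] := PT_size hf.
have [F [T1 p1 [_ h1]]] := PT_elim hf; move: hg => [G [k h2]].
apply: (@PT_intro _ _ _ _ _ (seqF F G) (fun n => T1 n + (p n).+2 ^ k)) => [|a rest R].
  apply: polyb_add => //; apply: polyb_exp; do 2 apply: polyb_S; exact: pp.
apply: tr_seq (h1 a rest R) _; apply: tr_le (h2 (f a) rest R).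
by apply: leq_expb; rewrite !ltnS.
Qed.

Lemma PT_id : PT (fun a : A => a). Proof. exact: PT_cast. Qed.

Lemma ws_push R b s : tr (pushF 0 b) (ws R s) 1 tt (ws R (b :: s)).
Proof. by rewrite !(ws_pk R false); apply: pk_push0. Qed.
Lemma ws_pop R s : tr (popF 0) (ws R s) 1 (ohead s) (ws R (behead s)).
Proof. by rewrite !(ws_pk R false); apply: pk_pop0. Qed.

Lemma PT_pair (f : A -> B) (g : A -> C) : PT f -> PT g -> PT (fun x => (f x, g x)).
Proof.
move=> hf hg; have [p pp hp] := PT_size hf; have [q qq hq] := PT_size hg.
have [F [T1 p1 [_ h1]]] := PT_elim hf; have [G [T2 p2 [_ h2]]] := PT_elim hg.
apply: (@PT_intro _ _ _ _ _ (seqF dupF (seqF F (seqF swapF (seqF G (seqF swapF (pushF 0 true))))))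
  (fun n => 20 * n + 13 + (T1 n + (11 * (p n + n) + 14 + (T2 n + (11 * (q n + p n) + 14 + 1)))))).
  by repeat first [exact: polyb_id | assumption | exact: polyb_const | apply: polyb_add | apply: polyb_mul].
move=> a rest R; apply: tr_seq; first exact: tr_dup.
apply: tr_seq; first exact: h1.
apply: tr_seq; first by apply: tr_le (tr_swap R (enc (f a)) (enc a) rest); have := hp a; rewrite /sz; lia.
apply: tr_seq; first exact: h2.
apply: tr_seq; first by apply: tr_le (tr_swap R (enc (g a)) (enc (f a)) rest); have := hp a; have := hq a; rewrite /sz; lia.
by rewrite /= -catA; apply: ws_push.
Qed.

Lemma PT_fst : PT (fun p : A * B => p.1).
Proof.
apply: (@PT_intro _ _ _ _ _ (bindF (popF 0) (fun _ => seqF swapF dropF))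
  (fun n => 1 + (11 * n + 14 + (10 * n + 7)))).
  by repeat first [exact: polyb_id | exact: polyb_const | apply: polyb_add | apply: polyb_mul].
move=> [a b] rest R; rewrite sz_pair /= -catA.
apply: tr_bind; first exact: ws_pop.
apply: tr_seq; first by apply: tr_le (tr_swap R (enc a) (enc b) rest); rewrite /sz; lia.
by apply: tr_le (tr_drop R _ _); rewrite /sz; lia.
Qed.

Lemma PT_snd : PT (fun p : A * B => p.2).
Proof.
apply: (@PT_intro _ _ _ _ _ (bindF (popF 0) (fun _ => dropF)) (fun n => 1 + (10 * n + 7))).
  by repeat first [exact: polyb_id | exact: polyb_const | apply: polyb_add | apply: polyb_mul].
move=> [a b] rest R; rewrite sz_pair /= -catA.
apply: tr_bind; first exact: ws_pop.
by apply: tr_le (tr_drop R _ _); rewrite /sz; lia.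
Qed.

Fixpoint pushes (s : seq bool) : frag unit :=
  if s is b :: s' then seqF (pushes s') (pushF 0 b) else retF tt.

Lemma tr_pushes R s s0 : tr (pushes s) (ws R s0) (size s + 2) tt (ws R (s ++ s0)).
Proof.
elim: s => [|b s IH] /=; first exact: tr_ret.
apply: (@tr_le _ _ _ (size s + 2 + 1)); first by lia.
by apply: tr_seq IH (ws_push _ _ _).
Qed.

Lemma PT_const (c : B) : PT (fun _ : A => c).
Proof.
apply: (@PT_intro _ _ _ _ _ (seqF dropF (pushes (code (enc c)))) (fun n => 10 * n + 7 + (sz c + 2))).
  by repeat first [exact: polyb_id | exact: polyb_const | apply: polyb_add | apply: polyb_mul].
by move=> a rest R; apply: tr_seq (tr_drop _ _ _) (tr_pushes _ _ _).
Qed.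

Lemma PT_if2 (f g : A -> B) : PT f -> PT g -> PT (fun p : bool * A => if p.1 then f p.2 else g p.2).
Proof.
move=> hf hg.
have [F [T1 p1 [m1 h1]]] := PT_elim hf; have [G [T2 p2 [m2 h2]]] := PT_elim hg.
apply: (@PT_intro _ _ _ _ _ (bindF (popF 0) (fun _ => bindF (popF 0) (fun o =>
    if o is Some true then bindF (popF 0) (fun _ => bindF (popF 0) (fun _ => F)) else G)))
  (fun n => 4 + (T1 n + T2 n))).
  by repeat first [exact: polyb_id | assumption | exact: polyb_const | apply: polyb_add | apply: polyb_mul].
move=> [b a] rest R; rewrite sz_pair.
have [n1 n2] : T1 (sz a) <= T1 (sz b + sz a).+1 /\ T2 (sz a) <= T2 (sz b + sz a).+1.
  by split; [apply: m1 | apply: m2]; lia.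
case: b n1 n2 => n1 n2.
  apply: (@tr_le _ _ _ (1 + (1 + (1 + (1 + T1 (sz a)))))); first by lia.
  do 4 (apply: tr_bind; first exact: ws_pop).
  exact: h1.
apply: (@tr_le _ _ _ (1 + (1 + T2 (sz a)))); first by lia.
do 2 (apply: tr_bind; first exact: ws_pop).
exact: h2.
Qed.

(** The codes of [(c :: l, a)] and of [((c, l), a)] coincide: after inspecting two bits the program
    pushes them back and runs that of [g]. *)
Lemma PT_list2 (f : A -> B) (g : (C * seq C) * A -> B) : PT f -> PT g ->
  PT (fun p : seq C * A => if p.1 is c :: l then g ((c, l), p.2) else f p.2).
Proof.
move=> hf hg.
have [F [T1 p1 [m1 h1]]] := PT_elim hf; have [G [T2 p2 [m2 h2]]] := PT_elim hg.
apply: (@PT_intro _ _ _ _ _ (bindF (popF 0) (fun _ => bindF (popF 0) (fun o =>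
    if o is Some true then seqF (pushF 0 true) (seqF (pushF 0 true) G) else F)))
  (fun n => 4 + (T1 n + T2 n))).
  by repeat first [exact: polyb_id | assumption | exact: polyb_const | apply: polyb_add | apply: polyb_mul].
move=> [l a] rest R; case: l => [|c l].
  have n1 : T1 (sz a) <= T1 (sz (@nil C, a)) by apply: m1; rewrite sz_pair; lia.
  apply: (@tr_le _ _ _ (1 + (1 + T1 (sz a)))); first by lia.
  do 2 (apply: tr_bind; first exact: ws_pop).
  exact: h1.
have e : sz ((c, l), a) = sz (c :: l, a) by rewrite !sz_pair sz_cons.
apply: (@tr_le _ _ _ (1 + (1 + (1 + (1 + T2 (sz ((c, l), a))))))); first by rewrite e; lia.
do 2 (apply: tr_bind; first exact: ws_pop).
do 2 (apply: tr_seq; first exact: ws_push).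
exact: h2.
Qed.

End PTcomb.

Section PTfold.
Context {X A S : Type} {eX : Enc X} {eA : Enc A} {eS : Enc S}.

Definition fold_body (G : frag unit) : frag (option unit) :=
  bindF (popF 0) (fun _ => bindF (popF 0) (fun o =>
    if o is Some true then seqF (pushF 0 true) (seqF (pushF 0 true) (seqF G (retF None)))
    else retF (Some tt))).

(** A polynomial-time step may double the size of the state at every round, hence the last
    hypothesis: all intermediate states stay within one polynomial in the size of the argument. *)
Lemma PT_fold2 (h : X -> S) (l : X -> seq A) (g : (X * S) * A -> S) :
  PT h -> PT l -> PT g ->
  (exists2 p, polyb p & forall x i, sz (foldl (fun s a => g ((x, s), a)) (h x) (take i (l x))) <= p (sz x)) ->
  PT (fun x => foldl (fun s a => g ((x, s), a)) (h x) (l x)).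
Proof.
move=> hh hl hg [p pp hp].
pose pre x := (l x, (x, h x)).
have hpre : PT pre by apply: PT_pair hl (PT_pair (PT_id) hh).
pose b (q : (A * seq A) * (X * S)) := (q.1.2, (q.2.1, g ((q.2.1, q.2.2), q.1.1))).
have hb : PT b.
  have h12 : PT (fun q : (A * seq A) * (X * S) => q.1.2) by apply: PT_comp PT_snd PT_fst.
  have h11 : PT (fun q : (A * seq A) * (X * S) => q.1.1) by apply: PT_comp PT_fst PT_fst.
  have h21 : PT (fun q : (A * seq A) * (X * S) => q.2.1) by apply: PT_comp PT_fst PT_snd.
  have h22 : PT (fun q : (A * seq A) * (X * S) => q.2.2) by apply: PT_comp PT_snd PT_snd.
  apply: PT_pair => //; apply: PT_pair => //; apply: PT_comp hg _.
  by do 2 apply: PT_pair => //.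
have [F [T1 p1 [m1 h1]]] := PT_elim hpre; have [G [T2 p2 [m2 h2]]] := PT_elim hb.
have [pl ppl hpl] := PT_size hl.
have [H [T3 p3 [m3 h3]]] := PT_elim (@PT_snd X S eX eS).
(* A bound on the size of the loop state: remaining list, argument and accumulator, with room for
   the pairing nodes. *)
pose M n := pl n + n + p n + 3.
have pM : polyb M.
  by repeat first [exact: polyb_id | assumption | exact: polyb_const | apply: polyb_add | apply: polyb_mul].
have pTM : polyb (fun n => T2 (M n)) by apply: polyb_comp pM p2.
have pTM3 : polyb (fun n => T3 (M n)) by apply: polyb_comp pM p3.
apply: (@PT_intro _ _ _ _ _ (seqF F (seqF (loopF (fold_body G)) H))
  (fun n => T1 n + ((pl n * (T2 (M n) + 6) + 4) + T3 (M n)))).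
  by repeat first [exact: polyb_id | assumption | exact: polyb_const | apply: polyb_add | apply: polyb_mul].
move=> x rest R; apply: tr_seq; first exact: h1.
have loopP l0 l1 : l0 ++ l1 = l x ->
  let s := foldl (fun s a => g ((x, s), a)) (h x) l0 in
  tr (loopF (fold_body G)) (ws R (code (enc (l1, (x, s))) ++ rest)) (sz l1 * (T2 (M (sz x)) + 6) + 4) tt
     (ws R (code (enc (x, foldl (fun s a => g ((x, s), a)) s l1)) ++ rest)).
  elim: l1 l0 => [|a l1 IH] l0 e s.
    apply: tr_loop_exit; apply: (@tr_le _ _ _ (1 + (1 + 2))); first by lia.
    do 2 (apply: tr_bind; first exact: ws_pop).
    exact: tr_ret.
  have hs : sz ((a, l1), (x, s)) <= M (sz x).
    have es : s = foldl (fun s a => g ((x, s), a)) (h x) (take (size l0) (l x)).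
      by rewrite -e take_size_cat.
    have := hp x (size l0); rewrite -es => h5; have := hpl x; rewrite -e !sz_pair /M.
    have : sz (a :: l1) <= sz (l0 ++ a :: l1).
      by elim: (l0) => //= c l2 IH2; apply: leq_trans IH2 _; rewrite [in X in _ <= X]sz_cons; lia.
    by rewrite sz_cons; lia.
  apply: (@tr_le _ _ _ ((1 + (1 + (1 + (1 + (T2 (M (sz x)) + 2))))) + (sz l1 * (T2 (M (sz x)) + 6) + 4))).
    by rewrite sz_cons mulSn mulnDl; have := sz_gt0 a; nia.
  have := IH (rcons l0 a); rewrite cat_rcons foldl_rcons -/s => /(_ e) IH'.
  apply: tr_loop_again; last exact: IH'.
  do 2 (apply: tr_bind; first exact: ws_pop).
  do 2 (apply: tr_seq; first exact: ws_push).
  apply: tr_seq; first by apply: tr_le (m2 _ _ hs) (h2 ((a, l1), (x, s)) rest R).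
  exact: tr_ret.
apply: tr_seq.
  apply: tr_le (loopP [::] (l x) erefl).
  by rewrite leq_add2r leq_mul // hpl.
apply: tr_le (h3 _ rest R); apply: m3.
have := hp x (size (l x)); rewrite take_size sz_pair /M /=; lia.
Qed.
End PTfold.

Section Combinators.
Context {X A B C V : Type} {eX : Enc X} {eA : Enc A} {eB : Enc B} {eC : Enc C} {eV : Enc V}.

Lemma PT_fstc (f : X -> A * B) : PT f -> PT (fun x => (f x).1).
Proof. exact: PT_comp PT_fst. Qed.
Lemma PT_sndc (f : X -> A * B) : PT f -> PT (fun x => (f x).2).
Proof. exact: PT_comp PT_snd. Qed.

Lemma PT_app2 (g : A -> B -> C) (a : X -> A) (b : X -> B) :
  PT (fun p : A * B => g p.1 p.2) -> PT a -> PT b -> PT (fun x => g (a x) (b x)).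
Proof. by move=> hg ha hb; apply: (PT_comp hg (PT_pair ha hb)). Qed.

Lemma PT_ifc (b : X -> bool) (f g : X -> A) :
  PT b -> PT f -> PT g -> PT (fun x => if b x then f x else g x).
Proof. by move=> hb hf hg; apply: (PT_comp (PT_if2 hf hg) (PT_pair hb PT_id)). Qed.

Lemma PT_listc (l : X -> seq A) (f : X -> B) (g : X -> A -> seq A -> B) :
  PT l -> PT f -> PT (fun p : X * (A * seq A) => g p.1 p.2.1 p.2.2) ->
  PT (fun x => if l x is a :: l' then g x a l' else f x).
Proof.
move=> hl hf hg.
have hg' : PT (fun p : (A * seq A) * X => g p.2 p.1.1 p.1.2).
  exact: (PT_comp hg (PT_pair PT_snd PT_fst)).
apply: PT_ext (PT_comp (PT_list2 hf hg') (PT_pair hl PT_id)) => x /=.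
by case: (l x).
Qed.

Lemma PT_cons (a : X -> A) (l : X -> seq A) : PT a -> PT l -> PT (fun x => a x :: l x).
Proof.
move=> ha hl; apply: (PT_comp (g := fun p : A * seq A => p.1 :: p.2) _ (PT_pair ha hl)).
exact: PT_cast.
Qed.

Lemma sz_nil : sz (@nil A) = 1. Proof. by []. Qed.

Lemma sz_cat (l1 l2 : seq A) : sz (l1 ++ l2) + 1 = sz l1 + sz l2.
Proof.
elim: l1 => [|a l IH]; first by rewrite [sz [::]]sz_nil addnC.
by rewrite cat_cons !sz_cons; lia.
Qed.

Lemma sz_rev (l : seq A) : sz (rev l) = sz l.
Proof.
elim: l => // a l IH; rewrite rev_cons -cats1 [RHS]sz_cons -IH.
by have := sz_cat (rev l) [:: a]; rewrite !sz_cons sz_nil; lia.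
Qed.

Lemma sz_mem_size (l : seq A) : size l < sz l.
Proof. by elim: l => // a l IH; rewrite sz_cons /=; have := sz_gt0 a; lia. Qed.

Lemma sz_take i (l : seq A) : sz (take i l) <= sz l.
Proof.
have := sz_cat (take i l) (drop i l); rewrite cat_take_drop.
by have : 0 < sz (drop i l) by [exact: sz_gt0]; lia.
Qed.

Lemma PT_foldc (h : X -> V) (l : X -> seq A) (g : X -> V -> A -> V) :
  PT h -> PT l -> PT (fun p : (X * V) * A => g p.1.1 p.1.2 p.2) ->
  (exists2 p, polyb p & forall x i, sz (foldl (g x) (h x) (take i (l x))) <= p (sz x)) ->
  PT (fun x => foldl (g x) (h x) (l x)).
Proof. by move=> hh hl hg hb; apply: (PT_fold2 (g := fun p => g p.1.1 p.1.2 p.2)). Qed.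

(** The increase per round is bounded independently of the state, so the increases add up and the
    bound on intermediate states comes for free. *)
Lemma PT_fold_add (h : X -> V) (l : X -> seq A) (g : X -> V -> A -> V) :
  PT h -> PT l -> PT (fun p : (X * V) * A => g p.1.1 p.1.2 p.2) ->
  (exists2 q, polyb q & forall x s a, sz (g x s a) <= sz s + q (sz x + sz a)) ->
  PT (fun x => foldl (g x) (h x) (l x)).
Proof.
move=> hh hl hg [q [k hk] hq].
have [ph pph hph] := PT_size hh; have [pl ppl hpl] := PT_size hl.
apply: PT_foldc => //.
exists (fun n => ph n + pl n * (n + pl n).+2 ^ k).
  apply: polyb_add => //; apply: polyb_mul => //; apply: polyb_exp.
  by do 2 apply: polyb_S; apply: polyb_add => //; apply: polyb_id.
move=> x i; set l0 := take i (l x).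
have hl0 : sz l0 <= pl (sz x) by apply: leq_trans (sz_take _ _) (hpl x).
apply: (@leq_trans (sz (h x) + sz l0 * (sz x + pl (sz x)).+2 ^ k)); last first.
  by apply: leq_add => //; rewrite leq_mul2r hl0 orbT.
elim: l0 (h x) hl0 => [|a l0 IH] s hl0 /=; first by lia.
rewrite sz_cons in hl0.
apply: leq_trans (IH _ _) _; first by lia.
rewrite sz_cons; set c := _ ^ k.
have : q (sz x + sz a) <= c by apply: leq_trans (hk _) _; apply: leq_expb; lia.
have := hq x s a; have := sz_gt0 a; nia.
Qed.

End Combinators.

Section Lists.
Context {X A B C V : Type} {eX : Enc X} {eA : Enc A} {eB : Enc B} {eC : Enc C} {eV : Enc V}.

Lemma PT_rev (l : X -> seq A) : PT l -> PT (fun x => rev (l x)).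
Proof.
move=> hl; apply: (@PT_ext _ _ _ _ (fun x => foldl (fun s a => a :: s) [::] (l x))).
  by move=> x; rewrite /rev; elim: (l x) [::] => //= a l' IH s.
apply: (PT_fold_add (g := fun _ s a => a :: s)) => //; first exact: PT_const.
  by apply: PT_cons; [exact: PT_snd | apply: PT_sndc; exact: PT_fst].
by exists S; [apply: polyb_S polyb_id | move=> x s a; rewrite sz_cons; lia].
Qed.

Lemma PT_cat (l1 l2 : X -> seq A) : PT l1 -> PT l2 -> PT (fun x => l1 x ++ l2 x).
Proof.
move=> h1 h2; apply: (@PT_ext _ _ _ _ (fun x => foldl (fun s a => a :: s) (l2 x) (rev (l1 x)))).
  move=> x; rewrite -{2}(revK (l1 x)); elim: (rev (l1 x)) (l2 x) => //= a l' IH s.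
  by rewrite IH rev_cons cat_rcons.
apply: (PT_fold_add (g := fun _ s a => a :: s)) => //; first exact: PT_rev.
  by apply: PT_cons; [exact: PT_snd | apply: PT_sndc; exact: PT_fst].
by exists S; [apply: polyb_S polyb_id | move=> x s a; rewrite sz_cons; lia].
Qed.

End Lists.

Section Bind.
Context {X A B C V : Type} {eX : Enc X} {eA : Enc A} {eB : Enc B} {eC : Enc C} {eV : Enc V}.

Lemma PT_bind (f : X -> A -> seq B) (l : X -> seq A) :
  PT (fun p : X * A => f p.1 p.2) -> PT l -> PT (fun x => flatten (map (f x) (l x))).
Proof.
move=> hf hl; have [p [k hk] hp] := PT_size hf.
apply: (@PT_ext _ _ _ _ (fun x => rev (foldl (fun s a => rev (f x a) ++ s) [::] (l x)))).
  move=> x; rewrite -[RHS]revK -[rev (flatten _)]cats0; congr rev.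
  elim: (l x) [::] => //= a l' IH s; rewrite IH rev_cat -catA //.
apply: PT_rev; apply: (PT_fold_add (g := fun x s a => rev (f x a) ++ s)) => //; first exact: PT_const.
  apply: PT_cat; last by apply: PT_sndc; exact: PT_fst.
  apply: PT_rev; apply: (PT_app2 (g := f)) hf _ _; last exact: PT_snd.
  by apply: PT_fstc; exact: PT_fst.
exists (fun n => n.+3 ^ k).
  by apply: polyb_exp; do 3 apply: polyb_S; exact: polyb_id.
move=> x s a; rewrite -(leq_add2r 1) sz_cat sz_rev.
have h1 : sz (f x a) <= (sz x + sz a).+3 ^ k.
  by apply: leq_trans (hp (x, a)) _; rewrite sz_pair; apply: hk.
by move=> /=; lia.
Qed.

End Bind.

Section MapL.
Context {X A B C V : Type} {eX : Enc X} {eA : Enc A} {eB : Enc B} {eC : Enc C} {eV : Enc V}.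

Lemma PT_map (f : X -> A -> B) (l : X -> seq A) :
  PT (fun p : X * A => f p.1 p.2) -> PT l -> PT (fun x => map (f x) (l x)).
Proof.
move=> hf hl.
apply: (@PT_ext _ _ _ _ (fun x => flatten (map (fun a => [:: f x a]) (l x)))).
  by move=> x; elim: (l x) => //= a l' ->.
by apply: PT_bind => //; apply: PT_cons => //; exact: PT_const.
Qed.

End MapL.

(** A number in unary has the code of a list of units, so that the list combinators apply to
    numbers. Type [nat] is thereby reserved for quantities polynomial in the domain size; large
    numbers have type [bnat]. *)
Lemma enc_nseq (n : nat) : enc (nseq n tt) = enc n.
Proof. by elim: n => //= n IH; exact: (congr1 (Nd Lf) IH). Qed.

Lemma sz_S n : sz n.+1 = (sz n).+2. Proof. exact: tsz_Nd. Qed.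

Lemma sz_nat n : sz n = n.*2.+1.
Proof. by elim: n => // n IH; rewrite sz_S IH doubleS. Qed.

Lemma PT_units {X : Type} {eX : Enc X} (n : X -> nat) : PT n -> PT (fun x => nseq (n x) tt).
Proof. by apply: (PT_comp (g := fun n => nseq n tt)); apply: PT_cast => m; rewrite enc_nseq. Qed.

Lemma PT_succ {X : Type} {eX : Enc X} (n : X -> nat) : PT n -> PT (fun x => (n x).+1).
Proof.
move=> hn; have : PT (fun x => (tt, n x)) by apply: PT_pair hn; exact: PT_const.
by apply: (PT_comp (g := fun p => p.2.+1)); apply: PT_cast.
Qed.

Lemma PT_lsize {X A : Type} {eX : Enc X} {eA : Enc A} (l : X -> seq A) : PT l -> PT (fun x => size (l x)).
Proof.
move=> hl; apply: (@PT_ext _ _ _ _ (fun x => foldl (fun s _ => s.+1) 0 (l x))).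
  by move=> x; rewrite -[RHS]add0n; elim: (l x) 0 => [|a l' IH] m /=; rewrite ?addn0 // IH addSnnS.
apply: (PT_fold_add (g := fun _ s _ => s.+1)) => //; first exact: PT_const.
  by apply: PT_succ; apply: PT_sndc; exact: PT_fst.
by exists (fun => 2); [exact: polyb_const | move=> x s a; rewrite sz_S; lia].
Qed.

Lemma PT_natc {X B : Type} {eX : Enc X} {eB : Enc B} (n : X -> nat) (f : X -> B) (g : X -> nat -> B) :
  PT n -> PT f -> PT (fun p : X * nat => g p.1 p.2) ->
  PT (fun x => if n x is m.+1 then g x m else f x).
Proof.
move=> hn hf hg.
apply: (@PT_ext _ _ _ _ (fun x => if nseq (n x) tt is _ :: l then g x (size l) else f x)).
  by move=> x; case: (n x) => //= m; rewrite size_nseq.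
apply: (PT_listc (g := fun x _ l => g x (size l))) => //; first exact: PT_units.
apply: (PT_app2 (g := g)) => //; first exact: PT_fst.
by apply: PT_lsize; apply: PT_sndc; exact: PT_snd.
Qed.

Lemma PT_pred {X : Type} {eX : Enc X} (n : X -> nat) : PT n -> PT (fun x => (n x).-1).
Proof.
move=> hn; apply: (@PT_ext _ _ _ _ (fun x => if n x is m.+1 then m else 0)); first by move=> x; case: (n x).
by apply: (PT_natc (g := fun _ m => m)) => //; [exact: PT_const | exact: PT_snd].
Qed.

Lemma PT_iter {X V : Type} {eX : Enc X} {eV : Enc V} (n : X -> nat) (h : X -> V) (g : X -> V -> V) :
  PT n -> PT h -> PT (fun p : X * V => g p.1 p.2) ->
  (exists2 p, polyb p & forall x i, i <= n x -> sz (iter i (g x) (h x)) <= p (sz x)) ->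
  PT (fun x => iter (n x) (g x) (h x)).
Proof.
move=> hn hh hg [p pp hp].
have e x m : iter m (g x) (h x) = foldl (fun s _ => g x s) (h x) (nseq m tt).
  by elim: m (h x) => //= m IH s; rewrite -IH -iterSr.
apply: PT_ext (fun x => esym (e x (n x))) _.
apply: (PT_foldc (g := fun x s _ => g x s)) => //; first exact: PT_units.
  by apply: PT_comp hg (PT_fst).
exists p => // x i.
have -> : take i (nseq (n x) tt) = nseq (minn i (n x)) tt.
  case: (leqP i (n x)) => hi; first by rewrite take_nseq.
  by rewrite take_oversize ?size_nseq // ltnW.
by rewrite -e; apply: hp; apply: geq_minr.
Qed.

Lemma PT_addn {X : Type} {eX : Enc X} (m n : X -> nat) : PT m -> PT n -> PT (fun x => m x + n x).
Proof.
move=> hm hn; apply: (@PT_ext _ _ _ _ (fun x => iter (m x) succn (n x))).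
  by move=> x; rewrite iter_succn addnC.
have [p pp hp] := PT_size hm; have [q qq hq] := PT_size hn.
apply: (PT_iter (g := fun _ => succn)) => //; first by apply: PT_succ; exact: PT_snd.
exists (fun k => p k + q k); first exact: polyb_add.
by move=> x i hi; rewrite iter_succn; have := hp x; have := hq x; rewrite !sz_nat; lia.
Qed.

Lemma PT_subn {X : Type} {eX : Enc X} (m n : X -> nat) : PT m -> PT n -> PT (fun x => m x - n x).
Proof.
move=> hm hn; apply: (@PT_ext _ _ _ _ (fun x => iter (n x) predn (m x))).
  by move=> x; rewrite iter_predn.
have [p pp hp] := PT_size hm.
apply: (PT_iter (g := fun _ => predn)) => //; first by apply: PT_pred; exact: PT_snd.
by exists p => // x i hi; rewrite iter_predn; have := hp x; rewrite !sz_nat; lia.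
Qed.

Lemma PT_muln {X : Type} {eX : Enc X} (m n : X -> nat) : PT m -> PT n -> PT (fun x => m x * n x).
Proof.
move=> hm hn.
apply: (@PT_ext _ _ _ _ (fun x => iter (m x) (addn (n x)) 0)).
  by move=> x; rewrite iter_addn_0 mulnC.
have [p pp hp] := PT_size hm; have [q qq hq] := PT_size hn.
apply: (PT_iter (g := fun x s => n x + s)) => //; first exact: PT_const.
  by apply: PT_addn; [apply: PT_comp hn PT_fst | exact: PT_snd].
exists (fun k => 2 * (p k * q k) + 1).
  by repeat first [exact: polyb_const | assumption | apply: polyb_add | apply: polyb_mul].
move=> x i hi; rewrite iter_addn_0; have := hp x; have := hq x; rewrite !sz_nat.
move: (p _) (q _) => a b h1 h2; have : n x * i <= b * a by apply: leq_mul; lia.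
lia.
Qed.

Lemma PT_expn {X : Type} {eX : Enc X} (m : X -> nat) k : PT m -> PT (fun x => m x ^ k).
Proof.
move=> hm; elim: k => [|k IH]; first exact: PT_const.
by apply: PT_ext (PT_muln hm IH) => x; rewrite expnS.
Qed.

Lemma PT_nseq {X A : Type} {eX : Enc X} {eA : Enc A} (n : X -> nat) (a : X -> A) : PT n -> PT a -> PT (fun x => nseq (n x) (a x)).
Proof.
move=> hn ha; apply: (@PT_ext _ _ _ _ (fun x => map (fun _ => a x) (nseq (n x) tt))).
  by move=> x; rewrite map_nseq.
by apply: (PT_map (f := fun x _ => a x)); [apply: PT_comp ha PT_fst | apply: PT_units].
Qed.

Lemma PT_nth {X A : Type} {eX : Enc X} {eA : Enc A} d i (l : X -> seq A) : PT l -> PT (fun x => nth d (l x) i).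
Proof.
move=> hl; have h (j : nat) : PT (fun l : seq A => nth d l j); last exact: (PT_comp (h i) hl).
elim: j => [|j IH].
  apply: (@PT_ext _ _ _ _ (fun l : seq A => if l is a :: l' then a else d)) => //.
  apply: (PT_listc (g := fun _ a _ => a)); [exact: PT_id | exact: PT_const |].
  by apply: PT_fstc; exact: PT_snd.
apply: (@PT_ext _ _ _ _ (fun l : seq A => if l is a :: l' then nth d l' j else d)) => [[]|] //.
apply: (PT_listc (g := fun _ a l => nth d l j)); [exact: PT_id | exact: PT_const |].
by apply: (PT_comp IH); apply: PT_sndc; exact: PT_snd.
Qed.

Lemma PT_incr_nth {X : Type} {eX : Enc X} i (l : X -> seq nat) : PT l -> PT (fun x => incr_nth (l x) i).
Proof.
move=> hl; have h (j : nat) : PT (fun l : seq nat => incr_nth l j); last exact: (PT_comp (h i) hl).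
elim: j => [|j IH].
  apply: (@PT_ext _ _ _ _ (fun l : seq nat => if l is a :: l' then a.+1 :: l' else [:: 1])) => [[]|] //.
  apply: (PT_listc (g := fun _ a l => a.+1 :: l)); [exact: PT_id | exact: PT_const |].
  by apply: PT_cons; [apply: PT_succ; apply: PT_fstc|apply: PT_sndc]; exact: PT_snd.
apply: (@PT_ext _ _ _ _ (fun l : seq nat => if l is a :: l' then a :: incr_nth l' j else ncons j.+1 0 [:: 1]))=> [[]|] //.
apply: (PT_listc (g := fun _ a l => a :: incr_nth l j)); [exact: PT_id | exact: PT_const |].
by apply: PT_cons; [apply: PT_fstc|apply: (PT_comp IH); apply: PT_sndc]; exact: PT_snd.
Qed.

Section Eq.
Context {X : Type} {eX : Enc X}.

Lemma PT_eqc (A : eqType) (eA : Enc A) (f g : X -> A) : injective eA ->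
  PT f -> PT g -> PT (fun x => f x == g x).
Proof.
move=> inj hf hg.
have h : PT (fun p : A * A => p.1 == p.2).
  apply: (@PT_intro _ _ _ _ _ (bindF (popF 0) (fun _ => eqF)) (fun n => 1 + (14 * n + 21))).
    by repeat first [exact: polyb_id | exact: polyb_const | apply: polyb_add | apply: polyb_mul].
  move=> [a b] rest R; rewrite sz_pair /= -catA.
  apply: tr_bind; first exact: ws_pop.
  have -> : (a == b) = (code (enc a) == code (enc b)).
    apply/eqP/eqP => [-> //|e]; apply: inj.
    by have [] := @code_inj (enc a) (enc b) [::] [::] (congr1 (cat^~ [::]) e).
  by apply: tr_le (tr_eq R _ _ _); rewrite /sz; lia.
exact: (PT_comp h (PT_pair hf hg)).
Qed.
End Eq.

Lemma enc_inj_nat : injective Enc_nat.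
Proof. by elim=> [|m IH] [|n] //= [] /IH ->. Qed.

Lemma enc_inj_pair A B (eA : Enc A) (eB : Enc B) :
  injective eA -> injective eB -> injective (@Enc_prod A B eA eB).
Proof. by move=> hA hB [a b] [c d] [] /hA -> /hB ->. Qed.

Lemma enc_inj_seq A (eA : Enc A) : injective eA -> injective (@Enc_seq A eA).
Proof. by move=> hA; elim=> [|a l IH] [|b l'] //= [] /hA -> /IH ->. Qed.

Definition enc_fin (T : finType) : Enc T := fun t => enc_unary (enum_rank t).

Lemma enc_inj_fin (T : finType) : injective (@enc_fin T).
Proof. by move=> a b /(enc_inj_nat) /ord_inj/enum_rank_inj. Qed.

Section Fin.
Context {X B : Type} {eX : Enc X} {eB : Enc B} (T : finType).
Local Existing Instance enc_fin.

(** Nested case distinctions, [m] of them, select one of finitely many programs. *)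
Lemma PT_nat_table m (f : nat -> X -> B) : (forall i, PT (f i)) -> (forall i, m <= i -> f i =1 f m) ->
  PT (fun p : nat * X => f p.1 p.2).
Proof.
elim: m f => [|m IH] f h1 h2.
  by apply: (@PT_ext _ _ _ _ (fun p => f 0 p.2)) => [[i x] /=|]; [rewrite h2 | apply: (PT_comp (h1 0) PT_snd)].
apply: (@PT_ext _ _ _ _ (fun p : nat * X => if p.1 is i.+1 then f i.+1 p.2 else f 0 p.2)) => [[[]]|] //.
apply: (PT_natc (g := fun p i => f i.+1 p.2)); [exact: PT_fst | exact: (PT_comp (h1 0) PT_snd)|].
apply: (PT_comp (g := fun p => f p.1.+1 p.2) (f := fun p : (nat * X) * nat => (p.2, p.1.2))).
  by apply: (IH (fun i => f i.+1)) => // i hi; apply: h2.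
by apply: PT_pair; [exact: PT_snd | apply: PT_sndc; exact: PT_fst].
Qed.

(** Any function on a fixed finite type, however it is defined, is a table built into the program.
    Evaluation of formulas at cells and tables enters the algorithm in this way, at a cost that
    depends on the fixed sentence only. *)
Lemma PT_fincase (t : X -> T) (f : T -> X -> B) :
  PT t -> (forall u, PT (f u)) -> PT (fun x => f (t x) x).
Proof.
move=> ht hf; case: (pickP T) => [t0 _|h0]; last first.
  (* The codomain of [t] is empty, so there is no argument at all. *)
  by exists (retF tt), 0 => x; have := h0 (t x).
have h : PT (fun p : nat * X => f (nth t0 (enum T) p.1) p.2).
  apply: (@PT_nat_table #|T| (fun i => f (nth t0 (enum T) i))) => // i hi x.
  by rewrite !nth_default // -cardE.
have hr : PT (fun x => enum_rank (t x) : nat).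
  by apply: (PT_comp (g := fun t => enum_rank t : nat)) ht; apply: PT_cast.
apply: PT_ext (PT_comp h (PT_pair hr PT_id)) => x /=.
by rewrite nth_enum_rank.
Qed.

Lemma PT_finfun (t : X -> T) (f : T -> B) : PT t -> PT (fun x => f (t x)).
Proof. by move=> ht; apply: (PT_fincase (f := fun u _ => f u)) => // u; exact: PT_const. Qed.

End Fin.

Lemma PT_retype {X A B : Type} {eX : Enc X} {eA : Enc A} {eB : Enc B} (f : X -> A) (g : X -> B) :
  (forall x, enc (g x) = enc (f x)) -> PT f -> PT g.
Proof. by move=> e [F [k h]]; exists F, k => a rest R; rewrite e. Qed.

(** An extension point of the syntax-directed tactic [pt], redefined as more operations become
    available. *)
Ltac pt_hook := fail.
Ltac pt_step := match goal with
  | |- PT (fun x => x) => apply: PT_id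
  | |- PT fst => exact: PT_fst
  | |- PT snd => exact: PT_snd
  | |- PT (fun _ => ?c) => apply: PT_const
  | H : PT ?h |- PT (fun x => ?h (@?f x)) => apply: (PT_comp H (f := f))
  | |- PT (fun x => (@?f x).1) => apply: (PT_fstc (f := f))
  | |- PT (fun x => (@?f x).2) => apply: (PT_sndc (f := f))
  | |- PT (fun x => (@?f x, @?g x)) => apply: (PT_pair (f := f) (g := g))
  | |- PT (fun x => (@?f x) :: (@?g x)) => apply: (PT_cons (a := f) (l := g))
  | |- PT (fun x => (@?f x) ++ (@?g x)) => apply: (PT_cat (l1 := f) (l2 := g))
  | |- PT (fun x => rev (@?f x)) => apply: (PT_rev (l := f))
  | |- PT (fun x => size (@?f x)) => apply: (PT_lsize (l := f))
  | |- PT (fun x => S (@?f x)) => apply: (PT_succ (n := f))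
  | |- PT (fun x => (@?f x) + (@?g x)) => apply: (PT_addn (m := f) (n := g))
  | |- PT (fun x => (@?f x) - (@?g x)) => apply: (PT_subn (m := f) (n := g))
  | |- PT (fun x => (@?f x) * (@?g x)) => apply: (PT_muln (m := f) (n := g))
  | |- PT (fun x => nth ?d (@?f x) ?i) => apply: (PT_nth d i (l := f))
  | |- PT _ => assumption
  | _ => pt_hook
  | |- PT (fun x => match _ with _ => _ end) => apply: PT_ifc
  end.
Ltac pt := repeat pt_step.

Ltac pb := repeat first [exact: polyb_id | assumption | exact: polyb_const | apply: polyb_S
  | apply: polyb_add | apply: polyb_mul | apply: polyb_exp].

Section PTbool.
Context {X : Type} {eX : Enc X}.
Lemma PT_negb (b : X -> bool) : PT b -> PT (fun x => ~~ b x).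
Proof. by move=> h; apply: (@PT_ext _ _ _ _ (fun x => if b x then false else true)); [move=> x; case: (b x) | pt]. Qed.
Lemma PT_andb (b c : X -> bool) : PT b -> PT c -> PT (fun x => b x && c x).
Proof. by move=> h1 h2; apply: (@PT_ext _ _ _ _ (fun x => if b x then c x else false)) => //; pt. Qed.
Lemma PT_orb (b c : X -> bool) : PT b -> PT c -> PT (fun x => b x || c x).
Proof. by move=> h1 h2; apply: (@PT_ext _ _ _ _ (fun x => if b x then true else c x)) => //; pt. Qed.
Lemma PT_behead {A} {eA : Enc A} (l : X -> seq A) : PT l -> PT (fun x => behead (l x)).
Proof.
move=> h; apply: (@PT_ext _ _ _ _ (fun x => if l x is a :: l' then l' else [::])); first by move=> x; case: (l x).
by apply: (PT_listc (g := fun _ _ l => l)); pt.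
Qed.
End PTbool.
Lemma PT_addb {X} {eX : Enc X} (b c : X -> bool) : PT b -> PT c -> PT (fun x => b x (+) c x).
Proof.
move=> h1 h2; apply: (@PT_ext _ _ _ _ (fun x => if b x then ~~ c x else c x)).
  by move=> x; case: (b x).
by pt; apply: PT_negb.
Qed.

Ltac pt_hook ::= match goal with
  | |- PT (fun x => ~~ (@?b x)) => apply: (PT_negb (b := b))
  | |- PT (fun x => (@?b x) && (@?c x)) => apply: (PT_andb (b := b) (c := c))
  | |- PT (fun x => (@?b x) || (@?c x)) => apply: (PT_orb (b := b) (c := c))
  | |- PT (fun x => (@?b x) (+) (@?c x)) => apply: (PT_addb (b := b) (c := c))
  | |- PT (fun x => behead (@?f x)) => apply: (PT_behead (l := f))
  end.

(** * Binary numerals and digitwise operations *)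

Definition valb (s : seq bool) : nat := foldr (fun (b : bool) m => b + m.*2) 0 s.

Lemma bin_fuel_eq k k' m : m <= k -> m <= k' -> bin_fuel k m = bin_fuel k' m.
Proof.
elim: k k' m => [|k IH] [|k'] m //=; try by case: m.
by case: m => //= m h1 h2; congr cons; apply: IH; lia.
Qed.

Lemma bin_rec m : bin m.+1 = odd m.+1 :: bin (m.+1)./2.
Proof. by rewrite /bin /=; congr cons; apply: bin_fuel_eq; lia. Qed.

Lemma valb_bin m : valb (bin m) = m.
Proof.
elim/ltn_ind: m => [[|m] IH] //; rewrite bin_rec /= -/(valb _) IH; last by lia.
by rewrite -[in RHS](odd_double_half m.+1).
Qed.

Definition trim_step (t : seq bool) (b : bool) := if b || (t != [::]) then b :: t else [::].
Definition trim s := foldr (fun b t => trim_step t b) [::] s.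

Lemma bin_eq0 m : (bin m == [::]) = (m == 0).
Proof. by case: m => // m; rewrite bin_rec. Qed.

Lemma bin_valb s : bin (valb s) = trim s.
Proof.
elim: s => //= b s IH; rewrite -IH /trim_step bin_eq0.
case: b => /=; first by rewrite add1n bin_rec /= odd_double uphalf_double.
case: (valb s) => //= m; rewrite add0n doubleS bin_rec.
by rewrite -doubleS odd_double doubleK.
Qed.

Lemma bin_lt m : m < 2 ^ size (bin m).
Proof.
elim/ltn_ind: m => [[|m] IH] //; rewrite bin_rec [size _]/= expnS.
have h : (m.+1)./2 < m.+1 by lia.
have := IH _ h; have := odd_double_half m.+1.
move: (m.+1)./2 (2 ^ _) => a b; lia.
Qed.

Lemma size_bin m k : m < 2 ^ k -> size (bin m) <= k.
Proof.
elim: k m => [|k IH] m; first by case: m.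
case: m => // m; rewrite bin_rec /= ltnS expnS => h; apply: IH; lia.
Qed.

(** A wrapper that selects the binary encoding, [nat] itself being encoded in unary. *)
Record bnat := BN { bval : nat }.
#[global] Instance Enc_bnat : Enc bnat := fun m => enc (bin (bval m)).

Lemma sz_bits (s : seq bool) : sz s <= 4 * size s + 1.
Proof. by elim: s => // b s IH; rewrite sz_cons /=; case: b => /=; rewrite /sz /tsz /=; move: IH; rewrite /sz /tsz; lia. Qed.

Lemma sz_bnat m k : m < 2 ^ k -> sz (BN m) <= 4 * k + 1.
Proof. by move=> h; apply: leq_trans (sz_bits (bin m)) _; have := size_bin h; lia. Qed.

Lemma bin_lt_sz m : bval m < 2 ^ sz m.
Proof.
apply: (leq_trans (bin_lt (bval m))); rewrite leq_exp2l //.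
by apply: ltnW; case: m => m; exact: (sz_mem_size (bin m)).
Qed.

Section Arith1.
Context {X : Type} {eX : Enc X}.

Lemma PT_trim (s : X -> seq bool) : PT s -> PT (fun x => trim (s x)).
Proof.
move=> hs; apply: (@PT_ext _ _ _ _ (fun x => foldl trim_step [::] (rev (s x)))).
  by move=> x; rewrite foldl_rev.
apply: (PT_fold_add (g := fun _ => trim_step)); pt.
  have he : PT (fun p : X * seq bool * bool => p.1.2 == [::]).
    by apply: (PT_eqc (A := seq bool)); [apply: enc_inj_seq; move=> [] [] | pt | pt].
  by rewrite /trim_step; pt.
exists (fun => 4); first by pb.
by move=> x t b; rewrite /trim_step; case: ifP => _; rewrite ?sz_cons; case: b; rewrite /sz /tsz /=; lia.
Qed.

Lemma PT_valb (s : X -> seq bool) : PT s -> PT (fun x => BN (valb (s x))).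
Proof.
move=> /PT_trim; apply: PT_retype => x.
by rewrite /enc /Enc_bnat /= bin_valb.
Qed.

Lemma PT_bin (m : X -> bnat) : PT m -> PT (fun x => bin (bval (m x))).
Proof. exact: PT_retype. Qed.
End Arith1.

Section Ripple.
Variables (fs fc : bool -> bool -> bool -> bool).
Definition rstate := ((seq bool * seq bool) * (bool * seq bool))%type.
Definition rstep (st : rstate) : rstate :=
  let x := head false st.1.1 in let y := head false st.1.2 in
  ((behead st.1.1, behead st.1.2), (fc x y st.2.1, fs x y st.2.1 :: st.2.2)).
(** The number of rounds exceeds the lengths of both arguments; in the additional round only zeros
    are read, which absorbs the carry of an addition. The digits are returned in reverse order. *)
Definition ripple (a b : seq bool) : bool * seq bool :=
  (iter (size a + size b).+1 rstep ((a, b), (false, [::]))).2.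

Lemma iter_rstep_args k st : (iter k rstep st).1 = (drop k st.1.1, drop k st.1.2).
Proof.
elim: k => [|k IH] /=; first by rewrite !drop0; case: (st.1).
by rewrite IH /= -!drop1 !drop_drop add1n.
Qed.

Hypothesis hs : PT (fun p : bool * bool * bool => fs p.1.1 p.1.2 p.2).
Hypothesis hc : PT (fun p : bool * bool * bool => fc p.1.1 p.1.2 p.2).

Lemma PT_ripple {X : Type} {eX : Enc X} (a b : X -> seq bool) :
  PT a -> PT b -> PT (fun x => ripple (a x) (b x)).
Proof.
move=> ha hb; rewrite /ripple; apply: PT_sndc.
have [p pp hp] := PT_size ha; have [q qq hq] := PT_size hb.
apply: (PT_iter (g := fun _ => rstep)); [by pt | by pt | |].
  have hd (f : X * rstate -> seq bool) : PT f -> PT (fun p => head false (f p)).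
    by move=> hf; rewrite -/(nth false _ 0); apply: PT_ext (PT_nth false 0 hf) => x; rewrite nth0.
  have h3 (f : bool -> bool -> bool -> bool) : PT (fun p : bool * bool * bool => f p.1.1 p.1.2 p.2) ->
    PT (fun p : X * rstate => f (head false p.2.1.1) (head false p.2.1.2) p.2.2.1).
    by move=> hf; apply: (PT_comp (g := fun p : bool * bool * bool => f p.1.1 p.1.2 p.2) hf
      (f := fun p : X * rstate => (head false p.2.1.1, head false p.2.1.2, p.2.2.1))); pt; apply: hd; pt.
  rewrite /rstep; pt; by apply: h3.
exists (fun n => p n + q n + 20 + 4 * (p n + q n)); first by pb.
move=> x i hi; rewrite [iter _ _ _]surjective_pairing iter_rstep_args /=.
have h2 : size (iter i rstep (a x, b x, (false, [::]))).2.2 = i.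
  by elim: (i) => //= j ->.
have h3 : sz (iter i rstep (a x, b x, (false, [::]))).2 <= 5 + (4 * i + 1).
  case: (iter _ _ _) h2 => [? [c s]] /= h2; rewrite sz_pair.
  have h4 := sz_bits s; rewrite h2 in h4.
  have : sz c <= 3 by case: (c).
  lia.
have h5 : sz (drop i (a x)) <= sz (a x).
  by have := sz_cat (take i (a x)) (drop i (a x)); rewrite cat_take_drop => /(_ _);
   have : 0 < sz (take i (a x)) by [exact: sz_gt0]; lia.
have h6 : sz (drop i (b x)) <= sz (b x).
  by have := sz_cat (take i (b x)) (drop i (b x)); rewrite cat_take_drop => /(_ _);
   have : 0 < sz (take i (b x)) by [exact: sz_gt0]; lia.
have h7 : size (a x) < sz (a x) by exact: sz_mem_size.
have h8 : size (b x) < sz (b x) by exact: sz_mem_size.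
have h9 := hp x; have h10 := hq x.
by rewrite !sz_pair; lia.
Qed.

End Ripple.

(** * From programs to Turing machines *)

Definition stepF (w : sym -> sym) (d : bool) : frag unit := @Frag _ unit tt (fun _ c => (inr tt, w c, d)).

Lemma runs_step w d tp : runs (stepF w d) tp 1 tt (mv tp (w tp.1.2) d).
Proof. by case: tp => [[]]. Qed.

(** The input consists of fields with separators between them. Four separators written before it
    create the four empty working stacks and turn the fields into the stacks from 4 on. *)
Definition initF : frag unit :=
  let sepF := stepF (fun=> sepS) false in
  seqF (stepF id false) (seqF sepF (seqF sepF (seqF sepF (seqF sepF (stepF (fun=> blank) true))))).

Lemma init_run (segs : seq (seq bool)) : 0 < size segs ->
  exists2 tp, Rep (ws segs [::]) tp & runs initF (mktp [::] (lay segs)) 6 tt tp.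
Proof.
move=> h; pose str := (uncons (lay segs)).1 :: (uncons (lay segs)).2.
exists (mktp [:: blank] ([:: sepS; sepS; sepS; sepS] ++ str)).
  exists 1, (lay segs == [::]); congr mktp; rewrite /ws /wk.
  have -> : lay [:: [::], [::], [::], [::] & segs] = [:: sepS; sepS; sepS; sepS] ++ lay segs.
    by case: (segs) h.
  by rewrite /str; case: (lay segs) => //= a l; rewrite cats0.
do 5 (apply: (@runs_bind _ _ _ _ _ 1); first exact: runs_step).
exact: runs_step.
Qed.

(** The output ends at the first blank, so the separator after stack 1 is erased. What remains are
    stacks 0 and 1 with a separator between them, which is the format of a rational. *)
Definition finish_d (q : bool + unit) (c : sym) : (bool + unit + unit) * sym * bool :=
  match q with
  | inl false => (inl (inl (c == sepS)), c, true)
  | inl true => if c == sepS then (inl (inr tt), blank, false) else (inl (inl true), c, true)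
  | inr tt => if c == blank then (inr tt, blank, true) else (inl (inr tt), c, false)
  end.
Definition finishF : frag unit := Frag (inl false : bool + unit)%type finish_d.

Lemma finish_skip k s L str :
  iter (size s) (@fstep _ finishF) (inl (inl k), mktp L (map bitS s ++ str)) =
  (inl (inl k), mktp (rev (map bitS s) ++ L) str).
Proof.
elim: s L => // b s IH L; rewrite [size _]/= iterSr /= rev_cons cat_rcons -IH.
by congr (iter _ _ _); case: (k).
Qed.

Lemma finish_run (a b : seq bool) (ss : seq (seq bool)) tp : 0 < size ss -> Rep [:: a, b & ss] tp ->
  exists L str, runs finishF tp (2 * lsz [:: a, b & ss] + 4) tt
    (mktp L ((map bitS a ++ sepS :: map bitS b) ++ blank :: str)).
Proof.
move=> h [n [n' ->]]; set u := map bitS a ++ sepS :: map bitS b.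
have hu : blank \notin u by rewrite mem_cat in_cons !negb_or !blank_bits.
have [str0 estr0] : exists str0, lay' ss = sepS :: str0 by case: (ss) h => // s l _; eexists.
have elay : lay [:: a, b & ss] = u ++ sepS :: str0 by rewrite lay_cons /u -catA /= -estr0.
have [a' h3] := @back_run _ finishF (inr tt) tt (fun c => erefl) u n (sepS :: str0 ++ nseq n' blank) blank hu.
exists (nseq a' blank), (str0 ++ nseq n' blank); move: h3; rewrite [behead _]/= => h3.
apply: (@runs_le _ _ _ ((size u).+1 + (1 + (size b + (1 + size a))))).
  by rewrite /lsz elay /u !size_cat /= !size_map; lia.
have e1 : iter 1 (@fstep _ finishF) (inl (inl false), mktp (rev (map bitS a) ++ nseq n blank)
    (sepS :: map bitS b ++ sepS :: str0 ++ nseq n' blank)) =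
  (inl (inl true), mktp (sepS :: rev (map bitS a) ++ nseq n blank) (map bitS b ++ sepS :: str0 ++ nseq n' blank))
  :> (fQ finishF + unit) * tape by [].
have e2 L : iter 1 (@fstep _ finishF) (inl (inl true), mktp L (sepS :: str0 ++ nseq n' blank)) =
  (inl (inr tt), mv (mktp L (sepS :: str0 ++ nseq n' blank)) blank false) :> (fQ finishF + unit) * tape by [].
have e3 : rev u ++ nseq n blank = rev (map bitS b) ++ sepS :: rev (map bitS a) ++ nseq n blank.
  by rewrite /u rev_cat rev_cons cat_rcons -catA.
rewrite /runs iterD 2!iterD iterD elay {2}/u -!catA !cat_cons finish_skip e1 finish_skip e2 -e3 h3.
by rewrite -catA.
Qed.

Section Machine.
Variable F : frag unit.
Definition st : finType := (fQ F + unit)%type.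
(** State 0 has to be the start state whatever the rank of [fq0 F]; it is added as a second name for
    that state, and all others are shifted by one. *)
Definition dec (i : 'I_#|st|.+1) : st := if unlift ord0 i is Some j then enum_val j else inl (fq0 F).
Definition cod (q : st) : 'I_#|st|.+1 := lift ord0 (enum_rank q).
Lemma codK : cancel cod dec.
Proof. by move=> q; rewrite /dec liftK enum_rankK. Qed.

Definition machine : TM := @MkTM #|st| (fun i c =>
  if dec i is inl q then let: (q', s, d) := fd q c in Some (cod q', s, d) else None).
Definition rep (c : config machine) : st * tape := (dec (cstate c), (cleft c, chead c, cright c)).

Lemma rep_step c : rep (step c) = fstep (rep c).
Proof.
case: c => q l h s; rewrite /rep /step /fstep /=.
case E: (dec q) => [q'|e] /=; last by rewrite E.
by case: (fd q' h) => [[q1 s1] []] /=; rewrite codK.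
Qed.

Lemma machine_run inp t L str out : blank \notin out ->
  runs F (mktp [::] inp) t tt (mktp L (out ++ blank :: str)) ->
  computes_within machine inp out t.
Proof.
move=> ho hr; exists t; split=> //.
have : rep (iter t (@step machine) (init machine inp)) = (inr tt, mktp L (out ++ blank :: str)).
  rewrite -hr; elim: (t) => [|k IH] /=; last by rewrite rep_step IH.
  by rewrite /rep /init /= /dec; case: unliftP => // j /eqP; rewrite (negbTE (neq_lift _ _)).
case: (iter t _ _) => q l h s; rewrite /rep /= => -[eq _ e2 e3]; split; first by rewrite /halted /= eq.
rewrite /output [chead _]/= [cright _]/= e2 e3.
have -> : (uncons (out ++ blank :: str)).1 :: (uncons (out ++ blank :: str)).2 = out ++ blank :: str.
  by case: (out).
rewrite find_cat has_pred1 (negbTE ho) /= addn0 take_size_cat //.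
Qed.
End Machine.

Lemma set_nth_nseq i (u v : seq bool) (B : seq (seq bool)) :
  set_nth [::] (nseq i [::] ++ u :: B) i v = nseq i [::] ++ v :: B.
Proof. by elim: i => //= i ->. Qed.

Lemma nth_nseq_cat i (u : seq bool) (B : seq (seq bool)) : nth [::] (nseq i [::] ++ u :: B) i = u.
Proof. by elim: i. Qed.

Definition absorb_body (i : nat) : frag (option unit) := bindF (popF i.+4) (fun o =>
  if o is Some b then seqF (push_bool b) (seqF (pushF 0 true) (retF None)) else retF (Some tt)).

Lemma tr_absorb_body i s0 u B :
  tr (absorb_body i) (ws (nseq i [::] ++ u :: B) s0) 7 (if u is [::] then Some tt else None)
   (ws (nseq i [::] ++ behead u :: B) (if u is b :: _ then true :: code (boolt b) ++ s0 else s0)).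
Proof.
have hi : i.+4 < size (ws (nseq i [::] ++ u :: B) s0) by rewrite /= size_cat size_nseq /=; lia.
apply: (@tr_bind _ _ _ _ _ 1 (ohead u) (ws (nseq i [::] ++ behead u :: B) s0) 6).
  have := tr_pop hi; rewrite /= nth_nseq_cat set_nth_nseq; apply.
case: u {hi} => [|b u] /=; first by apply: (@tr_le _ _ _ 2) => //; apply: tr_ret.
apply: (@tr_seq _ _ _ _ 3 _ 3); first by rewrite !(ws_pk _ false); apply: tr_push_bool.
by apply: (@tr_seq _ _ _ _ 1 _ 2); [exact: ws_push | exact: tr_ret].
Qed.

(** Lists are written in prefix notation on top of what is there: the first push is the empty list,
    every bit read is consed on (hence the reversal), and the last push conses the finished list
    onto the list of lists below. *)
Definition absorb (i : nat) : frag unit :=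
  seqF (pushF 0 false) (seqF (loopF (absorb_body i)) (pushF 0 true)).

Lemma tr_absorb_loop i (l u : seq bool) rest B :
  tr (loopF (absorb_body i)) (ws (nseq i [::] ++ u :: B) (code (enc l) ++ rest)) (7 * size u + 7) tt
     (ws (nseq i [::] ++ [::] :: B) (code (enc (catrev u l)) ++ rest)).
Proof.
elim: u l => [|b u IH] l; first exact: tr_loop_exit (tr_absorb_body i _ [::] B).
apply: (@tr_le _ _ _ (7 + (7 * size u + 7))); first by rewrite /=; lia.
apply: (@tr_loop_again _ _ _ _ (ws (nseq i [::] ++ u :: B) (code (enc (b :: l)) ++ rest))); last exact: IH.
have -> : code (enc (b :: l)) ++ rest = true :: code (boolt b) ++ code (enc l) ++ rest by rewrite /= -catA.
exact: (tr_absorb_body i (code (enc l) ++ rest) (b :: u) B).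
Qed.

Fixpoint absorb_all (i k : nat) : frag unit :=
  if k is k'.+1 then seqF (absorb i) (absorb_all i.+1 k') else retF tt.

Lemma tr_absorb_all i B (L : seq (seq bool)) :
  tr (absorb_all i (size B)) (ws (nseq i [::] ++ B) (code (enc L))) (7 * size (flatten B) + 9 * size B + 2) tt
   (ws (nseq (i + size B) [::]) (code (enc (catrev (map rev B) L)))).
Proof.
elim: B i L => [|u B IH] i L /=; first by rewrite cats0 addn0; apply: tr_le (tr_ret _ _ _).
apply: (@tr_le _ _ _ ((1 + ((7 * size u + 7) + 1)) + (7 * size (flatten B) + 9 * size B + 2))).
  by rewrite size_cat; lia.
apply: tr_seq; last first.
  by have := IH i.+1 (rev u :: L); rewrite addSnnS; apply.
apply: tr_seq; first exact: ws_push.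
apply: tr_seq; first exact: (tr_absorb_loop i [::] u (code (enc L)) B).
have -> : nseq i.+1 [::] ++ B = nseq i [::] ++ [::] :: B by elim: (i) => //= j ->.
exact: ws_push.
Qed.

Definition emit_body (j : nat) : frag (option unit) := bindF (popF 0) (fun o =>
  if o is Some true then bindF (popF 0) (fun o =>
    if o is Some true then bindF (popF 0) (fun _ => bindF (popF 0) (fun _ => seqF (pushF j true) (retF None)))
    else seqF (pushF j false) (retF None))
  else retF (Some tt)).

Lemma tr_emit R th (l : seq bool) rest u w c :
  tr (loopF (emit_body (pj th))) (pk R th (code (enc l) ++ rest) u w c) (7 * size l + 3) tt
    (pk R th rest (rev l ++ u) w c).
Proof.
elim: l u => [|b l IH] u.
  by apply: tr_loop_exit; apply: (@tr_bind _ _ _ _ _ 1 _ _ 2); [exact: pk_pop0 | exact: pk_ret].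
apply: (@tr_le _ _ _ (7 + (7 * size l + 3))); first by rewrite /=; lia.
rewrite rev_cons cat_rcons; apply: tr_loop_again; last exact: IH.
case: b.
  do 2 (apply: (@tr_bind _ _ _ _ _ 1); first exact: pk_pop0).
  do 2 (apply: (@tr_bind _ _ _ _ _ 1); first exact: pk_pop0).
  by apply: (@tr_seq _ _ _ _ 1 _ 2); [exact: pk_pushj | exact: pk_ret].
apply: (@tr_le _ _ _ 5) => //.
do 2 (apply: (@tr_bind _ _ _ _ _ 1); first exact: pk_pop0).
by apply: (@tr_seq _ _ _ _ 1 _ 2); [exact: pk_pushj | exact: pk_ret].
Qed.

Definition emitF : frag unit :=
  bindF (popF 0) (fun _ => seqF (loopF (emit_body 1)) (seqF (loopF (emit_body 3))
    (seqF (moveF 1 0) (moveF 3 1)))).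

Lemma tr_emitF R (a b : seq bool) : tr emitF (ws R (code (enc (a, b)))) (11 * (size a + size b) + 13) tt
  (wk R a b [::] [::]).
Proof.
apply: (@tr_le _ _ _ (1 + ((7 * size a + 3) + ((7 * size b + 3) + ((4 * size a + 3) + (4 * size b + 3)))))).
  by lia.
rewrite (ws_pk R false).
apply: tr_bind; first exact: pk_pop0.
rewrite [behead _]/= -[enc b]/(enc b) -[code (enc b)]cats0.
apply: tr_seq; first exact: (tr_emit R false).
rewrite pk_swap cats0 -[code (enc b)]cats0.
apply: tr_seq; first exact: (tr_emit R true).
rewrite -(pk_swap _ false) !cats0; apply: tr_seq.
  by have := @tr_move0 R false [::] (rev a) (rev b) [::]; rewrite size_rev revK cats0; apply.
rewrite pk_swap.
by have := @tr_movej R true a (rev b) [::] [::]; rewrite size_rev revK cats0; apply.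
Qed.

Section Assemble.
Variables (m : nat) (main : seq (seq bool) -> seq bool * seq bool).
Hypothesis hm : 0 < m.
Hypothesis hmain : PT main.

Lemma size_lay' ss : size (lay' ss) = size (flatten ss) + size ss.
Proof. by elim: ss => //= s ss IH; rewrite size_cat size_map IH size_cat; lia. Qed.

Lemma sz_catrev_rev (ss : seq (seq bool)) L : sz (catrev (map rev ss) L) <= sz L + 4 * size (flatten ss) + 2 * size ss.
Proof.
elim: ss L => [|s ss IH] L /=; first by lia.
apply: leq_trans (IH _) _; rewrite sz_cons size_cat.
have := sz_bits (rev s); rewrite size_rev; lia.
Qed.

(** The passage from functions on encoded data to a genuine machine: the fields are absorbed into
    one tree, the program is run, and the pair of its results is laid out for output. Absorbing
    reverses both the fields and their order, whence the argument of [main]. *)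
Theorem PT_machine : exists (M : TM) (c d : nat), forall segs, size segs = m ->
  let o := main (catrev (map rev segs) [::]) in
  computes_within M (lay segs) (map bitS o.1 ++ sepS :: map bitS o.2) (c * (size (lay segs)).+1 ^ d).
Proof.
case: hmain => F [k hF].
pose G := seqF initF (seqF (seqF (pushF 0 false) (seqF (absorb_all 0 m) (seqF F emitF))) finishF).
(* For an input of size [N]: [B] bounds the encoded list of fields (at most four bits for a digit,
   two for each list node), [K] the operations of the given program, [T] all stack operations, and
   [C] the machine steps. *)
pose B N := 4 * N + 5.
pose K N := (B N).+2 ^ k.
pose T N := 1 + (9 * N + 11 + (K N + (11 * (B N + K N) + 13))).
pose C N := 6 + (T N * (2 * ((N + 4) + T N) + 4) + (2 * (N + 4 + T N) + 4)).
have pC : polyb C by rewrite /C /T /K /B; pb.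
(* The factor [2 ^ d] comes from [N.+2 <= 2 * N.+1]. *)
case: pC => d hd; exists (machine G), (2 ^ d), d => segs hs o.
set N := size (lay segs).
have hN : (size (flatten segs) + m = N.+1).
  rewrite /N /lay size_behead size_lay' hs; lia.
set L := catrev (map rev segs) [::].
have hL : sz L <= B N.
  apply: leq_trans (sz_catrev_rev _ _) _; rewrite sz_nil hs /B; lia.
have hK : (sz L).+2 ^ k <= K N by apply: leq_expb; rewrite !ltnS.
set R := nseq m ([::] : seq bool).
have hmF : tr F (ws R (code (enc L))) ((sz L).+2 ^ k) tt (ws R (code (enc o))).
  by have := hF L [::] R; rewrite !cats0.
have ho : size o.1 + size o.2 <= B N + K N.
  have eo : sz o = (sz o.1 + sz o.2).+1 by rewrite -sz_pair -surjective_pairing.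
  have h : sz o <= sz L + (sz L).+2 ^ k.
    have [+ _] := hmF; rewrite (lsz_ws R (code (enc o))) (lsz_ws R (code (enc L))) addnAC leq_add2r.
    exact.
  have h3 : sz L + (sz L).+2 ^ k <= B N + K N by apply: leq_add.
  have h4 : size o.1 < sz o.1 by exact: sz_mem_size.
  have h5 : size o.2 < sz o.2 by exact: sz_mem_size.
  move: (leq_trans h h3); rewrite eo; move: (B N + K N) => z; lia.
have htr : tr (seqF (pushF 0 false) (seqF (absorb_all 0 m) (seqF F emitF))) (ws segs [::]) (T N) tt
    (wk R o.1 o.2 [::] [::]).
  apply: (@tr_seq _ _ _ _ 1); first exact: ws_push.
  apply: (@tr_seq _ _ _ _ (9 * N + 11)).
    have := @tr_absorb_all 0 segs [::]; rewrite hs add0n => h.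
    by apply: tr_le h; lia.
  apply: (@tr_seq _ _ _ _ (K N)); first exact: tr_le hK hmF.
  rewrite [in code _](surjective_pairing o).
  by apply: tr_le (tr_emitF R o.1 o.2); lia.
have hs0 : 0 < size segs by rewrite hs.
have [tp0 r0 q0] := init_run hs0.
have [h1 /(_ _ r0)[tp1 r1 q1]] := htr.
have [Lf [str q2]] := finish_run (ss := [:: [::], [::] & R]) isT r1.
have hl : lsz (ws segs [::]) = N + 4.
  by rewrite /N /lsz /ws /wk; case: (segs) hs0 => [|s l] //= _; rewrite addn4.
have hc : C N <= 2 ^ d * N.+1 ^ d.
  by apply: leq_trans (hd N) _; rewrite -expnMn; apply: leq_expb; lia.
have hr : runs G (mktp [::] (lay segs)) (C N) tt (mktp Lf ((map bitS o.1 ++ sepS :: map bitS o.2) ++ blank :: str)).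
  apply: (runs_bind q0); apply: runs_le (runs_bind q1 q2).
  by rewrite /cost hl leq_add2l leq_add2r leq_mul2l -hl h1 orbT.
have hb : blank \notin map bitS o.1 ++ sepS :: map bitS o.2.
  by rewrite mem_cat in_cons !negb_or !blank_bits.
have [t [ht hh]] := machine_run hb hr.
exists t; split=> //; exact: leq_trans ht hc.
Qed.
End Assemble.

(** * Binary arithmetic *)

Lemma valb_rcons s (b : bool) : valb (rcons s b) = valb s + b * 2 ^ size s.
Proof.
elim: s => [|x s IH] /=; first by case: b.
by rewrite IH expnS; move: (2 ^ _) => m; case: (b); lia.
Qed.

Lemma leq_size_take (T : Type) i (s : seq T) : size (take i s) <= size s.
Proof. by rewrite size_take; case: ltnP => // /ltnW. Qed.

Lemma valb_head s : valb s = head false s + (valb (behead s)).*2.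
Proof. by case: s. Qed.

Lemma valb_lt s : valb s < 2 ^ size s.
Proof. by elim: s => //= b s; rewrite expnS; case: (b); lia. Qed.

Definition maj (x y c : bool) := (x && y) || ((x || y) && c).
Definition xor3 (x y c : bool) := x (+) y (+) c.
(** The borrow of a full subtractor computing [x - y - c]. *)
Definition bor (x y c : bool) := (~~ x && (y || c)) || (y && c).

Section RippleSpec.
Variables a0 b0 : seq bool.
Let st0 : rstate := ((a0, b0), (false, [::])).

Lemma add_inv k : let st := iter k (rstep xor3 maj) st0 in
  size st.2.2 = k /\
  (valb st.1.1 + valb st.1.2 + st.2.1) * 2 ^ k + valb (rev st.2.2) = valb a0 + valb b0.
Proof.
elim: k => [|k [IHs IH]] /=; first by rewrite addn0 muln1 addn0.
set st := iter _ _ _ in IHs IH *; rewrite IHs; split=> //.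
rewrite rev_cons valb_rcons size_rev IHs -IH expnS (valb_head st.1.1) (valb_head st.1.2).
by rewrite /xor3 /maj; case: (head _ _); case: (head _ _); case: (st.2.1); move: (2 ^ k) => m /=; nia.
Qed.

(** Stated without subtraction, since it has to hold also when [b0] is the larger number. *)
Lemma sub_inv k : let st := iter k (rstep xor3 bor) st0 in
  size st.2.2 = k /\
  valb a0 + (valb st.1.2 + st.2.1) * 2 ^ k = valb b0 + valb st.1.1 * 2 ^ k + valb (rev st.2.2).
Proof.
elim: k => [|k [IHs IH]] /=; first by rewrite !addn0 !muln1 addnC.
set st := iter _ _ _ in IHs IH *; rewrite IHs; split=> //.
rewrite rev_cons valb_rcons size_rev IHs expnS; move: IH.
rewrite (valb_head st.1.1) (valb_head st.1.2).
by rewrite /xor3 /bor; case: (head _ _); case: (head _ _); case: (st.2.1); move: (2 ^ k) => m /=; nia.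
Qed.

Lemma ripple_add : valb (rev (ripple xor3 maj a0 b0).2) = valb a0 + valb b0.
Proof.
have [_] := add_inv (size a0 + size b0).+1; rewrite /ripple /=.
have := iter_rstep_args xor3 maj (size a0 + size b0) st0.
set st := iter _ _ _ => e; by rewrite e /= !drop_oversize /= ?leq_addl ?leq_addr.
Qed.

Lemma ripple_sub : (ripple xor3 bor a0 b0).1 = (valb a0 < valb b0) /\
  (valb b0 <= valb a0 -> valb (rev (ripple xor3 bor a0 b0).2) = valb a0 - valb b0).
Proof.
rewrite /ripple; have : size a0 + size b0 <= (size a0 + size b0).+1 by [].
move: _.+1 => N hN.
have [] := sub_inv N; have := iter_rstep_args xor3 bor N st0.
set st := iter _ _ _ => e hs.
(* The digits written represent a number below [2 ^ N]; the invariant then forces the final borrow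
   to be the truth value of [valb a0 < valb b0]. *)
have := valb_lt (rev st.2.2); rewrite size_rev hs => hlt.
rewrite e /= !drop_oversize /=; [|by lia|by lia].
case: (st.2.1) => /=; rewrite ?mul0n ?mul1n ?add0n ?addn0 => h; split; lia.
Qed.
End RippleSpec.

Lemma bval_inj : injective bval.
Proof. by move=> [m] [n] /= ->. Qed.

Definition badd a b := BN (bval a + bval b).
Definition bsub a b := BN (bval a - bval b).
Definition bleq a b := bval a <= bval b.
Definition bmul a b := BN (bval a * bval b).

Lemma PT_xor3 : PT (fun p : bool * bool * bool => xor3 p.1.1 p.1.2 p.2).
Proof. by rewrite /xor3; pt. Qed.
Lemma PT_maj : PT (fun p : bool * bool * bool => maj p.1.1 p.1.2 p.2).
Proof. by rewrite /maj; pt. Qed.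
Lemma PT_bor : PT (fun p : bool * bool * bool => bor p.1.1 p.1.2 p.2).
Proof. by rewrite /bor; pt. Qed.

Section ArithPT.
Context {X : Type} {eX : Enc X}.
Implicit Types a b : X -> bnat.

Lemma PT_badd a b : PT a -> PT b -> PT (fun x => badd (a x) (b x)).
Proof.
move=> ha hb.
apply: (@PT_ext _ _ _ _ (fun x => BN (valb (rev (ripple xor3 maj (bin (bval (a x))) (bin (bval (b x)))).2)))).
  by move=> x; rewrite ripple_add !valb_bin.
apply: PT_valb; apply: PT_rev; apply: PT_sndc.
by apply: (PT_ripple PT_xor3 PT_maj); apply: PT_bin.
Qed.

Lemma PT_bleq a b : PT a -> PT b -> PT (fun x => bleq (a x) (b x)).
Proof.
move=> ha hb.
apply: (@PT_ext _ _ _ _ (fun x => ~~ (ripple xor3 bor (bin (bval (b x))) (bin (bval (a x)))).1)).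
  by move=> x; have [-> _] := ripple_sub (bin (bval (b x))) (bin (bval (a x))); rewrite !valb_bin -leqNgt.
apply: PT_negb; apply: PT_fstc.
by apply: (PT_ripple PT_xor3 PT_bor); apply: PT_bin.
Qed.

Lemma PT_bsub a b : PT a -> PT b -> PT (fun x => bsub (a x) (b x)).
Proof.
move=> ha hb.
apply: (@PT_ext _ _ _ _ (fun x => if bleq (b x) (a x) then
   BN (valb (rev (ripple xor3 bor (bin (bval (a x))) (bin (bval (b x)))).2)) else BN 0)).
  move=> x; rewrite /bleq /bsub; case: leqP => h.
    by have [_ ->] := ripple_sub (bin (bval (a x))) (bin (bval (b x))); rewrite !valb_bin.
  by congr BN; lia.
apply: PT_ifc; [exact: PT_bleq | | exact: PT_const].
apply: PT_valb; apply: PT_rev; apply: PT_sndc.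
by apply: (PT_ripple PT_xor3 PT_bor); apply: PT_bin.
Qed.

Definition bdbl (c : bool) (m : bnat) := BN (c + (bval m).*2).

Lemma PT_bdbl (c : X -> bool) a : PT c -> PT a -> PT (fun x => bdbl (c x) (a x)).
Proof.
move=> hc ha; apply: (@PT_ext _ _ _ _ (fun x => BN (valb (c x :: bin (bval (a x)))))).
  by move=> x; rewrite /= valb_bin.
by apply: PT_valb; apply: PT_cons => //; apply: PT_bin.
Qed.
End ArithPT.

Ltac pt_arith := match goal with
  | |- PT (fun x => badd (@?b x) (@?c x)) => apply: (PT_badd (a := b) (b := c))
  | |- PT (fun x => bsub (@?b x) (@?c x)) => apply: (PT_bsub (a := b) (b := c))
  | |- PT (fun x => bleq (@?b x) (@?c x)) => apply: (PT_bleq (a := b) (b := c))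
  | |- PT (fun x => bdbl (@?b x) (@?c x)) => apply: (PT_bdbl (c := b) (a := c))
  | |- PT (fun x => bin (bval (@?b x))) => apply: (PT_bin (m := b))
  | |- PT (fun x => ~~ (@?b x)) => apply: (PT_negb (b := b))
  | |- PT (fun x => (@?b x) && (@?c x)) => apply: (PT_andb (b := b) (c := c))
  | |- PT (fun x => (@?b x) || (@?c x)) => apply: (PT_orb (b := b) (c := c))
  | |- PT (fun x => (@?b x) (+) (@?c x)) => apply: (PT_addb (b := b) (c := c))
  | |- PT (fun x => behead (@?f x)) => apply: (PT_behead (l := f))
  end.
Ltac pt_hook ::= pt_arith.

Section ArithMul.
Context {X : Type} {eX : Enc X}.
Implicit Types a b : X -> bnat.

Lemma leq_mul_pow2 m n j k : m < 2 ^ j -> n < 2 ^ k -> m * n < 2 ^ (j + k).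
Proof. by move=> h1 h2; rewrite expnD; nia. Qed.

Definition mul_step (n m : bnat) (c : bool) : bnat :=
  if c then badd (bdbl false m) n else bdbl false m.

Lemma mul_foldE n l m : bval (foldl (mul_step n) m l) = bval m * 2 ^ size l + valb (rev l) * bval n.
Proof.
elim: l m => [|c l IH] m /=; first by rewrite muln1 addn0.
rewrite IH rev_cons valb_rcons size_rev expnS /mul_step.
by case: c => /=; move: (2 ^ _) (valb _) (bval n) (bval m) => *; nia.
Qed.

Lemma PT_bmul a b : PT a -> PT b -> PT (fun x => bmul (a x) (b x)).
Proof.
move=> ha hb.
apply: (@PT_ext _ _ _ _ (fun x => foldl (mul_step (b x)) (BN 0) (rev (bin (bval (a x)))))).
  by move=> x; apply: bval_inj; rewrite mul_foldE revK valb_bin.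
have [p pp hp] := PT_size ha; have [q qq hq] := PT_size hb.
apply: (PT_foldc (g := fun x => mul_step (b x))); [by pt | by pt | |].
  rewrite /mul_step; pt.
exists (fun n => 4 * (p n + q n) + 1); first by pb.
move=> x i; set l := take _ _; case e: (foldl _ _ _) => [v].
have -> : v = valb (rev l) * bval (b x) by rewrite -[v]/(bval (BN v)) -e mul_foldE.
apply: leq_trans (sz_bnat (k := sz (a x) + sz (b x)) _) _; last by have := hp x; have := hq x; lia.
apply: leq_mul_pow2 (bin_lt_sz _).
apply: leq_trans (valb_lt _) _; rewrite leq_exp2l // size_rev.
apply: ltnW; apply: leq_ltn_trans (leq_size_take _ _) _; rewrite size_rev.
exact: (sz_mem_size (bin (bval (a x)))).
Qed.

Definition div_step (d : bnat) (st : bnat * bnat) (c : bool) : bnat * bnat :=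
  let r := bdbl c st.2 in
  if bleq d r then (bdbl true st.1, bsub r d) else (bdbl false st.1, r).

Definition bedivn (m d : bnat) := foldl (div_step d) (BN 0, BN 0) (rev (bin (bval m))).
Definition bdiv m d := (bedivn m d).1.
Definition bmod m d := (bedivn m d).2.

Lemma div_foldE d l st : let st' := foldl (div_step d) st l in
  bval st'.1 * bval d + bval st'.2 = (bval st.1 * bval d + bval st.2) * 2 ^ size l + valb (rev l).
Proof.
elim: l st => [|c l IH] st /=; first by rewrite muln1 addn0.
rewrite IH rev_cons valb_rcons size_rev expnS /div_step /bleq.
case: ifP => /= h; move: (2 ^ _) (valb _) h => m v h; nia.
Qed.

Lemma div_fold_lt d l st : bval st.2 < bval d -> bval (foldl (div_step d) st l).2 < bval d.
Proof.
elim: l st => //= c l IH st h; apply: IH; rewrite /div_step /bleq.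
by case: ifP => /= h2; case: c h2 => /=; lia.
Qed.

(** A size bound for every divisor, 0 included, since programs are bounded on all arguments. *)
Lemma div_fold_le d l st : bval (foldl (div_step d) st l).2 <= bval st.2 * 2 ^ size l + valb (rev l) /\
  (bval (foldl (div_step d) st l).1).+1 <= (bval st.1).+1 * 2 ^ size l.
Proof.
elim: l st => [|c l IH] st /=; first by rewrite !muln1 addn0.
have [h1 h2] := IH (div_step d st c).
rewrite rev_cons valb_rcons size_rev expnS; split.
  apply: leq_trans h1 _.
  have : bval (div_step d st c).2 <= c + 2 * bval st.2 by rewrite /div_step; case: ifP => _ /=; lia.
  by move: (2 ^ _) (bval (div_step _ _ _).2) => m r; nia.
apply: leq_trans h2 _; rewrite mulnA leq_mul2r; apply/orP; right.
by rewrite /div_step; case: ifP => _ /=; lia.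
Qed.

Lemma bedivnE (m d : bnat) : 0 < bval d -> bedivn m d = (BN (bval m %/ bval d), BN (bval m %% bval d)).
Proof.
move=> hd; have /= e1 := div_foldE d (rev (bin (bval m))) (BN 0, BN 0).
have := @div_fold_lt d (rev (bin (bval m))) (BN 0, BN 0) hd.
move: e1; rewrite -/(bedivn m d) revK valb_bin mul0n addn0 mul0n add0n.
case: (bedivn m d) => [[q] [r]] /= <- h.
by rewrite divnMDl // divn_small // addn0 modnMDl modn_small.
Qed.

Lemma PT_bedivn a b : PT a -> PT b -> PT (fun x => bedivn (a x) (b x)).
Proof.
move=> ha hb; rewrite /bedivn.
have [p pp hp] := PT_size ha.
apply: (PT_foldc (g := fun x => div_step (b x))); [by pt | by pt | |].
  by rewrite /div_step; pt.
exists (fun n => 8 * p n + 5); first by pb.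
move=> x i; set l := take _ _; case e: (foldl _ _ _) => [[q] [r]].
have hl : 2 ^ size l <= 2 ^ sz (a x).
  rewrite leq_exp2l //.
  apply: ltnW; apply: leq_ltn_trans (leq_size_take _ _) _; rewrite size_rev.
  exact: (sz_mem_size (bin (bval (a x)))).
have [] := div_fold_le (b x) l (BN 0, BN 0); rewrite e /= mul0n mul1n => h1 h2.
have v1 : r < 2 ^ sz (a x).
  by apply: leq_trans hl; apply: leq_ltn_trans h1 _; rewrite add0n -(size_rev l); apply: valb_lt.
have v2 : q < 2 ^ sz (a x) by lia.
by rewrite sz_pair; have := sz_bnat v1; have := sz_bnat v2; have := hp x; lia.
Qed.

Lemma PT_bdiv a b : PT a -> PT b -> PT (fun x => bdiv (a x) (b x)).
Proof. by move=> ha hb; apply: PT_fstc; apply: PT_bedivn. Qed.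
Lemma PT_bmod a b : PT a -> PT b -> PT (fun x => bmod (a x) (b x)).
Proof. by move=> ha hb; apply: PT_sndc; apply: PT_bedivn. Qed.
End ArithMul.

Definition gcd_step (st : bnat * bnat) : bnat * bnat :=
  if bleq st.2 (BN 0) then st else (st.2, bmod st.1 st.2).
Definition bgcd a b := (iter (size (bin (bval a)) + size (bin (bval b))).+2 gcd_step (a, b)).1.

Lemma gcd_step0 st : bval st.2 = 0 -> gcd_step st = st.
Proof. by rewrite /gcd_step /bleq => ->. Qed.

Lemma gcd_stepS a b : 0 < b -> gcd_step (BN a, BN b) = (BN b, BN (a %% b)).
Proof. by move=> h; rewrite /gcd_step /bleq leqNgt h /= /bmod bedivnE. Qed.

Lemma gcd_stepE st : gcdn (bval (gcd_step st).1) (bval (gcd_step st).2) = gcdn (bval st.1) (bval st.2) /\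
  bval (gcd_step st).1 + bval (gcd_step st).2 <= bval st.1 + bval st.2 + bval st.2.
Proof.
case: st => [[a] [b]]; rewrite /gcd_step /bleq /=; case: leqP => //= hb; first by split=> //; lia.
rewrite /bmod bedivnE //= gcdn_modr gcdnC; split=> //.
by have := ltn_pmod a hb; have := leq_mod a b; lia.
Qed.

(** A Euclidean step more than halves the product of the two numbers, because
    [a >= b + a %% b > 2 * (a %% b)] when [b < a]. The number of rounds is therefore logarithmic. *)
Lemma gcd_iter k st : bval st.2 < bval st.1 -> bval st.1 * bval st.2 < 2 ^ k ->
  bval (iter k gcd_step st).2 = 0 /\ bval (iter k gcd_step st).1 = gcdn (bval st.1) (bval st.2).
Proof.
elim: k st => [|k IH] st h1 h2.
  have h : bval st.2 = 0 by rewrite expn0 in h2; nia.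
  by rewrite /= h gcdn0.
rewrite iterSr; have [<- _] := gcd_stepE st; move: h1 h2.
case: st => [[a] [b]]; case: (posnP b) => hb h1 h2.
  by rewrite gcd_step0 //; apply: IH => //=; rewrite hb muln0 expn_gt0.
rewrite gcd_stepS //; apply: IH => /=; first exact: ltn_pmod.
rewrite /= expnS in h1 h2; have := ltn_pmod a hb; have := divn_eq a b.
have : 0 < a %/ b by rewrite divn_gt0 // ltnW.
by move: (a %/ b) (a %% b) (2 ^ k) h2 => q r m; nia.
Qed.

Lemma bgcdE a b : bgcd a b = BN (gcdn (bval a) (bval b)).
Proof.
apply: bval_inj; rewrite /bgcd iterSr.
have [<- _] := gcd_stepE (a, b).
set st := gcd_step (a, b); have [h0|h0] := posnP (bval b).
  have -> : st = (a, b) by apply: gcd_step0.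
  have -> k : iter k gcd_step (a, b) = (a, b) by elim: k => //= k ->; apply: gcd_step0.
  by rewrite /= h0 gcdn0.
have est : st = (BN (bval b), BN (bval a %% bval b)) by rewrite -gcd_stepS // /st; case: (a) (b) => ? [].
have h1 : bval st.2 < bval st.1 by rewrite est /= ltn_pmod.
have h2 : bval st.1 * bval st.2 < 2 ^ (size (bin (bval a)) + size (bin (bval b))).+1.
  have := bin_lt (bval a); have := bin_lt (bval b); rewrite expnS expnD.
  rewrite est /=; have := leq_mod (bval a) (bval b); move: (_ %% _) (2 ^ _) (2 ^ _) => r x y.
  by move: (bval a) (bval b) => u v; nia.
by have [_ ->] := gcd_iter h1 h2.
Qed.

Lemma PT_bgcd {X} {eX : Enc X} (a b : X -> bnat) : PT a -> PT b -> PT (fun x => bgcd (a x) (b x)).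
Proof.
move=> ha hb; rewrite /bgcd; apply: PT_fstc.
have [p pp hp] := PT_size ha; have [q qq hq] := PT_size hb.
apply: (PT_iter (g := fun _ => gcd_step)); [by pt | by pt | |].
  by rewrite /gcd_step; pt; apply: PT_bmod; pt.
exists (fun n => 8 * (p n + q n) + 5); first by pb.
move=> x i _.
have ha2 : bval (a x) < 2 ^ (sz (a x) + sz (b x)).
  by apply: leq_trans (bin_lt_sz _) _; rewrite leq_exp2l // leq_addr.
have hb2 : bval (b x) < 2 ^ (sz (a x) + sz (b x)).
  by apply: leq_trans (bin_lt_sz _) _; rewrite leq_exp2l // leq_addl.
have [h1 h2] : bval (iter i gcd_step (a x, b x)).1 < 2 ^ (sz (a x) + sz (b x)) /\
     bval (iter i gcd_step (a x, b x)).2 < 2 ^ (sz (a x) + sz (b x)).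
  elim: i => [|i [IH1 IH2]]; first by split.
  rewrite iterS; case: (iter _ _ _) IH1 IH2 => [u [v]] /= h1 h2.
  case: (posnP v) => hv; first by rewrite gcd_step0.
  case: u h1 => u h1; rewrite gcd_stepS //=; split=> //.
  by apply: leq_ltn_trans h1; apply: leq_mod.
case: (iter _ _ _) h1 h2 => [[u] [v]] /= h1 h2; rewrite sz_pair.
by have := sz_bnat h1; have := sz_bnat h2; have := hp x; have := hq x; lia.
Qed.

(** * Weights and weighted lists *)

Ltac pt_arith2 := match goal with
  | |- PT (fun x => bmul (@?b x) (@?c x)) => apply: (PT_bmul (a := b) (b := c))
  | |- PT (fun x => bdiv (@?b x) (@?c x)) => apply: (PT_bdiv (a := b) (b := c))
  | |- PT (fun x => bgcd (@?b x) (@?c x)) => apply: (PT_bgcd (a := b) (b := c))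
  | _ => pt_arith
  end.
Ltac pt_hook ::= pt_arith2.

Section Weights.
Import GRing.Theory.
Local Open Scope ring_scope.
HB.instance Definition _ := [isNew for bval].
HB.instance Definition _ := [Equality of bnat by <:].

(* A weight (p, m) denotes p - m: sums and products stay within the naturals. *)
Definition wgt := (bnat * bnat)%type.
Definition wadd (u v : wgt) : wgt := (badd u.1 v.1, badd u.2 v.2).
Definition wmul (u v : wgt) : wgt :=
  (badd (bmul u.1 v.1) (bmul u.2 v.2), badd (bmul u.1 v.2) (bmul u.2 v.1)).
Definition wval (u : wgt) : rat := (bval u.1)%:R - (bval u.2)%:R.
(** Like [wval] it respects sums and products, but nothing cancels in it: it bounds both components
    of a weight and thereby their bit lengths. *)
Definition wmass (u : wgt) : nat := (bval u.1 + bval u.2)%N.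

Lemma wval_add u v : wval (wadd u v) = wval u + wval v.
Proof. by rewrite /wval /= !natrD opprD addrACA. Qed.
Lemma wval_mul u v : wval (wmul u v) = wval u * wval v.
Proof.
rewrite /wval /= !natrD !natrM mulrDl !mulrDr !mulNr !mulrN opprK opprD.
by rewrite addrACA [X in _ + X]addrC -!addrA; congr (_ + _); rewrite addrCA.
Qed.
Lemma wmass_add u v : wmass (wadd u v) = (wmass u + wmass v)%N.
Proof. by rewrite /wmass /= addnACA. Qed.
Lemma wmass_mul u v : wmass (wmul u v) = (wmass u * wmass v)%N.
Proof. by rewrite /wmass /=; lia. Qed.

Lemma PT_wadd {X} {eX : Enc X} (u v : X -> wgt) : PT u -> PT v -> PT (fun x => wadd (u x) (v x)).
Proof. by move=> hu hv; rewrite /wadd; pt. Qed.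
Lemma PT_wmul {X} {eX : Enc X} (u v : X -> wgt) : PT u -> PT v -> PT (fun x => wmul (u x) (v x)).
Proof. by move=> hu hv; rewrite /wmul; pt. Qed.

Definition wone : wgt := (BN 1, BN 0).
Lemma wval_one : wval wone = 1. Proof. by rewrite /wval /= subr0. Qed.

Section Lin.
Variables (R : pzSemiRingType) (nu : wgt -> R).
(** A weighted list is a formal linear combination of keys. The value [nu] of a weight is a
    parameter because the same identities serve correctness, with [wval], and size bounds, with
    [wmass]. *)
Definition lin (key : Type) (l : seq (key * wgt)) (phi : key -> R) : R :=
  \sum_(e <- l) nu e.2 * phi e.1.
End Lin.

Section Norm.
Variables (key : eqType).
Implicit Types l : seq (key * wgt).

Definition keys l := map fst l.
Definition ins l (kv : key * wgt) : seq (key * wgt) :=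
  if kv.1 \in keys l then map (fun e => if e.1 == kv.1 then (e.1, wadd e.2 kv.2) else e) l
  else kv :: l.
(** Merging equal keys keeps the tables short: their length is then at most the number of possible
    keys, while every linear functional keeps its value. *)
Definition norm l := foldl ins [::] l.

Lemma keys_ins l kv : keys (ins l kv) = if kv.1 \in keys l then keys l else kv.1 :: keys l.
Proof.
rewrite /ins /keys; case: ifP => // _; rewrite -map_comp; apply: eq_map => e /=.
by case: ifP.
Qed.

Lemma uniq_ins l kv : uniq (keys l) -> uniq (keys (ins l kv)).
Proof. by rewrite keys_ins; case: ifP => //= ->. Qed.

Lemma mem_keys_ins l kv : keys (ins l kv) =i kv.1 :: keys l.
Proof.
move=> k; rewrite keys_ins; case: ifP => // h; rewrite in_cons.
by case: eqP => // ->.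
Qed.

Lemma fold_ins_keys l0 l : uniq (keys l0) ->
  uniq (keys (foldl ins l0 l)) /\ keys (foldl ins l0 l) =i keys l0 ++ keys l.
Proof.
elim: l l0 => [|kv l IH] l0 h /=; first by split=> // k; rewrite cats0.
have [h1 h2] := IH _ (uniq_ins kv h); split=> // k.
by rewrite h2 !mem_cat mem_keys_ins !in_cons orbA [(_ == _) || _]orbC.
Qed.

Lemma uniq_norm l : uniq (keys (norm l)).
Proof. by have [] := fold_ins_keys l (isT : uniq (keys [::])). Qed.

Lemma mem_keys_norm l : keys (norm l) =i keys l.
Proof. by have [] := fold_ins_keys l (isT : uniq (keys [::])). Qed.

Section LinNorm.
Variables (R : pzSemiRingType) (nu : wgt -> R).
Hypothesis nu_add : forall u v, nu (wadd u v) = nu u + nu v.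

Lemma lin_ins l kv phi : uniq (keys l) -> lin nu (ins l kv) phi = lin nu l phi + nu kv.2 * phi kv.1.
Proof.
rewrite /ins /lin; case: ifP => hk hu; last by rewrite big_cons addrC.
elim: l hk hu => //= e l IH; rewrite in_cons big_cons => hk /andP[he hu]; rewrite big_cons.
case: eqP hk => [e1|ne] /= hk.
  rewrite e1 eqxx /= nu_add mulrDl big_map.
  rewrite [X in _ + X](_ : _ = \sum_(f <- l) nu f.2 * phi f.1).
    by rewrite -!addrA; congr (_ + _); rewrite addrC.
  rewrite big_seq [RHS]big_seq; apply: eq_bigr => f hf.
  by case: eqP => // e2; case/negP: he; rewrite -e2; apply: (map_f fst).
by rewrite eq_sym; case: eqP => [e2|_]; [case: ne | rewrite IH // addrA].
Qed.

Lemma lin_norm l phi : lin nu (norm l) phi = lin nu l phi.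
Proof.
rewrite /norm -[RHS]add0r -[0]/(0 : R) -[X in X + _](_ : lin nu [::] phi = 0); last by rewrite /lin big_nil.
have : uniq (keys [::]) by [].
elim: l [::] => [|kv l IH] l0 h /=; first by rewrite /lin big_nil addr0.
by rewrite IH ?uniq_ins // lin_ins // -addrA; congr (_ + _); rewrite /lin big_cons.
Qed.
End LinNorm.

Definition mass l : nat := lin wmass l (fun _ => 1%N).

Lemma mass_norm l : mass (norm l) = mass l.
Proof. exact: (lin_norm wmass_add). Qed.

Lemma size_norm l : (size (norm l) <= size l)%N.
Proof.
have h l0 kv : (size (ins l0 kv) <= (size l0).+1)%N.
  by rewrite /ins; case: ifP => _ //=; rewrite size_map.
rewrite /norm -[size l]addn0 -[0%N]/(size (@nil (key * wgt))).
elim: l [::] => [|kv l IH] l0 //=; apply: leq_trans (IH _) _.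
by rewrite addSnnS leq_add2l.
Qed.

Lemma massE l : mass l = (\sum_(e <- l) wmass e.2)%N.
Proof. by rewrite /mass /lin; apply: eq_bigr => e _; rewrite [_ * _]muln1. Qed.

Lemma wmass_le_mass l e : e \in l -> (wmass e.2 <= mass l)%N.
Proof.
rewrite massE; elim: l => //= f l IH; rewrite in_cons big_cons => /orP[/eqP ->|/IH h].
  exact: leq_addr.
exact: leq_trans h (leq_addl _ _).
Qed.

End Norm.

Section NormPT.
Variables (key : eqType) (eK : Enc key).
Hypothesis inj : injective eK.
Implicit Types l : seq (key * wgt).

(** The three bounds that make a table small: number of entries, size of keys, and mass. A weight
    has two numbers of at most [E] bits, each encoded with four symbols per bit. *)
Lemma sz_wlist l N Ks E : (size l <= N)%N -> (forall k, k \in keys l -> (sz k <= Ks)%N) ->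
  (mass l < 2 ^ E)%N -> (sz l <= N * (Ks + 8 * E + 5) + 1)%N.
Proof.
move=> hN hK hE; apply: (@leq_trans (size l * (Ks + 8 * E + 5) + 1)); last first.
  by rewrite leq_add2r leq_mul2r hN orbT.
have : forall e, e \in l -> (sz e.1 <= Ks)%N /\ (wmass e.2 < 2 ^ E)%N.
  move=> e he; split; first by apply: hK; apply: map_f.
  by apply: leq_ltn_trans (wmass_le_mass he) hE.
elim: l {hN hK hE} => // [[k [[u] [v]]] l] IH h.
have [h1 h2] := h _ (mem_head _ _); rewrite /= /wmass /= in h1 h2.
have hu : (u < 2 ^ E)%N by lia.
have hv : (v < 2 ^ E)%N by lia.
have IH' : (sz l <= size l * (Ks + 8 * E + 5) + 1)%N.
  by apply: IH => e he; apply: h; rewrite in_cons he orbT.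
rewrite sz_cons !sz_pair /= mulSn.
by have := sz_bnat hu; have := sz_bnat hv; move: (_ * _)%N IH'; lia.
Qed.

Lemma sz_mem (A : eqType) (eA : Enc A) (a : A) (l : seq A) : a \in l -> (sz a <= sz l)%N.
Proof. by elim: l => // b l IH; rewrite in_cons sz_cons => /orP[/eqP -> | /IH]; lia. Qed.

Lemma mass_lt_sz l : (mass l < 2 ^ sz l)%N.
Proof.
rewrite massE; elim: l => [|[k [u v]] l IH]; first by rewrite big_nil expn_gt0.
rewrite big_cons sz_cons !sz_pair /wmass /=.
have hu := bin_lt_sz u; have hv := bin_lt_sz v.
apply: (@leq_trans (2 ^ sz u + 2 ^ sz v + 2 ^ sz l)%N); first by rewrite /wmass in IH; move: IH hu hv; lia.
apply: (@leq_trans (2 ^ (sz u + sz v + sz l + 2))%N); last by rewrite leq_exp2l //; lia.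
have p1 : (0 < 2 ^ sz u)%N by rewrite expn_gt0.
have p2 : (0 < 2 ^ sz v)%N by rewrite expn_gt0.
have p3 : (0 < 2 ^ sz l)%N by rewrite expn_gt0.
rewrite !expnD; move: (2 ^ sz u)%N (2 ^ sz v)%N (2 ^ sz l)%N p1 p2 p3 => a b c p1 p2 p3.
have h1 : (a <= a * b * c)%N by rewrite -mulnA leq_pmulr // muln_gt0 p2.
have h2 : (b <= a * b * c)%N by rewrite mulnAC leq_pmull // muln_gt0 p1.
have h3 : (c <= a * b * c)%N by rewrite leq_pmull // muln_gt0 p1.
by rewrite (_ : 2 ^ 2 = 4)%N //; lia.
Qed.

Lemma PT_norm {X} {eX : Enc X} (l : X -> seq (key * wgt)) : PT l -> PT (fun x => norm (l x)).
Proof.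
move=> hl; rewrite /norm.
have hmem : PT (fun p : seq key * key => p.2 \in p.1).
  apply: (@PT_ext _ _ _ _ (fun p => foldl (fun s k => s || (k == p.2)) false p.1)).
    move=> [s k] /=; rewrite -[RHS]orFb; elim: s false => [|k' s IH] b /=; first by rewrite orbF.
    by rewrite IH in_cons orbA (eq_sym k).
  apply: (PT_fold_add (g := fun p s k => s || (k == p.2))); [by pt|by pt| |].
    by apply: PT_orb; [by pt | apply: (PT_eqc inj); pt].
  by exists (fun => 3); [pb | move=> p b k; case: (b || _); rewrite /sz /tsz /=; lia].
have [p pp hp] := PT_size hl.
apply: (PT_foldc (g := fun _ => @ins key)) => //; first by pt.
  rewrite /ins; apply: PT_ifc; last by pt.
    apply: (PT_comp (g := fun p : seq key * key => p.2 \in p.1) hmem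
       (f := fun p : X * seq (key * wgt) * (key * wgt) => (keys p.1.2, p.2.1))).
    by pt; rewrite /keys; apply: (PT_map (f := fun _ e => e.1)); pt.
  apply: (PT_map (f := fun p e => if e.1 == p.2.1 then (e.1, wadd e.2 p.2.2) else e)); last by pt.
  by pt; [apply: (PT_eqc inj); pt | apply: PT_wadd; pt].
(* Merging neither changes the mass nor creates keys, so the bounds for the merged list are those of
   the prefix read, hence of the whole list. *)
exists (fun n => p n * (p n + 8 * p n + 5) + 1)%N; first by pb.
move=> x i; rewrite -/(norm _); set l0 := take i (l x).
have h0 : (sz l0 <= p (sz x))%N by apply: leq_trans (sz_take _ _) (hp x).
apply: sz_wlist.
- by apply: leq_trans (size_norm _) _; apply: ltnW; apply: leq_trans (sz_mem_size _) h0.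
- move=> k; rewrite mem_keys_norm => /mapP[e he ->]; apply: leq_trans h0.
  by apply: leq_trans (sz_mem _ he); case: e {he} => k' v; rewrite sz_pair /=; lia.
rewrite mass_norm; apply: leq_trans (mass_lt_sz _) _.
by rewrite leq_exp2l.
Qed.

End NormPT.

Section MergeBind.
Variables (key0 key : eqType).
Implicit Type D : seq (key0 * wgt).

Definition scale (v : wgt) (l : seq (key * wgt)) := map (fun e => (e.1, wmul v e.2)) l.
(** The linear extension of [f] to formal combinations, a monadic bind, followed by merging. *)
Definition mb (f : key0 -> seq (key * wgt)) D : seq (key * wgt) :=
  norm (flatten (map (fun e => scale e.2 (f e.1)) D)).

Lemma lin_mb (R : pzSemiRingType) (nu : wgt -> R) f D phi :
  (forall u v, nu (wadd u v) = nu u + nu v) -> (forall u v, nu (wmul u v) = nu u * nu v) ->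
  lin nu (mb f D) phi = lin nu D (fun k => lin nu (f k) phi).
Proof.
move=> ha hm; rewrite /mb lin_norm // /lin big_flatten big_map; apply: eq_bigr => e _.
rewrite /scale big_map mulr_sumr; apply: eq_bigr => e' _ /=; by rewrite hm mulrA.
Qed.

Lemma mass_mb_le f D c : (forall k, k \in keys D -> (mass (f k) <= c)%N) ->
  (mass (mb f D) <= mass D * c)%N.
Proof.
move=> h; rewrite {1}/mass lin_mb; [|exact: wmass_add|exact: wmass_mul].
rewrite /mass /lin big_distrl big_seq [X in (_ <= X)%N]big_seq; apply: leq_sum => e he; rewrite mulr1.
by apply: leq_mul => //; apply: h; apply: map_f.
Qed.

Lemma mem_mb f D k : k \in keys (mb f D) -> exists2 e, e \in D & k \in keys (f e.1).
Proof.
rewrite /mb mem_keys_norm /keys.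
elim: D => //= e D IH; rewrite map_cat mem_cat => /orP[|/IH[e' h1 h2]].
  by rewrite /scale -map_comp; exists e; rewrite ?mem_head.
by exists e'; rewrite // in_cons h1 orbT.
Qed.

Lemma uniq_mb f D : uniq (keys (mb f D)). Proof. exact: uniq_norm. Qed.

Lemma PT_mb {X} {eX : Enc X} {e0 : Enc key0} (eK : Enc key) (f : X -> key0 -> seq (key * wgt)) :
  injective eK -> PT (fun p : X * key0 => f p.1 p.2) ->
  forall D : X -> seq (key0 * wgt), PT D -> PT (fun x => mb (f x) (D x)).
Proof.
move=> inj hf l hl; rewrite /mb; apply: PT_norm => //.
apply: (PT_bind (f := fun x e => scale e.2 (f x e.1))) => //.
rewrite /scale; apply: (PT_map (f := fun p e => (e.1, wmul p.2.2 e.2))).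
  by pt; apply: PT_wmul; pt.
by apply: (PT_app2 (g := f)) => //; pt.
Qed.

End MergeBind.
End Weights.

(** * The cell-count dynamic program *)

Section Meta.
Context {X B : Type} {eX : Enc X} {eB : Enc B}.
Variable I : Type.

(** Here [l] is fixed and not part of the data: the program runs a fixed sequence of subprograms. *)
Lemma PT_metamap (F : I -> X -> B) (l : seq I) : (forall i, PT (F i)) -> PT (fun x => [seq F i x | i <- l]).
Proof. by move=> h; elim: l => [|i l IH] /=; pt. Qed.

Lemma PT_metaflatten (F : I -> X -> seq B) (l : seq I) : (forall i, PT (F i)) ->
  PT (fun x => flatten [seq F i x | i <- l]).
Proof. by move=> h; elim: l => [|i l IH] /=; pt. Qed.
End Meta.

Section Histogram.
Variable S : finType.
Definition idx (s : S) : nat := enum_rank s.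
Definition expand (h : seq nat) : seq S := flatten [seq nseq (nth 0 h (idx s)) s | s <- enum S].

Lemma size_expand h : size h = #|S| -> size (expand h) = sumn h.
Proof.
move=> hs; rewrite /expand size_flatten /shape -map_comp sumnE big_map big_enum /=.
transitivity (\sum_(j < #|S|) nth 0 h j); last first.
  by rewrite sumnE (big_nth 0) big_mkord hs.
rewrite (reindex_onto enum_val enum_rank) /=; last by move=> s _; rewrite enum_rankK.
by apply: eq_big => [j|j _]; rewrite ?enum_valK ?eqxx // size_nseq /idx enum_valK.
Qed.

Lemma count_expand h s : count_mem s (expand h) = nth 0 h (idx s).
Proof.
rewrite /expand count_flatten -map_comp sumnE big_map big_enum /= (bigD1 s) //=.
rewrite count_nseq /= eqxx mul1n big1 ?addn0 // => t /negbTE ht.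
by rewrite count_nseq /= ht mul0n.
Qed.

Lemma sumn_incr (h : seq nat) i : sumn (incr_nth h i) = (sumn h).+1.
Proof.
elim: h i => [|a h IH] [|i] //=; last by rewrite IH addnS.
by elim: i => //= i ->.
Qed.

Lemma sz_nats (h : seq nat) : sz h = 2 * sumn h + 2 * size h + 1.
Proof.
elim: h => [|a h IH]; first by rewrite sz_nil.
by rewrite sz_cons IH sz_nat /=; lia.
Qed.

Lemma sz_fin (F : finType) (f : F) : @sz _ (@enc_fin F) f <= 2 * #|F| + 1.
Proof. by rewrite -[sz f]/(sz (enum_rank f : nat)) sz_nat; have : enum_rank f < #|F| by [exact: ltn_ord]; lia. Qed.

(** A histogram of total at most [H] is a function from ['I_m] to ['I_H.+1]. As [m] is the number of
    classes, fixed by the sentence, this count is polynomial in the domain size; domain-liftability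
    rests on it. *)
Lemma size_hist_keys (F : finType) (l : seq (seq nat * F)) m H : uniq l ->
  (forall k, k \in l -> size k.1 = m /\ sumn k.1 <= H) -> size l <= H.+1 ^ m * #|F|.
Proof.
move=> hu hl.
have le_sumn (s : seq nat) i : nth 0 s i <= sumn s.
  elim: s i => [|a s IH] [|i] //=; first exact: leq_addr.
  by apply: leq_trans (IH i) (leq_addl _ _).
pose f (k : seq nat * F) : {ffun 'I_m -> 'I_H.+1} * F := ([ffun i : 'I_m => inord (nth 0 k.1 i)], k.2).
have hinj : {in l &, injective f}.
  move=> [h1 f1] [h2 f2] /hl[/= s1 t1] /hl[/= s2 t2] [/ffunP e ->]; congr pair.
  apply: (@eq_from_nth _ 0); rewrite ?s1 ?s2 // => i hi.
  have := e (Ordinal hi); rewrite !ffunE => /(congr1 val) /=.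
  by rewrite !inordK // ltnS; apply: leq_trans (le_sumn _ _) _.
have <- : #|(({ffun 'I_m -> 'I_H.+1} * F)%type : finType)| = H.+1 ^ m * #|F|.
  by rewrite card_prod card_ffun !card_ord.
rewrite -(size_map f) -(card_uniqP _); last by rewrite map_inj_in_uniq.
exact: max_card.
Qed.
End Histogram.

Section DP.
Context {X : Type} {eX : Enc X}.
Variables (C T A G B : finType) (ts : seq T).
Variables (u : C -> X -> wgt) (v : T -> X -> wgt) (bstep : B -> G -> X -> seq (G * wgt)).
Variables (a0 : C -> A) (gC : C -> G -> G) (gT : T -> G -> G) (up1 up2 : C -> C -> T -> A -> A).
Variables (g0 : G) (bigcount : B -> X -> nat) (nn : X -> nat).
Variables (okg : G -> bool) (okc : C * A -> bool).

Definition clsT : finType := (C * A)%type.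
(* A histogram lists the number of elements in each class of [clsT]. While an element is being added,
   the key also carries the accumulator of that element. *)
Definition hkey := (seq nat * G)%type.
Definition rkey := (seq nat * (A * G))%type.

Definition inner_succ (c : C) (x : X) (s : clsT) (k : rkey) : seq (rkey * wgt) :=
  [seq ((incr_nth k.1 (idx ((s.1, up1 s.1 c t s.2) : clsT)), (up2 s.1 c t k.2.1, gT t k.2.2)), v t x) | t <- ts].
Definition inner c x (D : seq (rkey * wgt)) s := mb (inner_succ c x s) D.
Definition row0 c x (g : G) : seq (rkey * wgt) :=
  [:: ((nseq #|clsT| 0, (a0 c, gC c g)), u c x)].
(** The histogram is rebuilt from zero: each old element, once paired with the new one, is entered
    under its updated accumulator. The new element itself follows in [close_row]. *)
Definition row c x (k : hkey) := foldl (inner c x) (row0 c x k.2) (@expand clsT k.1).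
Definition close_row (c : C) (e : rkey * wgt) : hkey * wgt :=
  ((incr_nth e.1.1 (idx ((c, e.1.2.1) : clsT)), e.1.2.2), e.2).
Definition extend x (k : hkey) := flatten [seq map (close_row c) (row c x k) | c <- enum C].
Definition bigs x : seq B := flatten [seq nseq (bigcount b x) b | b <- enum B].
Definition big_fold x := foldl (fun D b => mb (fun g => bstep b g x) D) [:: (g0, wone)] (bigs x).
Definition start x : seq (hkey * wgt) := [seq ((nseq #|clsT| 0, e.1), e.2) | e <- big_fold x].
Definition final x := iter (nn x) (fun P => mb (extend x) P) (start x).
Definition ok (k : hkey) : bool :=
  okg k.2 && all (fun s => (nth 0 k.1 (idx s) == 0) || okc s) (enum clsT).
Definition result x := foldl (fun acc e => if ok e.1 then wadd acc e.2 else acc) (BN 0, BN 0) (final x).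

#[local] Instance eC : Enc C := @enc_fin C.
#[local] Instance eT : Enc T := @enc_fin T.
#[local] Instance eA : Enc A := @enc_fin A.
#[local] Instance eG : Enc G := @enc_fin G.
#[local] Instance eB : Enc B := @enc_fin B.
#[local] Instance eS : Enc clsT := @enc_fin clsT.

Hypothesis hu : forall c, PT (u c).
Hypothesis hv : forall t, PT (v t).
Hypothesis hb : forall b g, PT (bstep b g).
Hypothesis hcount : forall b, PT (bigcount b).
Hypothesis hn : PT nn.

Lemma inj_rkey : injective (_ : Enc rkey).
Proof.
apply: enc_inj_pair; first exact: enc_inj_seq enc_inj_nat.
by apply: enc_inj_pair; exact: enc_inj_fin.
Qed.

Lemma inj_hkey : injective (_ : Enc hkey).
Proof. by apply: enc_inj_pair; [exact: enc_inj_seq enc_inj_nat | exact: enc_inj_fin]. Qed.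

Lemma PT_inner c : PT (fun p : X * seq (rkey * wgt) * clsT => inner c p.1.1 p.1.2 p.2).
Proof.
apply: (PT_fincase (t := fun p => p.2) (f := fun s p => inner c p.1.1 p.1.2 s)); first by pt.
move=> s; rewrite /inner; apply: (PT_mb (f := fun p => inner_succ c p.1.1 s)); [exact: inj_rkey | | by pt].
apply: PT_metamap => t.
apply: PT_pair; last by apply: (PT_comp (hv t)); pt.
apply: PT_pair; first by apply: PT_incr_nth; pt.
by apply: PT_pair; apply: (PT_finfun); pt.
Qed.

Lemma PT_expand {Y} {eY : Enc Y} (h : Y -> seq nat) : PT h -> PT (fun y => @expand clsT (h y)).
Proof. by move=> hh; apply: PT_metaflatten => s; apply: PT_nseq; [apply: PT_nth | pt]. Qed.

Lemma size_incr h (s : clsT) : size h = #|clsT| -> size (incr_nth h (idx s)) = #|clsT|.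
Proof. by move=> hs; rewrite size_incr_nth hs /idx ltn_ord. Qed.

(** The weights depend on the table [t] only, so the size of one fixed list of them bounds the mass
    uniformly in cells and keys. *)
Lemma mass_succ : exists p, forall x c s k, mass (inner_succ c x s k) < 2 ^ ((sz x).+2 ^ p).
Proof.
have h : PT (fun x => [seq (tt, v t x) | t <- ts]) by apply: PT_metamap => t; pt.
have [q [p pp] hp] := PT_size h; exists p => // x c s k.
apply: (@leq_trans (2 ^ sz [seq (tt, v t x) | t <- ts])); last first.
  by rewrite leq_exp2l //; apply: leq_trans (hp x) (pp _).
apply: leq_ltn_trans (mass_lt_sz _ _).
by rewrite !massE !big_map.
Qed.

Lemma mass_u : exists p, forall x, mass [seq (c, u c x) | c <- enum C] < 2 ^ ((sz x).+2 ^ p).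
Proof.
have h : PT (fun x => [seq (c, u c x) | c <- enum C]) by apply: PT_metamap => t; pt.
have [q [p pp] hp] := PT_size h; exists p => // x.
by apply: leq_trans (mass_lt_sz _ _) _; rewrite leq_exp2l //; apply: leq_trans (hp x) (pp _).
Qed.

Lemma row_fold_keys c x g l k : k \in keys (foldl (inner c x) (row0 c x g) l) ->
  size k.1 = #|clsT| /\ sumn k.1 = size l.
Proof.
elim/last_ind: l k => [|l s IH] k.
  by rewrite /= inE => /eqP -> /=; rewrite size_nseq sumn_nseq.
rewrite foldl_rcons => /mem_mb[e he]; rewrite /keys -map_comp => /mapP[t _ -> /=].
have [h1 h2] := IH e.1 (map_f _ he).
by rewrite size_incr // sumn_incr h2 size_rcons.
Qed.

Lemma row_fold_uniq c x g l : uniq (keys (foldl (inner c x) (row0 c x g) l)).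
Proof. by elim/last_ind: l => // l s IH; rewrite foldl_rcons; apply: uniq_mb. Qed.

Lemma row_fold_mass x p c g l : (forall c s k, mass (inner_succ c x s k) < 2 ^ p) ->
  mass (foldl (inner c x) (row0 c x g) l) <= wmass (u c x) * 2 ^ (p * size l).
Proof.
move=> hp; elim/last_ind: l => [|l s IH]; first by rewrite massE big_seq1 muln0 muln1.
rewrite foldl_rcons size_rcons mulnS expnD [2 ^ p * _]mulnC mulnA.
apply: leq_trans (mass_mb_le (c := 2 ^ p) _) _; first by move=> k _; apply: ltnW; apply: hp.
by rewrite leq_mul2r IH orbT.
Qed.

Lemma PT_row c : PT (fun p : X * hkey => row c p.1 p.2).
Proof.
have [ps hs] := mass_succ; have [pu hpu] := mass_u.
have he : PT (fun p : X * hkey => @expand clsT p.2.1) by apply: PT_expand; pt.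
have [pl ppl hpl] := PT_size he.
apply: (PT_foldc (g := fun p => inner c p.1)) => //.
- rewrite /row0; apply: PT_cons; last by pt.
  apply: PT_pair; last by apply: (PT_comp (hu c)); pt.
  by do 2 (apply: PT_pair; first by pt); apply: PT_finfun; pt.
- by apply: (PT_comp (g := fun p : X * seq (rkey * wgt) * clsT => inner c p.1.1 p.1.2 p.2) (PT_inner c)
    (f := fun p : X * hkey * seq (rkey * wgt) * clsT => (p.1.1.1, p.1.2, p.2))); pt.
set K0 := 2 * #|clsT| + (2 * #|A| + 2 * #|G|) + 6.
(* Number of keys times size of an entry: the histogram contributes [2 * pl n], the rest of the key
   [K0], and the weight is a product of one cell weight and at most [pl n] table weights. *)
exists (fun n => (pl n).+1 ^ #|clsT| * #|((A * G)%type : finType)| *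
  ((2 * pl n + K0) + 8 * (n.+2 ^ pu + n.+2 ^ ps * pl n) + 5) + 1).
  by pb.
move=> p i; set l := take i _.
have hl : size l <= pl (sz p).
  by apply: leq_trans (leq_size_take _ _) _; apply: ltnW; apply: leq_trans (sz_mem_size _) (hpl p).
have hk k : k \in keys (foldl (inner c p.1) (row0 c p.1 p.2.2) l) ->
    size k.1 = #|clsT| /\ sumn k.1 <= pl (sz p).
  by case/row_fold_keys => -> ->.
apply: sz_wlist.
- by rewrite -(size_map fst); apply: size_hist_keys hk; exact: row_fold_uniq.
- move=> [h [a g]] /hk[h1 h2].
  have {}h1 : size h = #|clsT| := h1; have {}h2 : sumn h <= pl (sz p) := h2.
  rewrite !sz_pair sz_nats h1 /K0.
  have ha : sz a <= 2 * #|A| + 1 by exact: sz_fin.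
  have hg : sz g <= 2 * #|G| + 1 by exact: sz_fin.
  by lia.
have hp : sz p.1 <= sz p by case: (p) => a b; rewrite [X in _ <= X]sz_pair /=; lia.
apply: (@leq_trans (2 ^ ((sz p.1).+2 ^ pu + (sz p.1).+2 ^ ps * size l))); last first.
  rewrite leq_exp2l //; apply: leq_add; first by apply: leq_expb.
  by apply: leq_mul => //; apply: leq_expb.
rewrite expnD; apply: leq_ltn_trans (row_fold_mass _ _ _ (fun c s k => hs p.1 c s k)) _.
rewrite ltn_mul2r expn_gt0 /=; apply: leq_ltn_trans (hpu p.1).
by rewrite massE big_map (bigD1_seq c) ?mem_enum ?enum_uniq //= leq_addr.
Qed.

Lemma PT_extend : PT (fun p : X * hkey => extend p.1 p.2).
Proof.
apply: PT_metaflatten => c; apply: (PT_map (f := fun _ => close_row c)); last exact: PT_row.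
rewrite /close_row; apply: PT_pair; last by pt.
apply: PT_pair; last by pt.
apply: (PT_fincase (t := fun p : X * hkey * (rkey * wgt) => p.2.1.2.1)
  (f := fun a p => incr_nth p.2.1.1 (idx ((c, a) : clsT)))); first by pt.
by move=> a; apply: PT_incr_nth; pt.
Qed.

Lemma PT_step : PT (fun p : X * seq (hkey * wgt) => mb (extend p.1) p.2).
Proof.
apply: (PT_mb (f := fun p => extend p.1)); [exact: inj_hkey | | by pt].
by apply: (PT_comp (g := fun p : X * hkey => extend p.1 p.2) PT_extend
  (f := fun p : X * seq (hkey * wgt) * hkey => (p.1.1, p.2))); pt.
Qed.

Lemma mass_big : exists p, forall x b g, mass (bstep b g x) < 2 ^ ((sz x).+2 ^ p).
Proof.
have h : PT (fun x => flatten [seq bstep bg.1 bg.2 x | bg <- enum ((B * G)%type : finType)]).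
  by apply: PT_metaflatten => -[b g]; exact: hb.
have [q [p pp] hp] := PT_size h; exists p => // x b g.
apply: (@leq_ltn_trans (mass (flatten [seq bstep bg.1 bg.2 x | bg <- enum ((B * G)%type : finType)]))).
  by rewrite !massE big_flatten big_map (bigD1_seq (b, g)) ?mem_enum ?enum_uniq //= leq_addr.
apply: leq_trans (mass_lt_sz _ _) _.
by rewrite leq_exp2l //; apply: leq_trans (hp x) (pp _).
Qed.

Lemma PT_bigs : PT bigs.
Proof. by apply: PT_metaflatten => b; apply: PT_nseq; pt. Qed.

Lemma big_fold_uniq x l : uniq (keys (foldl (fun D b => mb (fun g => bstep b g x) D) [:: (g0, wone)] l)).
Proof. by elim/last_ind: l => // l s IH; rewrite foldl_rcons; apply: uniq_mb. Qed.

Lemma big_fold_mass x p l : (forall b g, mass (bstep b g x) < 2 ^ p) ->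
  mass (foldl (fun D b => mb (fun g => bstep b g x) D) [:: (g0, wone)] l) <= 2 ^ (p * size l).
Proof.
move=> hp; elim/last_ind: l => [|l s IH]; first by rewrite massE big_seq1 muln0.
rewrite foldl_rcons size_rcons mulnS expnD [2 ^ p * _]mulnC.
apply: leq_trans (mass_mb_le (c := 2 ^ p) _) _; first by move=> k _; apply: ltnW; apply: hp.
by rewrite leq_mul2r IH orbT.
Qed.

Lemma PT_big_fold : PT big_fold.
Proof.
have [pb_ hpb] := mass_big; have [pl ppl hpl] := PT_size PT_bigs.
apply: (PT_foldc (g := fun x D b => mb (fun g => bstep b g x) D)); [by pt | exact: PT_bigs | |].
  apply: (PT_fincase (t := fun p : X * seq (G * wgt) * B => p.2)
    (f := fun b p => mb (fun g => bstep b g p.1.1) p.1.2)); first by pt.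
  move=> b; apply: (PT_mb (f := fun p g => bstep b g p.1.1)); [exact: enc_inj_fin | | by pt].
  apply: (PT_fincase (t := fun p : X * seq (G * wgt) * B * G => p.2)
    (f := fun g p => bstep b g p.1.1.1)); first by pt.
  by move=> g; apply: (PT_comp (hb b g)); pt.
exists (fun n => #|G| * ((2 * #|G| + 1) + 8 * (n.+2 ^ pb_ * pl n + 1) + 5) + 1); first by pb.
move=> x i; set l := take i _.
have hl : size l <= pl (sz x).
  by apply: leq_trans (leq_size_take _ _) _; apply: ltnW; apply: leq_trans (sz_mem_size _) (hpl x).
apply: sz_wlist => [|g _|].
- rewrite -(size_map fst) -(card_uniqP _) ?max_card //; exact: big_fold_uniq.
- exact: sz_fin.
apply: leq_ltn_trans (big_fold_mass _ (hpb x)) _.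
by rewrite addn1 ltn_exp2l // ltnS leq_mul2l hl orbT.
Qed.

Lemma PT_start : PT start.
Proof.
apply: (PT_map (f := fun _ e => ((nseq #|clsT| 0, e.1), e.2))); last exact: PT_big_fold.
by pt.
Qed.

Definition steps x i := iter i (fun P => mb (extend x) P) (start x).

(** The total of a histogram is the number of elements added so far. This bounds the number of keys
    as well as the length of every row. *)
Lemma steps_keys x i k : k \in keys (steps x i) -> size k.1 = #|clsT| /\ sumn k.1 = i.
Proof.
elim: i k => [|i IH] k.
  by rewrite /= /start /keys -map_comp => /mapP[e _ -> /=]; rewrite size_nseq sumn_nseq.
rewrite /steps iterS -/(steps x i) => /mem_mb[e /(map_f fst)/IH[h1 h2]].
rewrite /keys /extend => /mapP[f /flatten_mapP[c _ /mapP[r hr ->]] ->] /=.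
have [h3 h4] := row_fold_keys (map_f fst hr).
by rewrite size_incr ?sumn_incr ?h4 ?size_expand ?h2 //; split.
Qed.

Lemma steps_uniq x i : uniq (keys (steps x i)).
Proof.
case: i => [|i]; last by rewrite /steps iterS; exact: uniq_mb.
have -> : keys (steps x 0) = [seq (nseq #|clsT| 0, g) | g <- keys (big_fold x)].
  by rewrite /keys /steps /= /start -!map_comp.
by rewrite map_inj_uniq => [|a b []] //; exact: big_fold_uniq.
Qed.

Lemma mass_extend x ps pu k : (forall c s k, mass (inner_succ c x s k) < 2 ^ ps) ->
  mass [seq (c, u c x) | c <- enum C] < 2 ^ pu -> size k.1 = #|clsT| ->
  mass (extend x k) <= 2 ^ (pu + ps * sumn k.1).
Proof.
move=> hs h hk; rewrite expnD; apply: (@leq_trans (mass [seq (c, u c x) | c <- enum C] * 2 ^ (ps * sumn k.1))).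
  rewrite !massE big_flatten !big_map big_distrl; apply: leq_sum => c _ /=.
  rewrite big_map -(size_expand hk) /=.
  by apply: leq_trans (row_fold_mass c k.2 (@expand clsT k.1) hs); rewrite massE.
by rewrite leq_mul2r (ltnW h) orbT.
Qed.

Lemma PT_final : PT final.
Proof.
have [ps hs] := mass_succ; have [pu hpu] := mass_u; have [q qq hq] := PT_size hn.
have [r rr hr] := PT_size PT_start.
apply: (PT_iter (g := fun x P => mb (extend x) P)) => //; [exact: PT_start | exact: PT_step |].
set K0 := 2 * #|clsT| + 2 * #|G| + 6.
(* Each of the at most [q n] elements multiplies the mass by a cell weight and by at most [q n]
   table weights; [r n] accounts for the start table. *)
exists (fun n => (q n).+1 ^ #|clsT| * #|G| *
  ((2 * q n + K0) + 8 * (r n + (n.+2 ^ pu + n.+2 ^ ps * q n) * q n) + 5) + 1); first by pb.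
move=> x i hi; rewrite -/(steps x i).
have hnq : nn x <= q (sz x) by have := hq x; rewrite sz_nat; lia.
have hk k : k \in keys (steps x i) -> size k.1 = #|clsT| /\ sumn k.1 <= q (sz x).
  by case/steps_keys => -> ->; split=> //; apply: leq_trans hnq.
apply: sz_wlist.
- by rewrite -(size_map fst); apply: size_hist_keys hk; exact: steps_uniq.
- move=> [h g] /hk[h1 h2].
  have {}h1 : size h = #|clsT| := h1; have {}h2 : sumn h <= q (sz x) := h2.
  rewrite !sz_pair sz_nats h1 /K0.
  have hg : sz g <= 2 * #|G| + 1 by exact: sz_fin.
  by lia.
have : mass (steps x i) < 2 ^ (r (sz x) + ((sz x).+2 ^ pu + (sz x).+2 ^ ps * q (sz x)) * i).
  elim: i hi {hk} => [|i IH] hi.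
    by rewrite muln0 addn0; apply: leq_trans (mass_lt_sz _ _) _; rewrite leq_exp2l //; exact: hr.
  rewrite /steps iterS -/(steps x i) mulnS addnCA expnD mulnC.
  set E := _ + _ * q _.
  apply: leq_ltn_trans (mass_mb_le (c := 2 ^ E) _) _; last first.
    by rewrite ltn_mul2r expn_gt0 IH // ltnW.
  move=> k /steps_keys[k1 k2]; apply: leq_trans (mass_extend (hs x) (hpu x) k1) _.
  rewrite leq_exp2l // leq_add2l leq_mul2l k2; apply/orP; right.
  by apply: leq_trans hnq; apply: ltnW.
move=> h; apply: leq_trans h _; rewrite leq_exp2l // leq_add2l leq_mul2l; apply/orP; right.
exact: leq_trans hi hnq.
Qed.

Lemma PT_result : PT result.
Proof.
have hok : PT ok.
  rewrite /ok; apply: PT_andb; first by apply: PT_finfun; pt.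
  elim: (enum _) => [|s l IH] /=; first by pt.
  apply: PT_andb => //; apply: PT_orb; last by pt.
  apply: (PT_eqc enc_inj_nat); last by pt.
  by apply: PT_nth; pt.
(* Adding up weights is merging a list all of whose keys are equal, so the size bound behind
   [PT_norm] is reused. The leading zero entry makes the list nonempty. *)
apply: (@PT_ext _ _ _ _ (fun x => (nth (tt, wone) (norm ((tt, (BN 0, BN 0)) ::
   flatten [seq (if ok e.1 then [:: (tt, e.2)] else [::]) | e <- final x])) 0).2)).
  move=> x; rewrite /result /norm /=.
  have -> : ins [::] (tt, (BN 0, BN 0)) = [:: (tt, (BN 0, BN 0))] by [].
  elim: (final x) (BN 0, BN 0) => //= e l IH w.
  by rewrite foldl_cat -IH; case: (ok e.1).
apply: PT_sndc; apply: PT_nth; apply: PT_norm; first by move=> [] [].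
apply: PT_cons; first by pt.
apply: (PT_bind (f := fun _ e => if ok e.1 then [:: (tt, e.2)] else [::])); last exact: PT_final.
by pt; apply: (PT_comp hok); pt.
Qed.

Lemma wval_result x : wval (result x) = (lin wval (final x) (fun k => (ok k)%:R))%R.
Proof.
have gen l w : wval (foldl (fun acc (e : hkey * wgt) => if ok e.1 then wadd acc e.2 else acc) w l) =
    (wval w + lin wval l (fun k => (ok k)%:R))%R.
  elim: l w => [|e l IH] w /=; first by rewrite /lin big_nil GRing.addr0.
  rewrite IH /lin big_cons GRing.addrA; congr (_ + _)%R.
  by case: (ok e.1); rewrite ?wval_add ?GRing.mulr1 ?GRing.mulr0 ?GRing.addr0.
by rewrite /result gen {1}/wval GRing.subrr GRing.add0r.
Qed.
End DP.

(** * The value computed by the dynamic program *)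

Section ProgramValue.
Import GRing.Theory.
Local Open Scope ring_scope.

Section Path.
Variables (I : eqType) (St : eqType) (f : I -> St -> seq (St * wgt)).

Fixpoint path_sum (l : seq I) (st : St) (phi : St -> rat) : rat :=
  if l is i :: l' then lin wval (f i st) (fun st' => path_sum l' st' phi) else phi st.

Lemma eq_lin (key : Type) (l : seq (key * wgt)) (phi psi : key -> rat) :
  phi =1 psi -> lin wval l phi = lin wval l psi.
Proof. by move=> e; apply: eq_bigr => k _; rewrite e. Qed.

Lemma eq_path_sum l st (phi psi : St -> rat) : phi =1 psi -> path_sum l st phi = path_sum l st psi.
Proof. by move=> e; elim: l st => [|i l IH] st /=; [exact: e | apply: eq_lin]. Qed.

Lemma lin_foldl_mb D l phi :
  lin wval (foldl (fun D i => mb (f i) D) D l) phi = lin wval D (fun st => path_sum l st phi).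
Proof.
elim: l D => //= i l IH D; rewrite IH.
by rewrite lin_mb; [|exact: wval_add|exact: wval_mul].
Qed.

Hypothesis comm : forall i j st phi,
  lin wval (f i st) (fun st' => lin wval (f j st') phi) = lin wval (f j st) (fun st' => lin wval (f i st') phi).

Lemma path_sum_mid l1 i l2 st phi : path_sum (l1 ++ i :: l2) st phi = path_sum (i :: l1 ++ l2) st phi.
Proof. by elim: l1 st => //= j l1 IH st; rewrite (eq_lin _ (fun st' => IH st')) /= comm. Qed.

(** The program goes through elements class by class, and through big atoms predicate by predicate,
    since it does not know individuals; commuting steps make this order equivalent to any other. *)
Lemma path_sum_perm l l' st phi : perm_eq l l' -> path_sum l st phi = path_sum l' st phi.
Proof.
elim: l l' st => [|i l IH] l' st; first by rewrite perm_sym => /perm_nilP ->.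
move=> h; have hi : i \in l' by rewrite -(perm_mem h) mem_head.
case/splitPr: hi h => l1 l2; rewrite perm_sym perm_catC /= perm_cons perm_catC perm_sym => h.
by rewrite path_sum_mid /=; apply: eq_lin => st'; apply: IH.
Qed.
End Path.

Section DPcorrect.
Context {X : Type}.
Variables (C T A G B : finType) (ts : seq T).
Variables (u : C -> X -> wgt) (v : T -> X -> wgt) (bstep : B -> G -> X -> seq (G * wgt)).
Variables (a0 : C -> A) (gC : C -> G -> G) (gT : T -> G -> G) (up1 up2 : C -> C -> T -> A -> A).
Variables (g0 : G) (bigcount : B -> X -> nat) (nn : X -> nat).
Variables (okg : G -> bool) (okc : C * A -> bool).
Hypothesis up2C : forall c1 c2 c t1 t2 a, up2 c1 c t1 (up2 c2 c t2 a) = up2 c2 c t2 (up2 c1 c t1 a).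
Hypothesis gTC : forall t1 t2 g, gT t1 (gT t2 g) = gT t2 (gT t1 g).
Variable x : X.

Let S : finType := (C * A)%type.

(** The recursion of the program with individual elements restored: lists of classes in a fixed
    order replace histograms. A sum over worlds, carried out element by element, takes this form. *)
Fixpoint row_sum (c : C) (sg acc : seq S) (a : A) (g : G) (k : seq S -> A -> G -> rat) : rat :=
  if sg is s :: sg' then
    \sum_(t <- ts) wval (v t x) *
      row_sum c sg' (rcons acc (s.1, up1 s.1 c t s.2)) (up2 s.1 c t a) (gT t g) k
  else k acc a g.

Fixpoint all_sum (m : nat) (sg : seq S) (g : G) (phi : seq S -> G -> rat) : rat :=
  if m is m'.+1 then
    \sum_(c : C) wval (u c x) * row_sum c sg [::] (a0 c) (gC c g)
      (fun sg' a g' => all_sum m' (rcons sg' (c, a)) g' phi)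
  else phi sg g.

Definition hist (sg : seq S) : seq nat := foldl (fun h s => incr_nth h (idx s)) (nseq #|S| 0%N) sg.

Lemma hist_rcons sg s : hist (rcons sg s) = incr_nth (hist sg) (idx s).
Proof. by rewrite /hist foldl_rcons. Qed.

Lemma nth_hist sg s : nth 0%N (hist sg) (idx s) = count_mem s sg.
Proof.
elim/last_ind: sg => [|sg t IH]; first by rewrite /hist /= nth_nseq if_same.
rewrite hist_rcons nth_incr_nth IH -cats1 count_cat /= addn0 addnC; congr (_ + _)%N.
by rewrite /idx (inj_eq val_inj) (inj_eq enum_rank_inj).
Qed.

Lemma perm_expand_hist sg : perm_eq (@expand S (hist sg)) sg.
Proof. by apply/allP => s _ /=; rewrite count_expand nth_hist. Qed.

Let succ c := @inner_succ X C T A G ts v gT up1 up2 c x.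

Lemma lin_map (I : Type) (key : Type) (F : I -> key) (w : I -> wgt) (l : seq I) (phi : key -> rat) :
  lin wval [seq (F i, w i) | i <- l] phi = \sum_(i <- l) wval (w i) * phi (F i).
Proof. by rewrite /lin big_map. Qed.

(** Two partners touch in common only the histogram, the accumulator of the new element and the
    global state, and the updates of all three commute. *)
Lemma succ_comm c i j st (phi : seq nat * (A * G) -> rat) :
  lin wval (succ c i st) (fun st' => lin wval (succ c j st') phi) =
  lin wval (succ c j st) (fun st' => lin wval (succ c i st') phi).
Proof.
rewrite /succ /inner_succ !lin_map.
under eq_bigr => t _ do rewrite lin_map /= mulr_sumr.
under [RHS]eq_bigr => t _ do rewrite lin_map /= mulr_sumr.
rewrite exchange_big; apply: eq_bigr => t _; apply: eq_bigr => t' _.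
by rewrite mulrCA up2C gTC incr_nthC.
Qed.

Lemma row_path c sg acc a g phi :
  path_sum (succ c) sg (hist acc, (a, g)) phi =
  row_sum c sg acc a g (fun sg' a' g' => phi (hist sg', (a', g'))).
Proof.
elim: sg acc a g => //= s sg IH acc a g.
rewrite /succ /inner_succ lin_map; apply: eq_bigr => t _ /=.
by rewrite -hist_rcons IH.
Qed.

Lemma eq_row_sum c sg acc a g (k k' : seq S -> A -> G -> rat) :
  (forall s a g, k s a g = k' s a g) -> row_sum c sg acc a g k = row_sum c sg acc a g k'.
Proof.
move=> e; elim: sg acc a g => [|s sg IH] acc a g /=; first exact: e.
by apply: eq_bigr => t _; rewrite IH.
Qed.

Let ext := @extend X C T A G ts u v a0 gC gT up1 up2 x.

Lemma lin_extend sg g (phi : seq nat * G -> rat) :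
  lin wval (ext (hist sg, g)) phi =
  \sum_(c : C) wval (u c x) * row_sum c sg [::] (a0 c) (gC c g)
      (fun sg' a g' => phi (hist (rcons sg' (c, a)), g')).
Proof.
rewrite /ext /extend /lin big_flatten big_map big_enum /=; apply: eq_bigr => c _.
rewrite big_map.
transitivity (lin wval (row ts u v a0 gC gT up1 up2 c x (hist sg, g))
  (fun k => phi (incr_nth k.1 (idx ((c, k.2.1) : S)), k.2.2))).
  by rewrite /lin; apply: eq_bigr.
rewrite /row /inner lin_foldl_mb /= /row0 /lin big_seq1 /=; congr (_ * _).
rewrite (path_sum_perm (@succ_comm c) _ _ (perm_expand_hist sg)).
rewrite (row_path c sg [::]); apply: eq_row_sum => sg' a g' /=.
by rewrite hist_rcons.
Qed.

Lemma all_sum_steps m sg g phi :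
  path_sum (fun _ : unit => ext) (nseq m tt) (hist sg, g) phi =
  all_sum m sg g (fun sg' g' => phi (hist sg', g')).
Proof.
elim: m sg g => //= m IH sg g; rewrite lin_extend; apply: eq_bigr => c _; congr (_ * _).
by apply: eq_row_sum => sg' a g'; rewrite IH.
Qed.

Lemma eq_all_sum m sg g (phi psi : seq S -> G -> rat) : (forall s g, phi s g = psi s g) ->
  all_sum m sg g phi = all_sum m sg g psi.
Proof.
move=> e; elim: m sg g => [|m IH] sg g /=; first exact: e.
by apply: eq_bigr => c _; congr (_ * _); apply: eq_row_sum => sg' a g'.
Qed.

Lemma wval_result_sum :
  wval (result ts u v bstep a0 gC gT up1 up2 g0 bigcount nn okg okc x) =
  path_sum (fun b g => bstep b g x) (bigs bigcount x) g0
    (fun g => all_sum (nn x) [::] g (fun sg g' => (okg g' && all okc sg)%:R)).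
Proof.
rewrite wval_result /final.
have -> P : iter (nn x) (fun P => mb ext P) P = foldl (fun D _ => mb ext D) P (nseq (nn x) tt).
  by elim: (nn x) P => //= m IH P; rewrite -IH -iterSr.
rewrite (lin_foldl_mb (fun _ : unit => ext)) /start lin_map -/(lin _ _ _).
rewrite [LHS](_ : _ = lin wval (big_fold bstep g0 bigcount x)
   (fun g => path_sum (fun _ : unit => ext) (nseq (nn x) tt) (hist [::], g)
     (fun k => (ok okg okc k)%:R))) //.
rewrite /big_fold lin_foldl_mb /lin big_seq1 /= wval_one mul1r.
apply: eq_path_sum => g; rewrite all_sum_steps; apply: eq_all_sum => sg g'.
congr (_ %:R); congr nat_of_bool; rewrite /ok /=; congr (_ && _).
apply/allP/allP => h s hs.
  have := h s (mem_enum _ _); rewrite nth_hist => /orP[|//].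
  by move=> /eqP/count_memPn; rewrite hs.
by rewrite nth_hist; case: eqP => //= /eqP; rewrite -lt0n -has_count has_pred1 => /h.
Qed.

End DPcorrect.
End ProgramValue.

(** * Sums over worlds *)

Section SubsetSums.
Import GRing.Theory.
Local Open Scope ring_scope.

Section SubsetSum.
Variables (Y : finType) (w : Y -> bool -> rat).
Implicit Types (B : {set Y}) (Phi Psi : {set Y} -> rat).

(* The weighted sum of Phi over the truth assignments to the atoms in B. *)
Definition SB B Phi := \sum_(X : {set Y} | X \subset B) (\prod_(y in B) w y (y \in X)) * Phi X.

Lemma eq_SB B Phi Psi : (forall X : {set Y}, X \subset B -> Phi X = Psi X) -> SB B Phi = SB B Psi.
Proof. by move=> e; apply: eq_bigr => X hX; rewrite e. Qed.

Lemma SB0 Phi : SB set0 Phi = Phi set0.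
Proof.
rewrite /SB (big_pred1 set0); first by rewrite big_set0 mul1r.
by move=> X; rewrite subset0.
Qed.

(** Atoms may be decided in stages: a subset of a disjoint union is the pair of its traces, and the
    weights multiply. *)
Lemma SB_U B1 B2 Phi : [disjoint B1 & B2] ->
  SB (B1 :|: B2) Phi = SB B1 (fun X1 => SB B2 (fun X2 => Phi (X1 :|: X2))).
Proof.
move=> dis; rewrite /SB; under [RHS]eq_bigr do rewrite mulr_sumr.
rewrite pair_big_dep /=.
have d12 y : y \in B1 -> y \notin B2 by move=> h; rewrite (disjointFr dis h).
have I0 (S1 S2 : {set Y}) : S1 \subset B1 -> S2 \subset B2 -> (S1 :|: S2) :&: B1 = S1 /\ (S1 :|: S2) :&: B2 = S2.
  move=> h1 h2; split; apply/setP => y; rewrite !inE.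
    case: (boolP (y \in S1)) => [/(subsetP h1) -> //|_] /=.
    by case: (boolP (y \in S2)) => //= /(subsetP h2) h3; apply/negbTE; apply: contraL h3; apply: d12.
  case: (boolP (y \in S2)) => [/(subsetP h2) ->|_]; rewrite ?orbT ?orbF //.
  by case: (boolP (y \in S1)) => //= /(subsetP h1)/d12/negbTE.
rewrite (reindex_onto (fun p : {set Y} * {set Y} => p.1 :|: p.2) (fun X => (X :&: B1, X :&: B2))) /=; last first.
  by move=> X /setIidPl; rewrite setIUr.
apply: eq_big => [[S1 S2]|[S1 S2]] /=.
  apply/andP/andP => [[h /eqP[<- <-]]|[h1 h2]]; first by rewrite !subsetIr.
  by have [-> ->] := I0 _ _ h1 h2; rewrite eqxx subUset (subset_trans h1) ?subsetUl ?(subset_trans h2) ?subsetUr.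
case/andP => h /eqP[e1 e2].
have h1 : S1 \subset B1 by rewrite -e1 subsetIr.
have h2 : S2 \subset B2 by rewrite -e2 subsetIr.
rewrite (eq_bigl [predU B1 & B2]); last by move=> y; rewrite !inE.
rewrite bigU //= -mulrA; congr (_ * (_ * _)); apply: eq_bigr => y hy; congr w; rewrite inE.
  by case: (boolP (y \in S2)); rewrite ?orbF // => /(subsetP h2) h3; have := d12 _ hy; rewrite h3.
by case: (boolP (y \in S1)) => //= /(subsetP h1)/d12; rewrite hy.
Qed.

Lemma SB_imset (U : finType) (f : U -> Y) (D : {set U}) Phi : {in D &, injective f} ->
  SB (f @: D) Phi = \sum_(S : {set U} | S \subset D) (\prod_(z in D) w (f z) (z \in S)) * Phi (f @: S).
Proof.
move=> inj; rewrite /SB (reindex_onto (fun S : {set U} => f @: S) (fun X => (f @^-1: X) :&: D)) /=; last first.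
  move=> X hX; apply/setP => y; apply/imsetP/idP => [[z]|hy].
    by rewrite !inE => /andP[h _] ->.
  by have /imsetP[z hz e] := subsetP hX _ hy; exists z; rewrite // !inE -e hy hz.
have key (S : {set U}) : (f @^-1: (f @: S) :&: D == S) = (S \subset D) && (f @: S \subset f @: D).
  apply/eqP/andP => [<-|[h _]]; first by rewrite subsetIr imsetS ?subsetIr.
  apply/setP => z; rewrite !inE; apply/andP/idP => [[/imsetP[z' hz' e] hz]|hz].
    by rewrite (inj _ _ hz (subsetP h _ hz') e).
  by rewrite (subsetP h) ?imset_f.
apply: eq_big => [S|S].
  rewrite key; case: (boolP (S \subset D)) => h /=; last by rewrite andbF.
  by rewrite imsetS.
case/andP => _; rewrite key => /andP[h _]; rewrite big_imset //; congr (_ * _).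
apply: eq_bigr => z hz; congr w; apply/imsetP/idP => [[z' hz' e]|hz']; last by exists z.
by rewrite (inj _ _ hz (subsetP h _ hz') e).
Qed.

Lemma SB_1 y Phi : SB [set y] Phi = w y true * Phi [set y] + w y false * Phi set0.
Proof.
rewrite /SB (bigD1 [set y]) //= big_set1 set11; congr (_ + _).
rewrite (big_pred1 set0); first by rewrite big_set1 inE.
by move=> X; rewrite subset1 /= andb_orl andbN /= andb_idr // => /eqP ->; rewrite eq_sym -cards_eq0 cards1.
Qed.

End SubsetSum.
End SubsetSums.

(** * Guessed truth values of quantified subformulas *)

Section Formula.
Variables (r : nat) (ar : 'I_r -> nat).

Lemma eval_free n (w : world ar n) (e e' : env n) (f : fo2 ar) :
  (forall v, Defs.free f v -> e v = e' v) -> eval w e f = eval w e' f.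
Proof.
elim: f e e' => [R args|u v|g IH|g IHg h IHh|g IHg h IHh|v g IH|v g IH] e e' he /=.
- apply: eq_existsb => t; congr (_ && _); apply: eq_forallb => i.
  by rewrite he //= mem_tnth.
- by rewrite !he //= ?eqxx ?orbT.
- by congr (~~ _); apply: IH.
- by congr (_ && _); [apply: IHg | apply: IHh] => v hv; apply: he; rewrite /= hv ?orbT.
- by congr (_ || _); [apply: IHg | apply: IHh] => v hv; apply: he; rewrite /= hv ?orbT.
- by apply: eq_existsb => a; apply: IH => u hu; rewrite /upd; case: eqP => // /eqP ne; apply: he; rewrite /= ne.
- by apply: eq_forallb => a; apply: IH => u hu; rewrite /upd; case: eqP => // /eqP ne; apply: he; rewrite /= ne.
Qed.

Lemma eval_ext n (w : world ar n) (e e' : env n) (f : fo2 ar) : e =1 e' -> eval w e f = eval w e' f.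
Proof. by move=> h; apply: eval_free => v _; apply: h. Qed.

Lemma upd_envxy n (a b c : 'I_n) v : upd (envxy a b) v c =1 if v then envxy a c else envxy c b.
Proof. by case: v => -[]. Qed.

(* [nq f] guess bits, numbered from [off] in prefix order, stand for the quantified subformulas of f;
   the bit of a subformula quantifying over v is attached to the value of the other variable. *)
Fixpoint nq (f : fo2 ar) : nat :=
  match f with
  | FAtom _ _ | FEq _ _ => 0
  | FNeg g => nq g
  | FAnd g h | FOr g h => nq g + nq h
  | FEx _ g | FAll _ g => (nq g).+1
  end.

(* (g, o, v, s) counts the values of v at which g, with guess bits from o on, has truth value s; a universal
   subformula is thus watched for counterexamples. *)
Definition watcher := (fo2 ar * nat * var * bool)%type.

Fixpoint occ (off : nat) (f : fo2 ar) : seq watcher :=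
  match f with
  | FAtom _ _ | FEq _ _ => [::]
  | FNeg g => occ off g
  | FAnd g h | FOr g h => occ off g ++ occ (off + nq g) h
  | FEx v g => (g, off.+1, v, true) :: occ off.+1 g
  | FAll v g => (g, off.+1, v, false) :: occ off.+1 g
  end.

Lemma size_occ off f : size (occ off f) = nq f.
Proof.
by elim: f off => //= [g IHg h IHh|g IHg h IHh|v g IH|v g IH] off; rewrite ?size_cat ?IHg ?IHh ?IH.
Qed.

(** Quantification over all watchers in a form that follows the recursion on formulas; [all_occP]
    translates it into indices. *)
Fixpoint all_occ (P : nat -> watcher -> Prop) off f : Prop :=
  match f with
  | FAtom _ _ | FEq _ _ => True
  | FNeg g => all_occ P off g
  | FAnd g h | FOr g h => all_occ P off g /\ all_occ P (off + nq g) h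
  | FEx v g => P off (g, off.+1, v, true) /\ all_occ P off.+1 g
  | FAll v g => P off (g, off.+1, v, false) /\ all_occ P off.+1 g
  end.

Lemma all_occP P d off f : all_occ P off f <-> forall i, i < nq f -> P (off + i) (nth d (occ off f) i).
Proof.
have hcat o g h (IHg : forall o, all_occ P o g <-> forall i, i < nq g -> P (o + i) (nth d (occ o g) i))
  (IHh : forall o, all_occ P o h <-> forall i, i < nq h -> P (o + i) (nth d (occ o h) i)) :
  (all_occ P o g /\ all_occ P (o + nq g) h) <->
  forall i, i < nq g + nq h -> P (o + i) (nth d (occ o g ++ occ (o + nq g) h) i).
  rewrite IHg IHh; split=> [[h1 h2] i hi|hh].
    rewrite nth_cat size_occ; case: ltnP => hi2; first exact: h1.
    have := h2 (i - nq g); rewrite -addnA subnKC //; apply; lia.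
  split=> i hi; first by have := hh i; rewrite nth_cat size_occ hi; apply; lia.
  have := hh (nq g + i); rewrite nth_cat size_occ (_ : (nq g + i < nq g) = false) ?addKn ?addnA; [apply; lia | lia].
have hq o g v s (IH : forall o, all_occ P o g <-> forall i, i < nq g -> P (o + i) (nth d (occ o g) i)) :
  (P o (g, o.+1, v, s) /\ all_occ P o.+1 g) <->
  forall i, i < (nq g).+1 -> P (o + i) (nth d ((g, o.+1, v, s) :: occ o.+1 g) i).
  rewrite IH; split=> [[h1 h2] [|i] hi|hh] /=; first by rewrite addn0.
    by rewrite -addSnnS; apply: h2.
  split; first by have := hh 0; rewrite addn0; apply.
  by move=> i hi; have := hh i.+1; rewrite -addSnnS; apply.
elim: f off => [R args|u v|g IH|g IHg h IHh|g IHg h IHh|v g IH|v g IH] off //=; auto.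
Qed.

Definition vatom : finType := {R : 'I_r & (ar R).-tuple var}.

(** Propositional evaluation at a pair, [ga] and [gb] being the guess bits at the values of x and of
    y, and [same] telling whether these are equal. A subformula that quantifies over y reads the bit
    at x, and conversely; for a universal one the bit asserts a counterexample, whence the
    negation. *)
Fixpoint qe (L : vatom -> bool) (same : bool) (ga gb : nat -> bool) (off : nat) (f : fo2 ar) : bool :=
  match f with
  | FAtom R args => L (Tagged (fun R => (ar R).-tuple var) args)
  | FEq u v => (u == v) || same
  | FNeg g => ~~ qe L same ga gb off g
  | FAnd g h => qe L same ga gb off g && qe L same ga gb (off + nq g) h
  | FOr g h => qe L same ga gb off g || qe L same ga gb (off + nq g) h
  | FEx v g => if v then ga off else gb off
  | FAll v g => ~~ (if v then ga off else gb off)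
  end.

Lemma eq_qe L L' same ga ga' gb gb' off f : L =1 L' -> ga =1 ga' -> gb =1 gb' ->
  qe L same ga gb off f = qe L' same ga' gb' off f.
Proof.
move=> hL ha hb; elim: f off => //= [g IH|g IHg h IHh|g IHg h IHh|v g IH|v g IH] off.
- by rewrite IH.
- by rewrite IHg IHh.
- by rewrite IHg IHh.
- by rewrite ha hb.
- by rewrite ha hb.
Qed.

Section World.
Variables (n : nat) (w : world ar n) (gam : 'I_n -> nat -> bool).

Definition inst (a b : 'I_n) (u : vatom) : gatom ar n :=
  Tagged (fun R => (ar R).-tuple 'I_n) (map_tuple (fun v : var => if v then b else a) (tagged u)).

Lemma eval_atom a b R args : eval w (envxy a b) (FAtom args) =
  (inst a b (Tagged (fun R => (ar R).-tuple var) (args : (ar R).-tuple var)) \in w).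
Proof.
apply/existsP/idP => [[t /andP[ht /forallP h]]|ht].
  have -> // : inst a b (Tagged (fun R => (ar R).-tuple var) (args : (ar R).-tuple var)) =
    Tagged (fun R => (ar R).-tuple 'I_n) t.
  rewrite /inst /=; congr (Tagged _ _); apply: eq_from_tnth => i; rewrite tnth_map.
  by have /eqP[] := h i.
exists (map_tuple (fun v : var => if v then b else a) args); rewrite ht /=.
by apply/forallP => i; rewrite tnth_map.
Qed.

(** The message of [b] to [a]: whether [b], as value of the watched variable, is a witness for [a].
    In [emsg] it is defined by the semantics, in [qmsg] from the guesses. *)
Definition emsg (x : watcher) (a b : 'I_n) : bool :=
  let: (g, _, v, s) := x in
  (if v then eval w (envxy a b) g else eval w (envxy b a) g) == s.

Definition loc (a b : 'I_n) (u : vatom) : bool := inst a b u \in w.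

Definition qmsg (x : watcher) (a b : 'I_n) : bool :=
  let: (g, o, v, s) := x in
  (if v then qe (loc a b) (a == b) (gam a) (gam b) o g
   else qe (loc b a) (b == a) (gam b) (gam a) o g) == s.

Definition truth := all_occ (fun o x => forall a, gam a o = [exists b, emsg x a b]).
Definition consis := all_occ (fun o x => forall a, gam a o = [exists b, qmsg x a b]).

Lemma qe_eval a b off f : truth off f ->
  qe (loc a b) (a == b) (gam a) (gam b) off f = eval w (envxy a b) f.
Proof.
elim: f off => [R args|u v|g IH|g IHg h IHh|g IHg h IHh|v g IH|v g IH] off.
- by move=> _; rewrite eval_atom.
- move=> _ /=; case: u; case: v; rewrite /envxy //= ?eqxx ?orbT //.
  by rewrite [RHS](_ : _ = (b == a)) // eq_sym.
- by move=> h /=; rewrite IH.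
- by case=> h1 h2 /=; rewrite IHg ?IHh.
- by case=> h1 h2 /=; rewrite IHg ?IHh.
- case=> h1 _ /=; case: v h1 => h1; rewrite h1; apply: eq_existsb => c /=; rewrite eqb_id;
  by apply: eval_ext => u; rewrite upd_envxy.
case=> h1 _ /=; case: v h1 => h1; rewrite h1 negb_exists; apply: eq_forallb => c /=; rewrite eqbF_neg negbK;
by apply: eval_ext => u; rewrite upd_envxy.
Qed.

Lemma qmsg_emsg g o v s a b : truth o g -> qmsg (g, o, v, s) a b = emsg (g, o, v, s) a b.
Proof. by move=> h /=; rewrite !qe_eval. Qed.

(** From the inside out: once the bits of the inner subformulas are correct, the messages computed
    from guesses are the true ones, so consistency of the outer bit means its correctness. *)
Lemma truth_consis off f : truth off f <-> consis off f.
Proof.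
elim: f off => [R args|u v|g IH|g IHg h IHh|g IHg h IHh|v g IH|v g IH] off //.
- exact: IH.
- by rewrite /truth /consis /=; move: (IHg off) (IHh (off + nq g)); rewrite /truth /consis; tauto.
- by rewrite /truth /consis /=; move: (IHg off) (IHh (off + nq g)); rewrite /truth /consis; tauto.
- split=> -[h1 h2]; (split; last exact/IH) => a; rewrite h1; apply: eq_existsb => b;
    rewrite qmsg_emsg //; exact/IH.
split=> -[h1 h2]; (split; last exact/IH) => a; rewrite h1; apply: eq_existsb => b;
  rewrite qmsg_emsg //; exact/IH.
Qed.

End World.
End Formula.

(** * The weighted count as a dynamic program *)

Section Counting.
Import GRing.Theory.

Section Setup.
Variables (r : nat) (ar : 'I_r -> nat) (Gamma : fo2 ar)
  (cards : seq ('I_r * cmp * nat)) (cnts ecnts : seq (nat * fo2 ar)).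

(** Prefixed with a universal quantifier over y, the formula gets a guess bit telling whether it
    holds at x; the constraint then only counts elements by their cells. *)
Definition efl : seq (fo2 ar) := [seq FAll vy p.2 | p <- ecnts].
Definition fl : seq (fo2 ar) := Gamma :: efl ++ map snd cnts.

Fixpoint place (off : nat) (l : seq (fo2 ar)) : seq (fo2 ar * nat) :=
  if l is f :: l' then (f, off) :: place (off + nq f) l' else [::].

Definition dw : watcher ar := (FEq ar vx vx, 0, vx, true).
Definition df : fo2 ar * nat := (FEq ar vx vx, 0).
Definition placed := place 0 fl.
Definition allw : seq (watcher ar) := flatten [seq occ p.2 p.1 | p <- placed].
Definition q : nat := size allw.
Definition ne := size ecnts.
Definition nc := size cnts.
(** The counted formulas are watched like formulas quantified over y, but without a guess bit: their
    counters, from index [q] on, are compared with a number instead of a bit. Skipped are [Gamma]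
    and the entries of [efl]. *)
Definition cntw : seq (watcher ar) := [seq (p.1, p.2, vy, true) | p <- drop ne.+1 placed].
Definition wl : seq (watcher ar) := allw ++ cntw.
Definition m : nat := (q + nc)%N.
(* Counters saturate at a value above all the constants of the constraints. *)
Definition CAP : nat :=
  (sumn (map snd cards) + sumn (map fst cnts) + sumn (map fst ecnts)).+1.

Definition cap (k : nat) : 'I_CAP.+1 := inord (minn CAP k).

Lemma val_cap k : cap k = minn CAP k :> nat.
Proof. by rewrite inordK // ltnS geq_minl. Qed.

(** Saturation after every addition gives the same as saturation at the end; hence capped counters
    depend on totals only, and their updates commute. *)
Lemma cap_add a k : cap (cap a + k) = cap (a + k).
Proof. by apply: val_inj; rewrite /= !val_cap; lia. Qed.

(** The atom of a nullary predicate mentions no element. The set [z] of the true ones is fixed in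
    advance, with one run of the dynamic program for each choice. *)
Definition U0 : finType := {R : 'I_r | ar R == 0}.
Definition zin (z : {set U0}) (R : 'I_r) : bool := if insub R is Some R0 then R0 \in z else false.
Definition has_x (u : vatom ar) : bool := vx \in tval (tagged u).
Definition has_y (u : vatom ar) : bool := vy \in tval (tagged u).
Definition NC : {set vatom ar} := [set u | has_x u && has_y u].
Definition Pos : {set 'I_r} := [set R | 0 < ar R].
Definition vswap (u : vatom ar) : vatom ar :=
  Tagged (fun R => (ar R).-tuple var) (map_tuple negb (tagged u)).

Definition bitf (be : {set 'I_q}) (o : nat) : bool := if insub o is Some o' then o' \in be else false.

(** The atoms over a single element [a] apply a predicate to [a] in all places, so a set of
    predicates describes them; the second component holds the guess bits. *)
Definition colT : finType := ({set 'I_r} * {set 'I_q})%type.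
Definition accT : finType := {ffun 'I_m -> 'I_CAP.+1}.
Definition gloT : finType := ({ffun 'I_r -> 'I_CAP.+1} * {ffun 'I_ne -> 'I_CAP.+1})%type.

Definition qm (x : watcher ar) (L : vatom ar -> bool) same (ga gb : nat -> bool) : bool :=
  let: (g, o, v, s) := x in
  (if v then qe L same ga gb o g else qe (fun u => L (vswap u)) same gb ga o g) == s.

Definition eoff (j : nat) : nat := (nth df placed j.+1).2.

Section Fixed_z.
Variable z : {set U0}.

Definition locC (th1 th2 : {set 'I_r}) (t : {set vatom ar}) (u : vatom ar) : bool :=
  if has_x u then (if has_y u then u \in t else tag u \in th1)
  else if has_y u then tag u \in th2 else zin z (tag u).
Definition locS (th : {set 'I_r}) (u : vatom ar) : bool :=
  if has_x u || has_y u then tag u \in th else zin z (tag u).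

(** Messages of an element to itself, of the new element to an old one, and of an old element to the
    new one. In the last two [c1] is the old cell, and the table [t] is read with the old element as
    x. *)
Definition mself (i : nat) (c : colT) : bool := qm (nth dw wl i) (locS c.1) true (bitf c.2) (bitf c.2).
Definition mold (i : nat) (c1 c2 : colT) t : bool :=
  qm (nth dw wl i) (locC c1.1 c2.1 t) false (bitf c1.2) (bitf c2.2).
Definition mnew (i : nat) (c1 c2 : colT) t : bool :=
  qm (nth dw wl i) (fun u => locC c1.1 c2.1 t (vswap u)) false (bitf c2.2) (bitf c1.2).
Definition ebit (j : nat) (c : colT) : bool :=
  qe (locS c.1) true (bitf c.2) (bitf c.2) (eoff j) (nth df.1 efl j).

Definition a0 (c : colT) : accT := [ffun i : 'I_m => cap (mself i c)].
Definition up1 (c1 c2 : colT) t (al : accT) : accT := [ffun i : 'I_m => cap (al i + mold i c1 c2 t)].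
Definition up2 (c1 c2 : colT) t (al : accT) : accT := [ffun i : 'I_m => cap (al i + mnew i c1 c2 t)].
Definition gT (t : {set vatom ar}) (g : gloT) : gloT :=
  ([ffun R => cap (g.1 R + #|[set u in t | tag u == R]|)], g.2).
Definition gC (c : colT) (g : gloT) : gloT :=
  ([ffun R => cap (g.1 R + (R \in c.1))], [ffun j : 'I_ne => cap (g.2 j + ebit j c)]).
Definition g0 : gloT := ([ffun R => cap (zin z R)], [ffun => cap 0]).
Definition gB (R0 : 'I_r) (g : gloT) : gloT := ([ffun R => cap (g.1 R + (R0 == R))], g.2).
(** [Gamma] is evaluated at each element; for a sentence and correct guesses all these answers
    agree. *)
Definition okc (s : colT * accT) : bool :=
  [&& [forall o : 'I_q, (o \in s.1.2) == (0 < s.2 (lshift nc o))],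
      [forall j : 'I_nc, s.2 (rshift q j) == (nth (0, df.1) cnts j).1 :> nat]
    & qe (locS s.1.1) true (bitf s.1.2) (bitf s.1.2) 0 Gamma].
Definition okg (g : gloT) : bool :=
  all (fun cc => cmp_eval cc.1.2 (g.1 cc.1.1) cc.2) cards &&
  [forall j : 'I_ne, g.2 j == (nth (0, df.1) ecnts j).1 :> nat].

(* The truth value of a sentence in the empty domain, where the histogram says nothing about it. *)
Fixpoint ev0 (f : fo2 ar) : bool :=
  match f with
  | FAtom R _ => zin z R
  | FEq _ _ => false
  | FNeg g => ~~ ev0 g
  | FAnd g h => ev0 g && ev0 h
  | FOr g h => ev0 g || ev0 h
  | FEx _ _ => false
  | FAll _ _ => true
  end.

Lemma up2C c1 c2 c t1 t2 a : up2 c1 c t1 (up2 c2 c t2 a) = up2 c2 c t2 (up2 c1 c t1 a).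
Proof. by apply/ffunP => i; rewrite !ffunE !cap_add -!addnA [(mnew _ c1 _ _ + _)%N]addnC. Qed.

Lemma gTC t1 t2 g : gT t1 (gT t2 g) = gT t2 (gT t1 g).
Proof.
rewrite /gT /=; congr pair; apply/ffunP => R; rewrite !ffunE !cap_add -!addnA.
by rewrite [X in (_ + X)%N]addnC.
Qed.

(** * Deciding the atoms of a world block by block *)

Section Explore.
Variables (n : nat) (W Wb : 'I_r -> rat).
Local Open Scope ring_scope.

(* The variables of the sum: the ground atoms, and a guess bit for every element and quantified subformula. *)
Definition Y : finType := (gatom ar n + 'I_n * 'I_q)%type.
Definition wY (y : Y) (b : bool) : rat :=
  match y with inl g => if b then W (tag g) else Wb (tag g) | inr _ => 1 end.
Definition suppY (y : Y) : {set 'I_n} :=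
  match y with inl g => [set a in tval (tagged g)] | inr p => [set p.1] end.
(** The variables with support [s] are decided together: one-element blocks when an element is
    created, two-element blocks when two elements are paired. *)
Definition blk (s : {set 'I_n}) : {set Y} := [set y | suppY y == s].

Implicit Types (Om X : {set Y}) (a b : 'I_n).

Definition unat (R : 'I_r) (a : 'I_n) : Y := inl (Tagged (fun R => (ar R).-tuple 'I_n) (nseq_tuple (ar R) a)).
(** The definitions ending in O read the data of the program off a set [Om] of true variables, which
    may be a world only partly decided. *)
Definition locO Om a b (u : vatom ar) : bool := (inl (inst a b u) : Y) \in Om.
Definition bitO Om a (o : nat) : bool := if insub o is Some o' then (inr (a, o') : Y) \in Om else false.
Definition colO Om a : colT := ([set R in Pos | unat R a \in Om], [set o | (inr (a, o) : Y) \in Om]).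
Definition msgO Om (i : nat) a b : bool := qm (nth dw wl i) (locO Om a b) (a == b) (bitO Om a) (bitO Om b).
Definition accO Om (P : pred 'I_n) a : accT := [ffun i : 'I_m => cap (\sum_(b | P b) msgO Om i a b)].
Definition stO Om (k : nat) a : colT * accT := (colO Om a, accO Om (fun b => (b < k)%N) a).
Definition ebitO Om (j : nat) a : bool := ebit j (colO Om a).
Definition isR (R : 'I_r) (y : Y) : bool := if y is inl g then tag g == R else false.
Definition gO Om (k : nat) : gloT :=
  ([ffun R => cap #|[set y in Om | isR R y]|],
   [ffun j : 'I_ne => cap #|[set a : 'I_n | (a < k)%N && ebitO Om j a]|]).

Definition nulO Om : Prop := forall y : Y, suppY y = set0 ->
  (y \in Om) = (if y is inl g then zin z (tag g) else false).

Lemma supp_inst a b u : suppY (inl (inst a b u)) = [set c | (has_x u && (c == a)) || (has_y u && (c == b))].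
Proof.
apply/setP => c; rewrite !inE /=; case: u => R args; rewrite /has_x /has_y /inst /=.
apply/mapP/orP => [[[] hv ->]|]; first by right; rewrite hv eqxx.
  by left; rewrite hv eqxx.
by case=> /andP[h /eqP ->]; [exists vx | exists vy].
Qed.

Lemma inst_swap a b u : inst b a u = inst a b (vswap u).
Proof.
case: u => R args; rewrite /inst /vswap /=; congr (Tagged _ _); apply: val_inj => /=.
by rewrite -map_comp; apply: eq_map => -[].
Qed.

Lemma inst_same a b u : (has_y u -> a = b) -> (has_x u || has_y u) -> inst a b u = inst a a u.
Proof.
case: u => R args; rewrite /inst /has_x /has_y /= => h _; congr (Tagged _ _); apply: val_inj => /=.
by apply/eq_in_map => -[] // hv; rewrite -h.
Qed.

Lemma unat_inst R a (u : vatom ar) : tag u = R -> (inl (inst a a u) : Y) = unat R a.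
Proof.
case: u => R' args /= e; subst R'; congr inl; rewrite /inst /=; congr (Tagged _ _); apply: val_inj => /=.
have h (s : seq var) : [seq (if v then a else a) | v <- s] = nseq (size s) a.
  by elim: s => //= v s ->; case: v.
by rewrite h size_tuple.
Qed.

(** Locality: data concerning the elements of [s] depend on the variables supported in [s] only, so
    decisions made elsewhere leave them alone. *)
Definition agr Om Om' (s : {set 'I_n}) : Prop :=
  forall y : Y, suppY y \subset s -> (y \in Om) = (y \in Om').

Lemma agrS Om Om' (s s' : {set 'I_n}) : s' \subset s -> agr Om Om' s -> agr Om Om' s'.
Proof. by move=> h ha y hy; apply: ha; apply: subset_trans h. Qed.

Lemma supp_inst_sub a b u : suppY (inl (inst a b u)) \subset [set a; b].
Proof. by rewrite supp_inst; apply/subsetP => c; rewrite !inE => /orP[/andP[_ ->]|/andP[_ ->]]; rewrite ?orbT. Qed.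

Lemma has_xP u : has_x u || has_y u -> tag u \in Pos.
Proof.
rewrite inE /has_x /has_y; case: u => R args /= h; have : (0 < size args)%N by case: (tval args) h.
by rewrite size_tuple.
Qed.

Lemma supp_unat R a : R \in Pos -> suppY (unat R a) = [set a].
Proof.
rewrite inE => h; apply/setP => c; rewrite !inE /= ; case: (ar R) h => // k _ /=.
by rewrite inE mem_nseq andbC orb_idr // => /andP[].
Qed.

Lemma locO_agr Om Om' a b : agr Om Om' [set a; b] -> locO Om a b =1 locO Om' a b.
Proof. by move=> h u; rewrite /locO h ?supp_inst_sub. Qed.

Lemma bitO_agr Om Om' a : agr Om Om' [set a] -> bitO Om a =1 bitO Om' a.
Proof. by move=> h o; rewrite /bitO; case: insub => // o'; rewrite h. Qed.

Lemma colO_agr Om Om' a : agr Om Om' [set a] -> colO Om a = colO Om' a.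
Proof.
move=> h; congr pair; apply/setP => x; rewrite in_set [RHS]in_set; last by rewrite h.
by case: (boolP (x \in Pos)) => // hx; rewrite h // supp_unat.
Qed.

Lemma qm_ext x L L' same ga ga' gb gb' : L =1 L' -> ga =1 ga' -> gb =1 gb' ->
  qm x L same ga gb = qm x L' same ga' gb'.
Proof.
case: x => [[[g o] v] s] hL ha hb; rewrite /qm; congr (_ == _); by case: v; apply: eq_qe => // u.
Qed.

Lemma msgO_agr Om Om' i a b : agr Om Om' [set a; b] -> msgO Om i a b = msgO Om' i a b.
Proof.
move=> h; apply: qm_ext; first exact: locO_agr.
  by apply: bitO_agr; apply: agrS h; rewrite sub1set !inE eqxx.
by apply: bitO_agr; apply: agrS h; rewrite sub1set !inE eqxx orbT.
Qed.

Lemma accO_agr Om Om' (P P' : pred 'I_n) a : P =1 P' -> (forall b, P b -> agr Om Om' [set a; b]) ->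
  accO Om P a = accO Om' P' a.
Proof.
move=> hP h; apply/ffunP => i; rewrite !ffunE; congr cap.
by apply: eq_big => // b hb; rewrite (msgO_agr _ (h b hb)).
Qed.

Lemma stO_agr Om Om' k a : agr Om Om' [set a] -> (forall b, (b < k)%N -> agr Om Om' [set a; b]) ->
  stO Om k a = stO Om' k a.
Proof. by move=> h1 h2; rewrite /stO (colO_agr h1) (accO_agr (frefl _) h2). Qed.

Definition tabO Om a b : {set vatom ar} := [set u in NC | locO Om a b u].

Lemma locO_C Om a b : nulO Om -> locO Om a b =1 locC (colO Om a).1 (colO Om b).1 (tabO Om a b).
Proof.
move=> hn u; rewrite /locC; case: (boolP (has_x u)) => hx; case: (boolP (has_y u)) => hy /=.
- by rewrite !inE hx hy.
- by rewrite inE has_xP ?hx //= /locO inst_same ?hx ?(negbTE hy) // (@unat_inst (tag u)).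
- have e : inst a b u = inst b b u.
    case: u hx hy => R args; rewrite /inst /has_x /has_y /= => hx _; congr (Tagged _ _).
    by apply: val_inj => /=; apply/eq_in_map => -[] // hv; rewrite hv in hx.
  by rewrite inE has_xP ?hy ?orbT //= /locO e (@unat_inst (tag u)).
rewrite /locO hn // supp_inst; apply/setP => c; rewrite !inE.
by rewrite (negbTE hx) (negbTE hy).
Qed.

Lemma locO_S Om a : nulO Om -> locO Om a a =1 locS (colO Om a).1.
Proof.
move=> hn u; rewrite locO_C // /locC /locS.
case: (boolP (has_x u)) => hx; case: (boolP (has_y u)) => hy //=.
by rewrite in_set in_set hx hy /= in_set has_xP ?hx //= /locO (@unat_inst (tag u)).
Qed.

Lemma bitO_f Om a : bitO Om a =1 bitf (colO Om a).2.
Proof. by move=> o; rewrite /bitO /bitf; case: insub => // o'; rewrite inE. Qed.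

Lemma msgO_self Om i a : nulO Om -> msgO Om i a a = mself i (colO Om a).
Proof. by move=> hn; rewrite /msgO eqxx; apply: qm_ext; [exact: locO_S | exact: bitO_f | exact: bitO_f]. Qed.

Lemma msgO_old Om i a b : nulO Om -> a != b ->
  msgO Om i a b = mold i (colO Om a) (colO Om b) (tabO Om a b).
Proof.
by move=> hn /negbTE h; rewrite /msgO h; apply: qm_ext; [exact: locO_C | exact: bitO_f | exact: bitO_f].
Qed.

Lemma msgO_new Om i a b : nulO Om -> a != b ->
  msgO Om i b a = mnew i (colO Om a) (colO Om b) (tabO Om a b).
Proof.
move=> hn /negbTE h; rewrite /msgO eq_sym h; apply: qm_ext; [|exact: bitO_f | exact: bitO_f].
by move=> u; rewrite -locO_C // /locO inst_swap.
Qed.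

Definition instT a b (t : {set vatom ar}) : {set Y} := (fun u => inl (inst a b u) : Y) @: t.
Definition instC a (c : colT) : {set Y} :=
  [set unat R a | R in c.1] :|: [set (inr (a, o) : Y) | o in c.2].

Lemma inst_inj a b : a != b -> injective (fun u => inl (inst a b u) : Y).
Proof.
move=> hab; pose back (g : gatom ar n) : vatom ar :=
  Tagged (fun R => (ar R).-tuple var) (map_tuple (fun c => c == b) (tagged g)).
apply: inj_comp; first by move=> ? ? [].
apply: (can_inj (g := back)) => -[R u]; rewrite /back /inst /=; congr (Tagged _ _); apply: val_inj => /=.
rewrite -map_comp -[RHS]map_id; apply: eq_map => -[] /=; first by rewrite eqxx.
exact: negbTE.
Qed.

Lemma agrU Om X (s : {set 'I_n}) : (forall y, y \in X -> ~~ (suppY y \subset s)) -> agr Om (Om :|: X) s.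
Proof.
move=> h y hy; rewrite inE; case: (boolP (y \in X)) => hX; last by rewrite orbF.
by have := h y hX; rewrite hy.
Qed.

Lemma instT_blk a b (t : {set vatom ar}) (y : Y) : a != b -> t \subset NC -> y \in instT a b t -> suppY y = [set a; b].
Proof.
move=> hab ht /imsetP[u hu ->]; rewrite supp_inst; apply/setP => c.
by have := subsetP ht _ hu; rewrite !inE => /andP[-> ->].
Qed.

Lemma instC_blk a (c : colT) (y : Y) : c.1 \subset Pos -> y \in instC a c -> suppY y = [set a].
Proof.
move=> hc; rewrite inE => /orP[/imsetP[R hR ->]|/imsetP[o ho ->]] //.
by rewrite supp_unat // (subsetP hc).
Qed.

Lemma in_instT a b (t : {set vatom ar}) u : a != b -> ((inl (inst a b u) : Y) \in instT a b t) = (u \in t).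
Proof.
move=> hab; apply/imsetP/idP => [[u' hu' e]|hu]; last by exists u.
by rewrite (inst_inj hab e).
Qed.

Lemma unat_inj a : injective (fun R => unat R a).
Proof. by move=> R R' [] . Qed.

Lemma in_instC1 a (c : colT) R : (unat R a \in instC a c) = (R \in c.1).
Proof.
rewrite inE; have -> : (unat R a \in [set (inr (a, o) : Y) | o in c.2]) = false.
  by apply/imsetP => -[].
by rewrite orbF; apply/imsetP/idP => [[R' h /unat_inj ->] //|h]; exists R.
Qed.

Lemma in_instC2 a (c : colT) (o : 'I_q) : ((inr (a, o) : Y) \in instC a c) = (o \in c.2).
Proof.
rewrite inE; have -> : ((inr (a, o) : Y) \in [set unat R a | R in c.1]) = false.
  by apply/imsetP => -[].
by rewrite /=; apply/imsetP/idP => [[o' h [->]] //|h]; exists o.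
Qed.

Lemma tabO_instT Om a b (t : {set vatom ar}) : a != b -> t \subset NC -> [disjoint Om & blk [set a; b]] ->
  tabO (Om :|: instT a b t) a b = t.
Proof.
move=> hab ht hd; apply/setP => u; rewrite in_set /locO in_setU in_instT //.
case: (boolP (u \in NC)) => hu /=; last by apply/esym/negbTE; apply: contra hu; apply: (subsetP ht).
rewrite (disjointFl hd) // inE supp_inst; apply/eqP/setP => c.
by move: hu; rewrite !inE => /andP[-> ->].
Qed.

Lemma colO_instC Om a (c : colT) : c.1 \subset Pos -> [disjoint Om & blk [set a]] -> colO (Om :|: instC a c) a = c.
Proof.
case: c => th be hc hd; congr pair; apply/setP => x; rewrite in_set in_setU.
  rewrite in_instC1 /=; case: (boolP (x \in Pos)) => hx /=.
    by rewrite (disjointFl hd) // in_set supp_unat.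
  by apply/esym/negbTE; apply: contra hx; apply: (subsetP hc).
by rewrite in_instC2 (disjointFl hd) // in_set.
Qed.

Definition wT (t : {set vatom ar}) : rat := \prod_(u in NC) (if u \in t then W (tag u) else Wb (tag u)).
(** The type [colT] also admits nullary predicates in the first component; such a value is no cell
    and gets weight 0. *)
Definition wC (c : colT) : rat :=
  if c.1 \subset Pos then \prod_(R in Pos) (if R \in c.1 then W R else Wb R) else 0.

(** A ground atom over exactly [a] and [b] becomes an atom in x and y by replacing [a] with x and
    [b] with y, which is unambiguous as [a != b]. The bits drop out because their support is a
    singleton. *)
Lemma blk2E a b : a != b -> blk [set a; b] = instT a b NC.
Proof.
move=> hab.
apply/setP => y; rewrite inE; apply/eqP/imsetP => [|[u hu ->]]; last first.
  by apply: (@instT_blk a b NC) => //; apply: imset_f.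
case: y => [[R g]|[c o]] hs.
  pose u : vatom ar := Tagged (fun R => (ar R).-tuple var) (map_tuple (fun c => c == b) g).
  have e : inst a b u = Tagged (fun R => (ar R).-tuple 'I_n) g.
    rewrite /inst /u /=; congr (Tagged _ _); apply: val_inj => /=.
    rewrite -map_comp -[RHS]map_id; apply/eq_in_map => c hc /=.
    have : c \in suppY (inl (Tagged (fun R => (ar R).-tuple 'I_n) g)) by rewrite inE.
    by rewrite hs => /set2P[] ->; [rewrite (negbTE hab) | rewrite eqxx].
  exists u; last by rewrite e.
  have hin c : c \in [set a; b] -> c \in tval g by rewrite -hs inE.
  rewrite inE /has_x /has_y /=; apply/andP; split; apply/mapP.
    by exists a; rewrite ?hin ?inE ?eqxx //; apply/esym/negbTE.
  by exists b; rewrite ?hin ?inE ?eqxx ?orbT.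
have /set1P e1 : a \in [set c] by have := set21 a b; rewrite -hs.
have /set1P e2 : b \in [set c] by have := set22 a b; rewrite -hs.
by rewrite e1 e2 eqxx in hab.
Qed.

Lemma SB_blk2 a b (Phi : {set Y} -> rat) : a != b ->
  SB wY (blk [set a; b]) Phi = \sum_(t in powerset NC) wT t * Phi (instT a b t).
Proof.
move=> hab; rewrite blk2E // SB_imset; last by move=> ? ? _ _; apply: inst_inj.
by apply: eq_bigl => t; rewrite powersetE.
Qed.

Lemma blk1E a : blk [set a] = instC a (Pos, setT).
Proof.
apply/setP => y; rewrite !inE; apply/eqP/orP => [|[/imsetP[R hR ->]|/imsetP[o _ ->]]] //; last first.
  exact: supp_unat.
case: y => [[R g]|[c o]] hs; last first.
  right; have := set11 a; rewrite -hs => /set1P ->.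
  by apply: (imset_f (fun o => inr (c, o) : Y)); rewrite inE.
left; have hg : tval g = nseq (ar R) a.
  have <- : nseq (size g) a = nseq (ar R) a by rewrite size_tuple.
  apply/all_pred1P/allP => c hc /=.
  have : c \in suppY (inl (Tagged (fun R => (ar R).-tuple 'I_n) g)) by rewrite inE.
  by rewrite hs => /set1P ->.
have -> : (inl (Tagged (fun R => (ar R).-tuple 'I_n) g) : Y) = unat R a.
  by rewrite /unat; congr (inl (Tagged _ _)); apply: val_inj.
apply: imset_f; rewrite inE lt0n; apply/eqP => h0.
have : a \in suppY (inl (Tagged (fun R => (ar R).-tuple 'I_n) g)) by rewrite hs inE.
by rewrite inE /= hg h0.
Qed.

Lemma SB_blk1 a (Phi : {set Y} -> rat) :
  SB wY (blk [set a]) Phi = \sum_(c : colT) wC c * Phi (instC a c).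
Proof.
rewrite blk1E SB_U; last first.
  by rewrite disjoint_subset; apply/subsetP => y /imsetP[R _ ->]; rewrite !inE; apply/imsetP => -[].
rewrite SB_imset; last by move=> ? ? _ _; apply: unat_inj.
transitivity (\sum_(th : {set 'I_r} | th \subset Pos) \sum_(be : {set 'I_q})
   wC (th, be) * Phi (instC a (th, be))).
  apply: eq_bigr => th hth; rewrite SB_imset; last by move=> ? ? _ _ [].
  rewrite mulr_sumr; apply: eq_big => [be|be _]; first by rewrite subsetT.
  by rewrite [X in _ * (X * _)]big1 // mul1r /wC /= hth.
rewrite pair_big /= big_mkcond; apply: eq_bigr => -[th be] _ /=; rewrite /wC /= andbT.
by case: (th \subset Pos); rewrite ?mul0r.
Qed.

Definition E : seq 'I_n := enum 'I_n.
(* Not yet decided when element i, already paired with all elements before j, is being added. *)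
Definition Rw (i : 'I_n) (j : nat) : {set Y} :=
  [set y | [exists a : 'I_n, [&& (j <= a)%N, (a < i)%N & suppY y == [set a; i]]]].
Definition small (y : Y) : bool := (0 < #|suppY y|)%N && (#|suppY y| <= 2)%N.
(* Not yet decided when the elements before i have been added, big atoms apart. *)
Definition Rs (i : nat) : {set Y} :=
  [set y | small y && [exists a : 'I_n, (i <= a)%N && (a \in suppY y)]].

Lemma ltn_neq (a b : 'I_n) : (a < b)%N -> a != b.
Proof. by move=> h; apply: contraTneq h => ->; rewrite ltnn. Qed.

Lemma set2_lt_inj (a b a' b' : 'I_n) : (a < b)%N -> (a' < b')%N -> [set a; b] = [set a'; b'] -> a = a' /\ b = b'.
Proof.
move=> h1 h2 e.
have /set2P[e1|e1] : a \in [set a'; b'] by rewrite -e set21.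
  have /set2P[e2|e2] : b \in [set a'; b'] by rewrite -e set22.
    by move: h1; rewrite e1 e2 ltnn.
  by [].
have /set2P[e2|e2] : b \in [set a'; b'] by rewrite -e set22.
  by move: h1 h2; rewrite e1 e2 => h1 /(ltn_trans h1); rewrite ltnn.
by move: h1; rewrite e1 e2 ltnn.
Qed.

Lemma Rw_rec (i a : 'I_n) : (a < i)%N -> Rw i a = blk [set a; i] :|: Rw i a.+1.
Proof.
move=> hai; apply/setP => y; rewrite !inE; apply/existsP/orP => [[b /and3P[h1 h2 h3]]|[h|/existsP[b /and3P[h1 h2 h3]]]].
- move: h1; rewrite leq_eqVlt => /orP[/eqP e|h1]; last by right; apply/existsP; exists b; rewrite h1 h2.
  by left; have -> : a = b by apply: val_inj.
- by exists a; rewrite leqnn hai.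
by exists b; rewrite h2 h3 ltnW.
Qed.

Lemma Rw_nil (i : 'I_n) : Rw i i = set0.
Proof.
apply/setP => y; rewrite !inE; apply/existsP => -[a /and3P[h1 h2 _]].
by move: h2; rewrite ltnNge h1.
Qed.

Lemma Rw_disj (i a : 'I_n) : (a < i)%N -> [disjoint blk [set a; i] & Rw i a.+1].
Proof.
move=> h; rewrite disjoint_subset; apply/subsetP => y; rewrite !inE => /eqP ->.
apply/existsP => -[b /and3P[h1 h2 /eqP/(set2_lt_inj h h2)[e _]]].
by move: h1; rewrite e ltnn.
Qed.

(** A small support with an element from [i] on either is the singleton of [i], or joins [i] to an
    earlier element, or contains a later element. *)
Lemma Rs_rec (i : 'I_n) : Rs i = blk [set i] :|: (Rw i 0 :|: Rs i.+1).
Proof.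
apply/setP => y; rewrite !inE /small; apply/andP/idP => [[/andP[h1 h2] /existsP[a /andP[h3 h4]]]|].
  case: (boolP [exists a : 'I_n, (i < a)%N && (a \in suppY y)]) => h5.
    by rewrite h1 h2 orbA orbT.
  have hle c : c \in suppY y -> (c <= i)%N.
    move=> hc; rewrite leqNgt; apply: contra h5 => hic; apply/existsP; exists c; by rewrite hic.
  have ea : a = i by apply: val_inj; apply/eqP; rewrite eqn_leq h3 hle.
  subst a; case: (boolP (suppY y == [set i])) => //= ne.
  have [b hb hbi] : exists2 b, b \in suppY y & b != i.
    have /subsetPn[b hb hbi] : ~~ (suppY y \subset [set i]).
      apply: contra ne => hs; rewrite eqEsubset hs; by apply/subsetP => c /set1P ->.
    by exists b => //; rewrite inE in hbi.
  apply/orP; left; apply/existsP; exists b.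
  have hlt : (b < i)%N by rewrite ltn_neqAle hle // andbT (inj_eq val_inj).
  rewrite hlt /= eq_sym eqEcard cards2 hbi h2 andbT.
  by apply/subsetP => c /set2P[] ->.
case/or3P => [/eqP ->|/existsP[a /and3P[_ h1 /eqP ->]]|/andP[h1 /existsP[a /andP[h2 h3]]]].
- by rewrite cards1; split=> //; apply/existsP; exists i; rewrite leqnn set11.
- rewrite cards2 ltn_neq //; split=> //; apply/existsP; exists i; by rewrite leqnn set22.
by rewrite h1; split=> //; apply/existsP; exists a; rewrite h3 ltnW.
Qed.

Lemma Rs_nil : Rs n = set0.
Proof.
apply/setP => y; rewrite !inE; apply/negbTE/negP => /andP[_ /existsP[a /andP[h _]]].
by move: (ltn_ord a); rewrite ltnNge h.
Qed.

Lemma Rs_disj1 (i : 'I_n) : [disjoint blk [set i] & Rw i 0 :|: Rs i.+1].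
Proof.
rewrite disjoint_subset; apply/subsetP => y; rewrite !inE => /eqP ->; rewrite negb_or.
apply/andP; split.
  apply/existsP => -[a /and3P[_ h /eqP e]].
  have /set1P ea : a \in [set i] by rewrite e set21.
  by move: h; rewrite ea ltnn.
rewrite negb_and; apply/orP; right; apply/existsP => -[a /andP[h /set1P ea]].
by move: h; rewrite ea ltnn.
Qed.

Lemma Rs_disj2 (i : 'I_n) : [disjoint Rw i 0 & Rs i.+1].
Proof.
rewrite disjoint_subset; apply/subsetP => y; rewrite !inE => /existsP[a /and3P[_ h /eqP ->]].
rewrite negb_and; apply/orP; right; apply/existsP => -[b /andP[h1 /set2P[] eb]].
  by move: (ltn_trans h h1); rewrite eb ltnn.
by move: h1; rewrite eb ltnn.
Qed.

Lemma nulO_U Om X : (forall y, y \in X -> suppY y != set0) -> nulO Om -> nulO (Om :|: X).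
Proof.
move=> h hn y hy; rewrite inE hn //; case: (boolP (y \in X)) => [/h|]; first by rewrite hy eqxx.
by rewrite orbF.
Qed.

Lemma set2_neq0 (a b : 'I_n) : [set a; b] != set0.
Proof. by apply/set0Pn; exists a; rewrite set21. Qed.

Lemma card_isR Om X R : [disjoint Om & X] ->
  #|[set y in Om :|: X | isR R y]| = (#|[set y in Om | isR R y]| + #|[set y in X | isR R y]|)%N.
Proof.
move=> hd; rewrite -cardsUI [X in (_ + X)%N](_ : _ = 0%N) ?addn0.
  by congr #|pred_of_set _|; apply/setP => y; rewrite !inE; case: (isR R y); rewrite ?andbT ?andbF.
apply/eqP; rewrite cards_eq0; apply/eqP/setP => y; rewrite !inE.
by case: (boolP (y \in Om)) => //= hy; rewrite (disjointFr hd hy) andbF.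
Qed.

Lemma card_instT a b (t : {set vatom ar}) R : a != b ->
  #|[set y in instT a b t | isR R y]| = #|[set u in t | tag u == R]|.
Proof.
move=> hab; rewrite -(card_imset _ (inst_inj hab)); congr #|pred_of_set _|; apply/setP => y.
rewrite inE; apply/andP/imsetP => [[/imsetP[u hu ->] hR]|[u]]; first by exists u; rewrite // inE hu.
by rewrite inE => /andP[hu hR] ->; split=> //; apply: imset_f.
Qed.

Lemma card_instC a (c : colT) R : #|[set y in instC a c | isR R y]| = (R \in c.1).
Proof.
case: (boolP (R \in c.1)) => hR.
  rewrite (_ : [set y in _ | _] = [set unat R a]) ?cards1 //; apply/setP => y; rewrite !inE.
  apply/andP/eqP => [[/orP[/imsetP[R' _ ->]|/imsetP[o _ ->]]]|->] //=; first by move=> /eqP ->.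
  by split; [apply/orP; left; exact: (imset_f (fun R => unat R a)) | exact: eqxx].
apply/eqP; rewrite cards_eq0; apply/eqP/setP => y; rewrite !inE; apply/negbTE/andP.
case=> /orP[/imsetP[R' hR' ->]|/imsetP[o _ ->]] //= /eqP e.
by rewrite -e hR' in hR.
Qed.

Lemma sumb_ord (P : pred 'I_n) (F : 'I_n -> bool) (a : 'I_n) : ~~ P a ->
  (\sum_(b | P b || (b == a)) F b = \sum_(b | P b) F b + F a)%N.
Proof.
move=> h; rewrite (bigD1 a) ?eqxx ?orbT //= addnC; congr (_ + _)%N.
by apply: eq_bigl => b; case: eqP => [->|_]; rewrite ?(negbTE h) ?orbF ?andbT ?andbF.
Qed.

Lemma card_setb (P Q : pred 'I_n) : #|[set b | P b && Q b]| = (\sum_(b | P b) Q b)%N.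
Proof. by rewrite -sum1dep_card big_mkcondr; apply: eq_bigr => b _; case: (Q b). Qed.

Lemma mem_takeE (b : 'I_n) k : (b \in take k E) = (b < k)%N.
Proof. by rewrite in_take ?mem_enum // index_enum_ord. Qed.

Section Run.
Variables (Env : Type) (env : Env) (uW : colT -> Env -> wgt) (vW : {set vatom ar} -> Env -> wgt).
Hypothesis uWE : forall c, wval (uW c env) = wC c.
Hypothesis vWE : forall t, wval (vW t env) = wT t.
Let ts := enum (powerset NC).

(** The invariant of a row: the elements before [j] have met [i] and count partners below [i.+1],
    those from [j] on still count partners below [i], and [i] has counted itself and the elements
    below [j]. What is left to sum over are the pairs of [i] with the elements from [j] on. *)
Lemma row_explore (i : 'I_n) c k d j : (j + d)%N = i -> forall Om, nulO Om ->
  [disjoint Om & Rw i j] -> colO Om i = c ->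
  row_sum ts vW gT up1 up2 env c (map (stO Om i) (drop j (take i E))) (map (stO Om i.+1) (take j E))
    (accO Om (fun b => (b < j)%N || (b == i)) i) (gO Om i.+1) k =
  SB wY (Rw i j) (fun X => k (map (stO (Om :|: X) i.+1) (take i E))
    (accO (Om :|: X) (fun b => (b < i)%N || (b == i)) i) (gO (Om :|: X) i.+1)).
Proof.
elim: d j => [|d IH] j hj Om hn hd hc.
  have ej : j = i by rewrite -hj addn0.
  by rewrite ej Rw_nil SB0 setU0 drop_oversize // size_take; case: ifP => // /negbT; rewrite -leqNgt.
have hji : (j < i)%N by rewrite -hj addnS ltnS leq_addr.
have hjn : (j < n)%N by apply: ltn_trans hji (ltn_ord i).
pose a := Ordinal hjn.
have sE : size E = n by rewrite size_enum_ord.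
have sT : size (take i E) = i by rewrite size_take sE ltn_ord.
have eD : drop j (take i E) = a :: drop j.+1 (take i E).
  rewrite (drop_nth a) ?sT // nth_take //; congr cons.
  by rewrite (nth_ord_enum a a).
have eT : take j.+1 E = rcons (take j E) a.
  by rewrite (take_nth a) ?sE //; congr rcons; rewrite (nth_ord_enum a a).
have hai : a != i by apply: ltn_neq.
have eR : Rw i j = blk [set a; i] :|: Rw i j.+1 := Rw_rec (a := a) hji.
rewrite eD map_cons eR SB_U; last exact: (Rw_disj (a := a) hji).
rewrite SB_blk2 // /= big_enum /=; apply: eq_bigr => t; rewrite powersetE => ht.
rewrite vWE; congr (_ * _).
pose Om1 := Om :|: instT a i t.
have hB y : y \in instT a i t -> suppY y = [set a; i] by apply: instT_blk.
have hd1 : [disjoint Om & blk [set a; i]].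
  by move: hd; rewrite eR !disjoints_subset => h; apply: subset_trans h _; rewrite setCU subsetIl.
have agr1 (s : {set 'I_n}) : ~~ ([set a; i] \subset s) -> agr Om Om1 s.
  by move=> hs; apply: agrU => y /hB ->.
have n1 : nulO Om1 by apply: nulO_U hn => y /hB ->; apply: set2_neq0.
(* The table of a pair lies outside every one-element block, so no cell changes. *)
have cO (b : 'I_n) : colO Om b = colO Om1 b.
  apply: colO_agr; apply: agr1; apply/negP => /subsetP h.
  have /set1P e1 := h _ (set21 a i); have /set1P e2 := h _ (set22 a i).
  by move: hai; rewrite e1 -e2 eqxx.
have nsub (b b' : 'I_n) : (b < i)%N -> (b' < i)%N -> ~~ ([set a; i] \subset [set b; b']).
  move=> h1 h2; apply/negP => /subsetP/(_ _ (set22 a i))/set2P[] e; [move: h1|move: h2]; by rewrite -e ltnn.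
have tO : tabO Om1 a i = t by apply: tabO_instT.
have sO (b : 'I_n) : (b < i)%N -> stO Om i b = stO Om1 i b.
  move=> hb; apply: stO_agr => [|b' hb']; last by apply: agr1; apply: nsub.
  by apply: agr1; have := nsub b b hb hb; rewrite setUid.
(* The invariant for [j.+1] with the table of [a] and [i] decided: [a] has moved to the processed
   elements, and [a] and [i] have each counted the other. *)
transitivity (row_sum ts vW gT up1 up2 env c (map (stO Om1 i) (drop j.+1 (take i E)))
    (map (stO Om1 i.+1) (take j.+1 E))
    (accO Om1 (fun b => (b < j.+1)%N || (b == i)) i) (gO Om1 i.+1) k); last first.
  rewrite IH //.
  - by apply: eq_SB => X hX; rewrite /Om1 setUA.
  - by rewrite -hj addSnnS.
  - rewrite disjoint_sym disjoints_subset setCU subsetI; apply/andP; split.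
      rewrite -disjoints_subset disjoint_sym; apply: disjointWr hd.
      by rewrite eR subsetUr.
    rewrite -disjoints_subset disjoint_sym; apply: disjointWl (Rw_disj (a := a) hji).
    by apply/subsetP => y /hB e; rewrite inE e.
  by rewrite -cO.
have e1 : map (stO Om i) (drop j.+1 (take i E)) = map (stO Om1 i) (drop j.+1 (take i E)).
  by apply/eq_in_map => b /mem_drop; rewrite mem_takeE; apply: sO.
have e2 : rcons (map (stO Om i.+1) (take j E)) ((stO Om i a).1, up1 (stO Om i a).1 c t (stO Om i a).2) =
    map (stO Om1 i.+1) (take j.+1 E).
  rewrite eT map_rcons; congr rcons.
    apply/eq_in_map => b; rewrite mem_takeE => hb; have hbi := ltn_trans hb hji.
    apply: stO_agr => [|b' hb'].
      by apply: agr1; have := nsub b b hbi hbi; rewrite setUid.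
    apply: agr1; apply/negP => /subsetP h.
    have /set2P[e|e] := h _ (set21 a i); first by move: hb; rewrite -e ltnn.
    have /set2P[e'|e'] := h _ (set22 a i); first by move: hbi; rewrite -e' ltnn.
    by move: hai; rewrite e e' eqxx.
  rewrite sO // /stO /=; congr pair; apply/ffunP => l; rewrite !ffunE cap_add; congr cap.
  have -> : mold l (colO Om1 a) c t = msgO Om1 l a i by rewrite msgO_old // -hc cO tO.
  rewrite -(@sumb_ord (fun b => b < i)%N) ?ltnn //; apply: eq_bigl => b.
  by rewrite [RHS]ltnS [RHS]leq_eqVlt -[b == i]val_eqE orbC.
have e3 : up2 (stO Om i a).1 c t (accO Om (fun b => (b < j)%N || (b == i)) i) =
    accO Om1 (fun b => (b < j.+1)%N || (b == i)) i.
  have -> : accO Om (fun b => (b < j)%N || (b == i)) i = accO Om1 (fun b => (b < j)%N || (b == i)) i.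
    apply: accO_agr => // b hb; apply: agr1; apply/negP => /subsetP/(_ _ (set21 a i))/set2P[] e.
      by move: hai; rewrite e eqxx.
    by move: hb; rewrite -e (negbTE hai) ltnn.
  apply/ffunP => l; rewrite !ffunE cap_add; congr cap.
  have -> : mnew l (stO Om i a).1 c t = msgO Om1 l i a by rewrite msgO_new // -hc /stO /= !cO tO.
  rewrite -(@sumb_ord (fun b => (b < j)%N || (b == i))) /= ?ltnn ?(negbTE hai) //; apply: eq_bigl => b.
  by rewrite [(b < j.+1)%N]ltnS [(b <= j)%N]leq_eqVlt [LHS]orbAC -[b == a]val_eqE; congr (_ || _); rewrite orbC.
have e4 : gT t (gO Om i.+1) = gO Om1 i.+1.
  rewrite /gT /gO /=; congr pair; apply/ffunP => R; rewrite !ffunE.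
    rewrite cap_add card_isR ?card_instT //; apply: disjointWr hd1.
    by apply/subsetP => y /hB e; rewrite inE e.
  congr cap; congr #|pred_of_set _|; apply/setP => b; rewrite !inE; congr (_ && _).
  by rewrite /ebitO cO.
by rewrite e1 e2 e3 e4.
Qed.

Lemma col_in_Pos c : wC c != 0 -> c.1 \subset Pos.
Proof. by rewrite /wC; case: ifP; rewrite ?eqxx. Qed.

(** Adding the remaining [d] elements one by one amounts to summing over all undecided blocks of at
    most two elements. *)
Lemma elem_explore phi d i : (i + d)%N = n -> forall Om, nulO Om -> [disjoint Om & Rs i] ->
  all_sum ts uW vW a0 gC gT up1 up2 env d (map (stO Om i) (take i E)) (gO Om i) phi =
  SB wY (Rs i) (fun X => phi (map (stO (Om :|: X) n) E) (gO (Om :|: X) n)).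
Proof.
elim: d i => [|d IH] i hi Om hn hd.
  have ei : i = n by rewrite -hi addn0.
  by rewrite ei Rs_nil SB0 setU0 take_oversize ?size_enum_ord.
have hin : (i < n)%N by rewrite -hi addnS ltnS leq_addr.
pose a := Ordinal hin.
have eR : Rs i = blk [set a] :|: (Rw a 0 :|: Rs i.+1) := Rs_rec a.
have dR : [disjoint blk [set a] & Rw a 0 :|: Rs i.+1] := Rs_disj1 a.
have eT : take i.+1 E = rcons (take i E) a.
  by rewrite (take_nth a) ?size_enum_ord //; congr rcons; rewrite (nth_ord_enum a a).
rewrite /= eR SB_U // SB_blk1; apply: eq_bigr => c _; rewrite uWE.
(* Values that are no cells contribute nothing on either side. *)
have [->|/col_in_Pos hc] := eqVneq (wC c) 0; first by rewrite !mul0r.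
congr (_ * _).
pose Om1 := Om :|: instC a c.
have hB y : y \in instC a c -> suppY y = [set a] by apply: instC_blk.
have hd1 : [disjoint Om & blk [set a]].
  by move: hd; rewrite eR !disjoints_subset => h; apply: subset_trans h _; rewrite setCU subsetIl.
have hdi : [disjoint Om & instC a c].
  by apply: disjointWr hd1; apply/subsetP => y /hB e; rewrite inE e.
have agr1 (s : {set 'I_n}) : a \notin s -> agr Om Om1 s.
  by move=> hs; apply: agrU => y /hB ->; rewrite sub1set.
have s0 (b : 'I_n) : [set b] != set0 by apply/set0Pn; exists b; rewrite set11.
have n1 : nulO Om1 by apply: nulO_U hn => y /hB ->.
have c1 : colO Om1 a = c by apply: colO_instC.
have dRw : [disjoint Om1 & Rw a 0 :|: Rs i.+1].
  rewrite disjoint_sym disjoints_subset setCU subsetI -!disjoints_subset; apply/andP; split.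
    by rewrite disjoint_sym; apply: disjointWr hd; rewrite eR subsetUr.
  by rewrite disjoint_sym; apply: disjointWl dR; apply/subsetP => y /hB e; rewrite inE e.
rewrite SB_U; last exact: (Rs_disj2 a).
pose k (sg : seq (colT * accT)) al g := all_sum ts uW vW a0 gC gT up1 up2 env d (rcons sg (c, al)) g phi.
(* With the cell of the new element decided, its row starts: no old element has been paired yet, and
   the accumulator contains just the message of the element to itself. *)
transitivity (SB wY (Rw a 0) (fun X => k (map (stO (Om1 :|: X) a.+1) (take a E))
    (accO (Om1 :|: X) (fun b => (b < a)%N || (b == a)) a) (gO (Om1 :|: X) a.+1))).
  rewrite -(@row_explore a c k a 0) ?add0n //; last first.
    by apply: disjointWr dRw; rewrite subsetUl.
  rewrite drop0 take0 /=; congr (row_sum _ _ _ _ _ _ _ _ _ _ _ _).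
  - apply/eq_in_map => b; rewrite mem_takeE => hb; apply: stO_agr => [|b' hb']; apply: agr1.
      by rewrite inE; apply: contraTneq hb => <-; rewrite /= ltnn.
    by rewrite !inE negb_or; apply/andP; split; [apply: contraTneq hb | apply: contraTneq hb'] => <-; rewrite /= ltnn.
  - apply/ffunP => l; rewrite !ffunE; congr cap.
    rewrite (big_pred1 a) //.
    by rewrite msgO_self // c1.
  rewrite /gC /gO /=; congr pair; apply/ffunP => R; rewrite !ffunE cap_add; congr cap.
    by rewrite card_isR // card_instC.
  rewrite !card_setb -c1 -/(ebitO Om1 R a).
  rewrite [RHS](_ : _ = \sum_(b : 'I_n | (b < i)%N || (b == a)) ebitO Om1 R b)%N; last first.
    by apply: eq_bigl => b; rewrite ltnS leq_eqVlt -[b == a]val_eqE orbC.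
  rewrite sumb_ord ?ltnn //; congr (_ + _)%N; apply: eq_bigr => b hb; congr (nat_of_bool (ebit R _)).
  by apply: colO_agr; apply: agr1; rewrite inE; apply: contraTneq hb => <-; rewrite /= ltnn.
apply: eq_SB => X hX; pose Om2 := Om1 :|: X.
have hX2 y : y \in X -> exists2 b : 'I_n, (b < i)%N & suppY y = [set b; a].
  by move=> /(subsetP hX); rewrite inE => /existsP[b /and3P[_ h /eqP e]]; exists b.
have c2 : colO Om2 a = c.
  rewrite -c1; apply/esym/colO_agr; apply: agrU => y /hX2[b hb ->].
  by apply/negP => /subsetP/(_ _ (set21 b a))/set1P e; move: hb; rewrite e /= ltnn.
(* After its row the new element has counted all elements up to itself and joins the list. *)
transitivity (all_sum ts uW vW a0 gC gT up1 up2 env d (map (stO Om2 i.+1) (take i.+1 E)) (gO Om2 i.+1) phi).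
  rewrite /k eT map_rcons; congr (all_sum _ _ _ _ _ _ _ _ _ _ (rcons _ _) _ _).
  rewrite /stO c2; congr pair; apply: accO_agr => // b.
  by rewrite [RHS]ltnS [RHS]leq_eqVlt -[b == a]val_eqE orbC.
rewrite IH.
- by apply: eq_SB => X2 _; rewrite /Om2 /Om1 !setUA.
- by rewrite addSnnS.
- by apply: nulO_U n1 => y /hX2[b _ ->]; apply: set2_neq0.
rewrite disjoint_sym disjoints_subset setCU subsetI -!disjoints_subset; apply/andP; split.
  by rewrite disjoint_sym; apply: disjointWr dRw; rewrite subsetUr.
by rewrite disjoint_sym; apply: disjointWl (Rs_disj2 a).
Qed.

End Run.

(** * Consistent guesses and satisfaction of the constraints *)

Definition wo Om : world ar n := [set g | (inl g : Y) \in Om].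
Definition cons Om : bool :=
  [forall a : 'I_n, forall o : 'I_q, ((inr (a, o) : Y) \in Om) == [exists b : 'I_n, msgO Om o a b]].

Lemma locO_wo Om a b : locO Om a b =1 loc (wo Om) a b.
Proof. by move=> u; rewrite /loc inE. Qed.

Lemma msgO_qmsg Om i a b : msgO Om i a b = qmsg (wo Om) (bitO Om) (nth dw wl i) a b.
Proof.
rewrite /msgO /qm /qmsg; case: (nth dw wl i) => [[[g o] v] s]; congr (_ == _).
case: v; first by apply: eq_qe => // u; rewrite locO_wo.
by rewrite [b == a]eq_sym; apply: eq_qe => // u; rewrite locO_wo /loc -inst_swap.
Qed.

Lemma size_place off l : size (place off l) = size l.
Proof. by elim: l off => //= f l IH off; rewrite IH. Qed.

Lemma place_fst off l : map fst (place off l) = l.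
Proof. by elim: l off => //= f l IH off; rewrite IH. Qed.

Lemma place_occ (P : nat -> watcher ar -> Prop) off l :
  (forall j, (j < size l)%N -> all_occ P (nth df (place off l) j).2 (nth df (place off l) j).1) <->
  forall i, (i < size (flatten [seq occ p.2 p.1 | p <- place off l]))%N ->
    P (off + i)%N (nth dw (flatten [seq occ p.2 p.1 | p <- place off l]) i).
Proof.
elim: l off => //= f l IH off; split=> [h i|h [|j] hj].
- rewrite size_cat size_occ nth_cat size_occ => hi2; case: (ltnP i (nq f)) => hi.
    by have /(all_occP _ dw) /= hh := h 0 isT; apply: hh.
  have /(IH (off + nq f)%N) := fun j (hj : (j < size l)%N) => h j.+1 hj.
  by move=> /(_ (i - nq f)%N); rewrite -addnA subnKC //; apply; lia.
- apply/(all_occP _ dw) => i hi /=; have := h i; rewrite size_cat nth_cat size_occ hi; apply.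
  exact: leq_trans hi (leq_addr _ _).
apply: (proj2 (IH (off + nq f)%N)) => // i hi.
have := h (nq f + i)%N; rewrite size_cat nth_cat size_occ (_ : (nq f + i < nq f)%N = false).
  by rewrite addKn addnA; apply; rewrite ltn_add2l.
by apply/negbTE; rewrite -leqNgt leq_addr.
Qed.

Definition truths Om : Prop := forall j, (j < size fl)%N ->
  truth (wo Om) (bitO Om) (nth df placed j).2 (nth df placed j).1.

Lemma bitO_ord Om a (o : 'I_q) : bitO Om a o = ((inr (a, o) : Y) \in Om).
Proof. by rewrite /bitO valK. Qed.

Lemma nth_wl (i : nat) : (i < q)%N -> nth dw wl i = nth dw allw i.
Proof. by move=> h; rewrite /wl nth_cat h. Qed.

Lemma cons_truths Om : cons Om <-> truths Om.
Proof.
have h : cons Om <-> (forall j, (j < size fl)%N ->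
    consis (wo Om) (bitO Om) (nth df placed j).2 (nth df placed j).1).
  apply: (iff_trans _ (iff_sym (place_occ _ _ _))); split.
    move=> /forallP hc i hi a; rewrite add0n.
    have /forallP/(_ (Ordinal hi : 'I_q))/eqP := hc a; rewrite -bitO_ord /= => ->.
    by apply: eq_existsb => b; rewrite msgO_qmsg nth_wl.
  move=> hc; apply/forallP => a; apply/forallP => o; apply/eqP.
  have := hc o (ltn_ord o) a; rewrite add0n bitO_ord => ->.
  by apply: eq_existsb => b; rewrite msgO_qmsg nth_wl.
by rewrite h; split=> hh j hj; apply/truth_consis; apply: hh.
Qed.

Definition guess (w : world ar n) : {set 'I_n * 'I_q} :=
  [set p : 'I_n * 'I_q | [exists b : 'I_n, emsg w (nth dw allw p.2) p.1 b]].

Lemma truths_guess Om : truths Om <-> [set p | (inr p : Y) \in Om] = guess (wo Om).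
Proof.
apply: (iff_trans (place_occ _ _ _)); split=> [h|/setP h i hi a].
  apply/setP => -[a o]; rewrite !inE -bitO_ord.
  by have := h o (ltn_ord o) a; rewrite add0n => ->.
by have := h (a, Ordinal hi : 'I_q); rewrite !inE -bitO_ord add0n.
Qed.

(** Over each world exactly one set of guess bits is consistent, the correct one, and guess bits
    have weight 1; so summing over guesses restores the plain sum over worlds. *)
Lemma SB_world (F : world ar n -> rat) :
  SB wY setT (fun Om => (cons Om)%:R * F (wo Om)) =
  \sum_(w : world ar n) (\prod_(g : gatom ar n) (if g \in w then W (tag g) else Wb (tag g))) * F w.
Proof.
have -> : [set: Y] = ((fun g => inl g : Y) @: [set: gatom ar n]) :|:
    ((fun p => inr p : Y) @: [set: 'I_n * 'I_q]).
  by apply/setP => -[g|p]; rewrite !inE; apply/esym/orP; [left|right]; apply: imset_f; rewrite inE.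
rewrite SB_U; last first.
  by rewrite disjoint_subset; apply/subsetP => y /imsetP[g _ ->]; rewrite !inE; apply/imsetP => -[].
rewrite SB_imset; last by move=> ? ? _ _ [].
apply: eq_big => [w|w _]; first by rewrite subsetT.
congr (_ * _); first by apply: eq_big => [g|g _]; rewrite ?inE.
rewrite SB_imset; last by move=> ? ? _ _ [].
have hw (be : {set 'I_n * 'I_q}) : wo ((fun g => inl g : Y) @: w :|: (fun p => inr p : Y) @: be) = w.
  apply/setP => g; rewrite !inE; have -> : ((inl g : Y) \in [set inr p | p in be]) = false.
    by apply/imsetP => -[].
  by rewrite orbF; apply/imsetP/idP => [[g' hg [->]] //|hg]; exists g.
have hb (be : {set 'I_n * 'I_q}) : [set p | (inr p : Y) \in ((fun g => inl g : Y) @: w :|: (fun p => inr p : Y) @: be)] = be.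
  apply/setP => p; rewrite !inE; have -> : ((inr p : Y) \in [set inl g | g in w]) = false.
    by apply/imsetP => -[].
  by apply/imsetP/idP => [[p' hp [->]] //|hp]; exists p.
rewrite (bigD1 (guess w)) ?subsetT //= big1 ?mul1r ?hw => [|p _]; last by [].
rewrite big1 ?addr0 => [|be /andP[_ hne]].
  have -> : cons ((fun g => inl g : Y) @: w :|: (fun p => inr p : Y) @: (guess w)).
    by apply/cons_truths/truths_guess; rewrite hb hw.
  by rewrite mul1r.
rewrite (_ : cons _ = false) ?mul0r ?mulr0 //.
apply/negP => /cons_truths/truths_guess; rewrite hb hw => e.
by rewrite e eqxx in hne.
Qed.

Lemma leq_sumn (s : seq nat) k : k \in s -> (k <= sumn s)%N.
Proof.
elim: s => //= x s IH; rewrite in_cons => /orP[/eqP ->|/IH h]; first exact: leq_addr.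
exact: leq_trans h (leq_addl _ _).
Qed.

Lemma cap_eq N k : (k < CAP)%N -> (cap N == k :> nat) = (N == k).
Proof. by move=> h; rewrite val_cap; lia. Qed.

Lemma cap_cmp o N k : (k < CAP)%N -> cmp_eval o (cap N) k = cmp_eval o N k.
Proof. by move=> h; rewrite val_cap; case: o => /=; lia. Qed.

Lemma cap_sum_gt0 (F : 'I_n -> bool) : (0 < cap (\sum_(b : 'I_n | (b < n)%N) F b))%N = [exists b, F b].
Proof.
have -> : (0 < cap (\sum_(b : 'I_n | (b < n)%N) F b))%N = (0 < \sum_(b : 'I_n | (b < n)%N) F b)%N.
  by rewrite val_cap /CAP; lia.
rewrite lt0n sum_nat_eq0; apply/idP/existsP => [|[b hb]].
  by rewrite negb_forall => /existsP[b]; rewrite negb_imply => /andP[_ h]; exists b; case: (F b) h.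
by apply/negP => /forallP/(_ b); rewrite ltn_ord hb.
Qed.

Lemma nth_placed j : (j < size fl)%N -> (nth df placed j).1 = nth df.1 fl j.
Proof. by move=> h; rewrite -(nth_map _ df.1) ?size_place // place_fst. Qed.

Lemma size_fl : size fl = (ne + nc).+1.
Proof. by rewrite /= size_cat !size_map. Qed.

Lemma nth_cntw (j : nat) : (j < nc)%N ->
  nth dw wl (q + j) = ((nth (0, df.1) cnts j).2, (nth df placed (ne.+1 + j)).2, vy, true).
Proof.
move=> hj; have hs : (ne.+1 + j < size placed)%N by rewrite size_place size_fl addSn ltnS ltn_add2l.
rewrite /wl nth_cat -/q ltnNge leq_addr /= addKn /cntw (nth_map df); last first.
  by rewrite size_drop size_place size_fl subSS addKn.
rewrite nth_drop nth_placed; last by rewrite -(size_place 0).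
congr (_, _, _, _); rewrite /= nth_cat size_map -/ne ltnNge leq_addr /= addKn.
by rewrite (nth_map (0, df.1)).
Qed.

Lemma nth_efl (j : nat) : (j < ne)%N -> nth df.1 efl j = FAll vy (nth (0, df.1) ecnts j).2.
Proof. by move=> hj; rewrite (nth_map (0, df.1)). Qed.

Lemma ebitO_eval Om (j : nat) a : nulO Om -> truths Om -> (j < ne)%N ->
  ebitO Om j a = [forall b, eval (wo Om) (envxy a b) (nth (0, df.1) ecnts j).2].
Proof.
move=> hn ht hj; have hj2 : (j.+1 < size fl)%N by rewrite size_fl ltnS ltn_addr.
have /= e := nth_placed hj2; rewrite nth_cat size_map -/ne hj nth_efl // in e.
have := qe_eval a a (ht j.+1 hj2); rewrite e eqxx /= => h.
transitivity (qe (loc (wo Om) a a) true (bitO Om a) (bitO Om a) (eoff j) (FAll vy (nth (0, df.1) ecnts j).2)).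
  rewrite /ebitO /ebit nth_efl //; apply: eq_qe => u; rewrite ?bitO_f //.
  by rewrite -locO_wo locO_S.
rewrite [LHS]/= /eoff h; apply: eq_forallb => b.
by apply: eval_ext => u; rewrite (upd_envxy a a b vy).
Qed.

Lemma msgO_cnt Om (j : nat) a b : truths Om -> (j < nc)%N ->
  msgO Om (q + j) a b = eval (wo Om) (envxy a b) (nth (0, df.1) cnts j).2.
Proof.
move=> ht hj; have hj2 : (ne.+1 + j < size fl)%N by rewrite size_fl addSn ltnS ltn_add2l.
rewrite msgO_qmsg nth_cntw // [qmsg _ _ _ _ _]/= eqb_id.
have e : (nth df placed (ne.+1 + j)).1 = (nth (0, df.1) cnts j).2.
  rewrite nth_placed // /= nth_cat size_map -/ne ltnNge leq_addr /= addKn.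
  by rewrite (nth_map (0, df.1)).
by have := qe_eval a b (ht _ hj2); rewrite e.
Qed.

Lemma Ncount_isR Om R : Ncount R (wo Om) = #|[set y in Om | isR R y]|.
Proof.
rewrite /Ncount -(card_imset _ (f := fun g => inl g : Y)); last by move=> ? ? [].
congr #|pred_of_set _|; apply/setP => y; rewrite [RHS]inE; apply/imsetP/andP => [[g]|[hy hR]].
  by rewrite !inE => /andP[h1 h2] ->.
by case: y hy hR => // g hy hR; exists g; rewrite // !inE hy.
Qed.

Lemma all_nthE (T : Type) (d : T) (p : pred T) (s : seq T) : all p s = [forall j : 'I_(size s), p (nth d s j)].
Proof.
by apply/(all_nthP d)/forallP => [h j|h i hi]; [apply: h | exact: (h (Ordinal hi))].
Qed.

Lemma leq_sumn_nth (l : seq (nat * fo2 ar)) j : (j < size l)%N -> ((nth (0%N, df.1) l j).1 <= sumn (map fst l))%N.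
Proof.
by move=> hj; rewrite -(nth_map _ 0%N fst) //; apply: leq_sumn; rewrite mem_nth ?size_map.
Qed.

Lemma cnt_lt j : (j < size cnts)%N -> ((nth (0%N, df.1) cnts j).1 < CAP)%N.
Proof.
move=> hj; rewrite /CAP ltnS; apply: leq_trans (leq_sumn_nth hj) _.
by rewrite -addnA addnCA leq_addr.
Qed.

Lemma ecnt_lt j : (j < size ecnts)%N -> ((nth (0%N, df.1) ecnts j).1 < CAP)%N.
Proof. by move=> hj; rewrite /CAP ltnS; apply: leq_trans (leq_sumn_nth hj) (leq_addl _ _). Qed.

Lemma cards_lt : all (fun k => k < CAP)%N (map snd cards).
Proof.
apply/allP => k hk; rewrite /CAP ltnS -addnA; apply: leq_trans _ (leq_addr _ _).
exact: leq_sumn.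
Qed.

(** The tests on final states express consistency and all constraints together. Only [Gamma] over
    the empty domain escapes them, there being no element at which to evaluate it; hence the last
    conjunct. *)
Lemma sat_ok Om : nulO Om -> sentence Gamma ->
  cons Om && sat_all Gamma cards cnts ecnts (wo Om) =
  [&& okg (gO Om n), all okc (map (stO Om n) E) & (n != 0) || eval (wo Om) (@env0 n) Gamma].
Proof.
move=> hn hs.
have part1 : cons Om = all (fun a => [forall o : 'I_q,
    (o \in (stO Om n a).1.2) == (0 < (stO Om n a).2 (lshift nc o))%N]) E.
  apply/forallP/allP => [h a _|h a]; apply/forallP => o.
    have /forallP/(_ o) := h a; rewrite ffunE cap_sum_gt0 inE => /eqP ->.
    by apply/eqP/eq_existsb.
  have /forallP/(_ o) := h a (mem_enum _ _); rewrite ffunE cap_sum_gt0 inE => /eqP ->.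
  by apply/eqP/eq_existsb.
(* Without consistency both sides are false: by [part1] the guess test of [okc] fails at some
   element. *)
case: (boolP (cons Om)) => hc; last first.
  apply/esym/negbTE/negP => /and3P[_ + _]; rewrite all_map => hall.
  move/negP: hc; apply; rewrite part1; apply: sub_all hall => a /and3P[] //.
have ht : truths Om by apply/cons_truths.
(* The guesses being correct, propositional evaluation gives the truth value of [Gamma] at [a], and
   this is independent of [a] because [Gamma] has no free variable. *)
have eG a : qe (locS (stO Om n a).1.1) true (bitf (stO Om n a).1.2) (bitf (stO Om n a).1.2) 0 Gamma =
    eval (wo Om) (@env0 n) Gamma.
  have := qe_eval a a (ht 0 isT); rewrite eqxx /= => h.
  transitivity (qe (loc (wo Om) a a) true (bitO Om a) (bitO Om a) 0 Gamma).
    by apply: eq_qe => u; rewrite ?bitO_f // -locO_wo locO_S.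
  rewrite h; apply: eval_free => v hv.
  by move: hs; rewrite /sentence; case: v hv => ->; rewrite ?andbF.
have eC : all okc (map (stO Om n) E) = all (sat_fa_excount (wo Om)) cnts && ((n == 0) || eval (wo Om) (@env0 n) Gamma).
  rewrite all_map; apply/allP/andP => [h|[h1 h2] a _ /=].
    split; last first.
      case: (posnP n) => hn0; first by [].
      have /and3P[_ _] := h (Ordinal hn0) (mem_enum _ _); rewrite eG => ->; by rewrite orbT.
    rewrite (all_nthE (0, df.1)); apply/forallP => j; apply/forallP => a.
    have /and3P[_ /forallP/(_ j) + _] := h a (mem_enum _ _).
    rewrite ffunE cap_eq; last exact: cnt_lt.
    move=> /eqP <-; apply/eqP; rewrite -sum1dep_card big_mkcond; apply: eq_big => [b|b _]; first by rewrite ltn_ord.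
    by rewrite msgO_cnt //; case: (eval _ _ _).
  apply/and3P; split.
  - by move: hc; rewrite part1 => /allP/(_ a (mem_enum _ _)).
  - apply/forallP => j; rewrite ffunE cap_eq; last exact: cnt_lt.
    move: h1; rewrite (all_nthE (0, df.1)) => /forallP/(_ j)/forallP/(_ a)/eqP <-.
    rewrite -sum1dep_card [X in _ == X]big_mkcond; apply/eqP; apply: eq_big => [b|b _]; first by rewrite ltn_ord.
    by rewrite msgO_cnt //; case: (eval _ _ _).
  rewrite eG; case/orP: h2 => // /eqP e0; by have := leq_trans (ltn_ord a) (eq_leq e0).
have eg : okg (gO Om n) = all (sat_card (wo Om)) cards && all (sat_excount_fa (wo Om)) ecnts.
  rewrite /okg; congr (_ && _).
    have h l : all (fun k => k < CAP)%N (map snd l) ->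
        all (fun cc : 'I_r * cmp * nat => cmp_eval cc.1.2 ((gO Om n).1 cc.1.1) cc.2) l = all (sat_card (wo Om)) l.
      elim: l => //= -[[R o] c] l IH /andP[h1 h2]; rewrite IH //; congr (_ && _).
      by rewrite /sat_card /= ffunE Ncount_isR cap_cmp.
    exact: h cards_lt.
  rewrite (all_nthE (0, df.1)); apply: eq_forallb => j; rewrite ffunE cap_eq; last first.
    exact: ecnt_lt.
  rewrite /sat_excount_fa; congr (_ == _); congr #|pred_of_set _|; apply/setP => a; rewrite !inE ltn_ord /=.
  by rewrite ebitO_eval.
rewrite eC eg /sat_all /=; case: (eval (wo Om) _ Gamma) => /=; rewrite ?orbT ?andbT ?orbF.
  by rewrite -!andbA; congr (_ && _); rewrite andbC.
by case: (n == 0); rewrite /= ?andbF.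
Qed.

(** * Counting atoms by support; atoms over three or more elements *)

Definition cI (R : 'I_r) (B : {set Y}) : nat := #|[set y in B | isR R y]|.
Definition BigY : {set Y} := [set y | (2 < #|suppY y|)%N].
Definition ncR (R : 'I_r) : nat := #|[set u in NC | tag u == R]|.

Lemma cI_U R (B1 B2 : {set Y}) : [disjoint B1 & B2] -> cI R (B1 :|: B2) = (cI R B1 + cI R B2)%N.
Proof. exact: card_isR. Qed.

Lemma cI0 R : cI R set0 = 0%N.
Proof. by apply/eqP; rewrite cards_eq0; apply/eqP/setP => y; rewrite !inE. Qed.

Lemma cI_Rw R (i : 'I_n) j d : (j + d)%N = i -> cI R (Rw i j) = (d * ncR R)%N.
Proof.
elim: d j => [|d IH] j hj.
  by rewrite -(addn0 j) hj Rw_nil cI0.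
have hji : (j < i)%N by rewrite -hj addnS ltnS leq_addr.
pose a := Ordinal (ltn_trans hji (ltn_ord i)).
have -> : Rw i j = blk [set a; i] :|: Rw i j.+1 := Rw_rec (a := a) hji.
have hai : a != i by apply: ltn_neq.
rewrite cI_U; last exact: (Rw_disj (a := a) hji).
by rewrite blk2E // /cI card_instT // -/(cI R _) IH ?mulSn // addSnnS.
Qed.

Lemma cI_Rs R d i : (i + d)%N = n ->
  cI R (Rs i) = (d * (R \in Pos) + (\sum_(i <= j < n) j) * ncR R)%N.
Proof.
elim: d i => [|d IH] i hi.
  by rewrite -(addn0 i) hi Rs_nil cI0 big_geq.
have hin : (i < n)%N by rewrite -hi addnS ltnS leq_addr.
pose a := Ordinal hin.
have -> : Rs i = blk [set a] :|: (Rw a 0 :|: Rs i.+1) := Rs_rec a.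
rewrite cI_U; last exact: (Rs_disj1 a).
rewrite cI_U; last exact: (Rs_disj2 a).
rewrite blk1E /cI card_instC -!/(cI R _) (@cI_Rw R a 0 i) ?add0n // IH ?addSnnS //.
by rewrite (big_ltn hin) mulSn mulnDl addnA addnACA addnA.
Qed.

Definition nulat (R : U0) : Y :=
  inl (Tagged (fun R => (ar R).-tuple 'I_n) (tcast (esym (eqP (valP R))) [tuple])).
Definition instZ (zz : {set U0}) : {set Y} := nulat @: zz.
Definition wZ (zz : {set U0}) : rat := \prod_(R : U0) (if R \in zz then W (val R) else Wb (val R)).

Lemma nulat_inj : injective nulat.
Proof. by move=> R R' [] /val_inj. Qed.

Lemma supp_nulat R : suppY (nulat R) = set0.
Proof. by apply/setP => c; rewrite !inE /= val_tcast. Qed.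

Lemma supp0_nulat (y : Y) : suppY y = set0 -> exists R, y = nulat R.
Proof.
case: y => [[R g]|[a o]] /= /setP h; last by have := h a; rewrite !inE eqxx.
have hg : tval g = [::].
  by case e: (tval g) => [//|c s]; have := h c; rewrite !inE /= e mem_head.
have h0 : ar R == 0%N by rewrite -(size_tuple g) hg.
exists (Sub R h0); rewrite /nulat; congr inl; rewrite [val _]/=.
by congr (Tagged _ _); apply: val_inj; rewrite /= val_tcast hg.
Qed.

Lemma blk0E : blk set0 = nulat @: [set: U0].
Proof.
apply/setP => y; rewrite inE; apply/eqP/imsetP => [/supp0_nulat[R ->]|[R _ ->]]; last exact: supp_nulat.
by exists R; rewrite ?inE.
Qed.

Lemma SB_blk0 (Phi : {set Y} -> rat) : SB wY (blk set0) Phi = \sum_(zz : {set U0}) wZ zz * Phi (instZ zz).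
Proof.
rewrite blk0E SB_imset; last by move=> ? ? _ _; apply: nulat_inj.
apply: eq_big => [zz|zz _]; first by rewrite subsetT.
by congr (_ * _); apply: eq_bigl => R; rewrite inE.
Qed.

Lemma nulO_instZ : nulO (instZ z).
Proof.
move=> y /supp0_nulat[R ->] /=; rewrite /zin valK.
by apply/imsetP/idP => [[R' h /nulat_inj ->] //|h]; exists R.
Qed.

Lemma cI_blk0 R : cI R (blk set0) = (ar R == 0%N).
Proof.
rewrite blk0E /cI; case: (boolP (ar R == 0%N)) => h.
  rewrite (_ : [set _ in _ | _] = [set nulat (Sub R h)]) ?cards1 //; apply/setP => y; rewrite !inE.
  apply/andP/eqP => [[/imsetP[R' _ ->] /= /eqP e]|->].
    by congr nulat; apply: val_inj.
  by split; [apply: imset_f; rewrite inE | rewrite /= eqxx].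
apply/eqP; rewrite cards_eq0; apply/eqP/setP => y; rewrite !inE; apply/negbTE/andP.
case=> /imsetP[R' _ ->] /= /eqP e.
have hv : ar (sval R') == 0%N := valP R'; by rewrite e (negbTE h) in hv.
Qed.

Lemma cI_instZ R : cI R (instZ z) = zin z R.
Proof.
rewrite /cI /zin; case: insubP => [R0 h0 e|hn].
  case: (boolP (R0 \in z)) => hz.
    rewrite (_ : [set _ in _ | _] = [set nulat R0]) ?cards1 //; apply/setP => y; rewrite !inE.
    apply/andP/eqP => [[/imsetP[R' _ ->] /= /eqP e']|->].
      by congr nulat; apply: val_inj; exact: (etrans e' (esym e)).
    by split; [apply: imset_f | rewrite /= e eqxx].
  apply/eqP; rewrite cards_eq0; apply/eqP/setP => y; rewrite !inE; apply/negbTE/andP.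
  case=> /imsetP[R' hR' ->] /= /eqP e'; case/negP: hz.
  by have <- : R' = R0 by apply: val_inj; exact: (etrans e' (esym e)).
apply/eqP; rewrite cards_eq0; apply/eqP/setP => y; rewrite !inE; apply/negbTE/andP.
case=> /imsetP[R' _ ->] /= /eqP e; have hv : ar (sval R') == 0%N := valP R'; by rewrite e (negbTE hn) in hv.
Qed.

Lemma setT_split : [set: Y] = blk set0 :|: (BigY :|: Rs 0).
Proof.
apply/setP => y; rewrite !inE /small; apply/esym.
have [/eqP|h] := posnP #|suppY y|; first by rewrite cards_eq0 => ->.
rewrite [(_ <= 2)%N]leqNgt; case: (2 < _)%N; rewrite ?orbT //= orbC.
have [a ha] := card_gt0P h.
by have -> : [exists a : 'I_n, a \in suppY y] by apply/existsP; exists a.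
Qed.

Lemma disj_split1 : [disjoint blk set0 & BigY :|: Rs 0].
Proof.
rewrite disjoint_subset; apply/subsetP => y; rewrite !inE => /eqP h.
by rewrite /small h cards0.
Qed.

Lemma disj_split2 : [disjoint BigY & Rs 0].
Proof.
rewrite disjoint_subset; apply/subsetP => y; rewrite !inE => h.
by rewrite /small [(_ <= 2)%N]leqNgt h andbF.
Qed.

Lemma cI_setT R : cI R setT = (n ^ ar R)%N.
Proof.
have -> : (n ^ ar R)%N = #|{: (ar R).-tuple 'I_n}| by rewrite card_tuple card_ord.
rewrite -(card_imset _ (f := fun t => inl (Tagged (fun R => (ar R).-tuple 'I_n) t) : Y)); last first.
  by move=> t t' [] /eqP; rewrite eq_Tagged => /eqP.
congr #|pred_of_set _|; apply/setP => y; rewrite !inE; apply/idP/imsetP => [|[t _ ->]] /=; last exact: eqxx.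
case: y => //= -[R' t] /= /eqP e; subst R'.
by exists t.
Qed.

(** Counted by complement: from all ground atoms of [R] are removed the nullary one, one for each
    element if the arity is positive, and [ncR R] for each of the unordered pairs, whose number is
    the sum of the [j] below [n]. *)
Lemma cI_Big R : cI R BigY =
  (n ^ ar R - ((ar R == 0) + (n * (0 < ar R) + (\sum_(0 <= j < n) j) * ncR R)))%N.
Proof.
rewrite -cI_setT setT_split cI_U ?disj_split1 // cI_U ?disj_split2 // cI_blk0 (@cI_Rs R n 0) // inE.
by rewrite addnCA addnK.
Qed.

Definition gadd (g : gloT) X : gloT := ([ffun R => cap (g.1 R + cI R X)], g.2).

Lemma cap_val (x : 'I_CAP.+1) : cap x = x.
Proof. by apply: val_inj; rewrite /= val_cap; have := ltn_ord x; lia. Qed.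

Section Run2.
Variables (Env : Type) (env : Env) (uW : colT -> Env -> wgt) (vW : {set vatom ar} -> Env -> wgt).
Variables (rW rWb : 'I_r -> Env -> wgt) (bigcount : 'I_r -> Env -> nat).
Hypothesis uWE : forall c, wval (uW c env) = wC c.
Hypothesis vWE : forall t, wval (vW t env) = wT t.
Hypothesis rWE : forall R, wval (rW R env) = W R.
Hypothesis rWbE : forall R, wval (rWb R env) = Wb R.
Hypothesis countE : forall R, bigcount R env = cI R BigY.
Let ts := enum (powerset NC).

Definition bstep (R : 'I_r) (g : gloT) (x : Env) : seq (gloT * wgt) := [:: (gB R g, rW R x); (g, rWb R x)].

Lemma gB_comm R R' g : gB R (gB R' g) = gB R' (gB R g).
Proof.
rewrite /gB /=; congr pair; apply/ffunP => S; rewrite !ffunE !cap_add -!addnA.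
by rewrite [X in (_ + X)%N]addnC.
Qed.

Lemma lin_bstep R g phi : lin wval (bstep R g env) phi = W R * phi (gB R g) + Wb R * phi g.
Proof. by rewrite /lin /bstep !big_cons big_nil addr0 /= rWE rWbE. Qed.

(** Big atoms affect nothing but the global counters, and there only through their predicates; each
    is an independent choice between true and false. *)
Lemma SB_big_list (l : seq (gatom ar n)) (g : gloT) (F : gloT -> rat) : uniq l ->
  SB wY [set y | y \in map (fun h => inl h : Y) l] (fun X => F (gadd g X)) =
  path_sum (fun (R0 : 'I_r) g => bstep R0 g env) (map tag l) g F.
Proof.
elim: l g => [|h l IH] g hu.
  rewrite (_ : [set y | _] = set0) ?SB0 /=; last by apply/setP => y; rewrite !inE.
  congr F; rewrite /gadd; case: g => g1 g2; congr pair; apply/ffunP => R.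
  by rewrite ffunE cI0 addn0 cap_val.
case/andP: hu => hh hu.
have -> : [set y | y \in map (fun h => inl h : Y) (h :: l)] =
    [set (inl h : Y)] :|: [set y | y \in map (fun h => inl h : Y) l].
  by apply/setP => y; rewrite !inE.
have hd : [disjoint [set (inl h : Y)] & [set y | y \in map (fun h => inl h : Y) l]].
  rewrite disjoints1 inE; apply: contra hh => /mapP[h' hh' [->]] //.
rewrite SB_U // SB_1 /= lin_bstep; congr (_ * _ + _ * _); last first.
  by rewrite -IH //; apply: eq_SB => X _; rewrite set0U.
rewrite -IH //; apply: eq_SB => X hX; congr F; rewrite /gadd /=; congr pair; apply/ffunP => R.
rewrite !ffunE cap_add -addnA; congr (cap (_ + _)).
rewrite cI_U; last by apply: disjointWr hd.
congr (_ + _)%N; rewrite /cI; case: (boolP (tag h == R)) => e.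
  rewrite (_ : [set _ in _ | _] = [set (inl h : Y)]) ?cards1 //; apply/setP => y; rewrite !inE.
  by apply/andP/eqP => [[/eqP]|->] //=; rewrite eqxx.
apply/eqP; rewrite cards_eq0; apply/eqP/setP => y; rewrite !inE; apply/negbTE/andP.
by case=> /eqP -> /=; apply/negP.
Qed.

Definition bigl : seq (gatom ar n) := [seq g <- enum {: gatom ar n} | (inl g : Y) \in BigY].

Lemma bigl_set : [set y | y \in map (fun h => inl h : Y) bigl] = BigY.
Proof.
apply/setP => y; rewrite inE; apply/mapP/idP => [[g]|hy].
  by rewrite mem_filter => /andP[h _] ->.
case: y hy => [g|[a o]] hy; first by exists g => //; rewrite mem_filter hy mem_enum.
by move: hy; rewrite inE /= cards1.
Qed.

Lemma perm_bigs : perm_eq (map tag bigl) (bigs bigcount env).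
Proof.
apply/allP => R _ /=; apply/eqP.
have -> : count_mem R (bigs bigcount env) = bigcount R env.
  rewrite /bigs count_flatten -map_comp sumnE big_map big_enum /= (bigD1 R) //=.
  rewrite count_nseq /= eqxx mul1n big1 ?addn0 // => t /negbTE ht.
  by rewrite count_nseq /= ht mul0n.
rewrite countE count_map -sum1_count /bigl big_filter_cond big_enum_cond /= sum1dep_card /cI.
rewrite -(card_imset _ (f := fun h => inl h : Y)); last by move=> ? ? [].
congr #|pred_of_set _|; apply/setP => y; rewrite [RHS]inE; apply/imsetP/andP => [[g]|[hy hR]].
  by rewrite inE => /andP[h1 h2] ->.
by case: y hy hR => // g hy hR; exists g; rewrite // inE hy.
Qed.

(** For fixed nullary atoms, the sum over big atoms can be carried out before all elements, since no
    message depends on it. The order of big atoms is adapted to the program by commutation of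
    [gB]. *)
Lemma z_part : sentence Gamma ->
  (forall Om, nulO Om -> n = 0%N -> eval (wo Om) (@env0 n) Gamma = ev0 Gamma) ->
  SB wY (BigY :|: Rs 0) (fun X => (cons (instZ z :|: X) && sat_all Gamma cards cnts ecnts (wo (instZ z :|: X)))%:R) =
  ((n != 0%N) || ev0 Gamma)%:R *
  path_sum (fun (R0 : 'I_r) g => bstep R0 g env) (bigs bigcount env) g0
    (fun g => all_sum ts uW vW a0 gC gT up1 up2 env n [::] g (fun sg g' => (okg g' && all okc sg)%:R)).
Proof.
move=> hs hev; rewrite SB_U; last exact: disj_split2.
rewrite -(path_sum_perm _ _ _ perm_bigs); last first.
  move=> R R' g phi; rewrite !lin_bstep gB_comm !mulrDr !mulrA.
  by rewrite [W R * W R']mulrC [W R * Wb R']mulrC [Wb R * W R']mulrC [Wb R * Wb R']mulrC addrACA.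
have ub : uniq bigl by rewrite filter_uniq ?enum_uniq.
rewrite -(SB_big_list g0 _ ub) bigl_set -[in RHS]/(SB _ _ _).
rewrite [RHS](_ : _ = SB wY BigY (fun X => ((n != 0%N) || ev0 Gamma)%:R *
  all_sum ts uW vW a0 gC gT up1 up2 env n [::] (gadd g0 X) (fun sg g' => (okg g' && all okc sg)%:R))); last first.
  by rewrite /SB mulr_sumr; apply: eq_bigr => X _; rewrite mulrCA.
apply: eq_SB => X1 hX1; pose Om := instZ z :|: X1.
have hX y : y \in X1 -> suppY y != set0.
  by move=> /(subsetP hX1); rewrite inE => h; rewrite -cards_eq0 -lt0n; apply: ltn_trans h.
have hn : nulO Om by apply: nulO_U hX nulO_instZ.
have hZ : instZ z \subset blk set0 by rewrite blk0E imsetS ?subsetT.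
(* The counters after the big atoms are the state in which no element has yet been added. *)
have -> : gadd g0 X1 = gO Om 0.
  rewrite /gadd /gO /=; congr pair; apply/ffunP => R; rewrite !ffunE.
    rewrite cap_add -[#|_|]/(cI R Om) cI_U ?cI_instZ //.
    by apply: disjointW disj_split1 => //; apply: subset_trans hX1 (subsetUl _ _).
  by congr cap; apply/esym/eqP; rewrite cards_eq0; apply/eqP/setP => a; rewrite !inE.
have hd : [disjoint Om & Rs 0].
  rewrite disjoint_sym disjoints_subset setCU subsetI -!disjoints_subset; apply/andP; split.
    by rewrite disjoint_sym; apply: disjointW disj_split1 => //; rewrite subsetUr.
  by rewrite disjoint_sym; apply: disjointWl disj_split2.
have := @elem_explore Env env uW vW uWE vWE (fun sg g' => (okg g' && all okc sg)%:R) n 0 (add0n n) Om hn hd.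
rewrite take0 /= => ->; rewrite /SB mulr_sumr; apply: eq_bigr => X hX2; rewrite mulrCA; congr (_ * _).
rewrite setUA -/Om sat_ok //; last first.
  apply: nulO_U hn => y /(subsetP hX2); rewrite inE /small -cards_eq0 -lt0n.
  by case/andP => /andP[].
rewrite -natrM mulnb; congr (_ %:R); congr nat_of_bool.
have -> : (n != 0%N) || eval (wo (Om :|: X)) (@env0 n) Gamma = (n != 0%N) || ev0 Gamma.
  case: eqP => //= e0; apply: hev e0.
  apply: nulO_U hn => y /(subsetP hX2); rewrite inE /small -cards_eq0 -lt0n.
  by case/andP => /andP[].
by rewrite andbA [RHS]andbC.
Qed.

End Run2.

Lemma ev0P Om (f : fo2 ar) : nulO Om -> n = 0%N -> eval (wo Om) (@env0 n) f = ev0 f.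
Proof.
move=> hn h0.
have no (a : 'I_n) : False by have := leq_trans (ltn_ord a) (eq_leq h0).
elim: f => [R args|u v|g IH|g IHg h IHh|g IHg h IHh|v g IH|v g IH] //=.
- have [hR|hR] := posnP (ar R); last first.
    have -> : zin z R = false by rewrite /zin; case: insubP => //= R0 h1 e1; move: hR; rewrite lt0n h1.
    apply/existsP => -[t /andP[_ /forallP h]].
    by have := h (Ordinal hR); rewrite /env0.
  have hz (t : (ar R).-tuple 'I_n) : suppY (inl (Tagged (fun R => (ar R).-tuple 'I_n) t) : Y) = set0.
    apply/setP => c; rewrite !inE /=.
    have : size (tval t) = 0%N by rewrite size_tuple hR.
    by case: (tval t).
  apply/existsP/idP => [[t /andP[h _]]|h].
    by move: h; rewrite inE (hn _ (hz t)).
  exists (tcast (esym hR) [tuple]); rewrite inE (hn _ (hz _)) /= h /=.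
  by apply/forallP => i; have := leq_trans (ltn_ord i) (eq_leq hR).
- by rewrite IH.
- by rewrite IHg IHh.
- by rewrite IHg IHh.
- by apply/existsP => -[a _]; case: (no a).
- by apply/forallP => a; case: (no a).
Qed.

End Explore.
End Fixed_z.

Section Total.
Variables (n : nat) (W Wb : 'I_r -> rat).
Local Open Scope ring_scope.

Lemma card_tag R : #|[set g : gatom ar n | tag g == R]| = (n ^ ar R)%N.
Proof.
have -> : (n ^ ar R)%N = #|{: (ar R).-tuple 'I_n}| by rewrite card_tuple card_ord.
rewrite -(card_imset _ (f := fun t => Tagged (fun R => (ar R).-tuple 'I_n) (t : (ar R).-tuple 'I_n))); last first.
  by move=> t t' /eqP; rewrite eq_Tagged => /eqP.
congr #|pred_of_set _|; apply/setP => y; rewrite !inE; apply/idP/imsetP => [|[t _ ->]] /=; last exact: eqxx.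
by case: y => R' t /= /eqP e; subst R'; exists t.
Qed.

Lemma weightE (w : world ar n) :
  weight W Wb w = \prod_(g : gatom ar n) (if g \in w then W (tag g) else Wb (tag g)).
Proof.
rewrite /weight [RHS](partition_big (fun g : gatom ar n => tag g) xpredT) //=; apply: eq_bigr => R _.
rewrite [RHS](bigID (fun g => g \in w)) /=; congr (_ * _).
  rewrite (eq_bigr (fun _ => W R)) => [|g /andP[/eqP <- ->] //].
  rewrite (eq_bigl (mem [set a in w | tag a == R])) ?prodr_const //.
  by move=> g; rewrite /= !inE andbC.
rewrite (eq_bigr (fun _ => Wb R)) => [|g /andP[/eqP <- /negbTE ->] //].
rewrite (eq_bigl (mem ([set a | tag a == R] :\: w))) ?prodr_const; last first.
  by move=> g; rewrite /= !inE andbC.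
congr (_ ^+ _); rewrite -(card_tag R) -(cardsID w); rewrite /Ncount.
have -> : [set a in w | tag a == R] = [set g : gatom ar n | tag g == R] :&: w.
  by apply/setP => g; rewrite !inE andbC.
by rewrite addKn.
Qed.

Variables (Env : Type) (env : Env) (uW : colT -> Env -> wgt) (vW : {set vatom ar} -> Env -> wgt).
Variables (rW rWb : 'I_r -> Env -> wgt) (bigcount : 'I_r -> Env -> nat) (nn : Env -> nat).
Hypothesis uWE : forall c, wval (uW c env) = wC W Wb c.
Hypothesis vWE : forall t, wval (vW t env) = wT W Wb t.
Hypothesis rWE : forall R, wval (rW R env) = W R.
Hypothesis rWbE : forall R, wval (rWb R env) = Wb R.
Hypothesis countE : forall R, bigcount R env =
  (n ^ ar R - ((ar R == 0) + (n * (0 < ar R) + (\sum_(0 <= j < n) j) * ncR R)))%N.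
Hypothesis nnE : nn env = n.

(** Nullary atoms outermost; for each choice the remaining sum is one run of the program, the factor
    in front correcting the empty domain. *)
Lemma total_sum : sentence Gamma ->
  WFOMC n Gamma cards cnts ecnts W Wb =
  \sum_(z : {set U0}) wZ W Wb z * (((n != 0%N) || ev0 z Gamma)%:R *
    wval (result (enum (powerset NC)) uW vW (bstep rW rWb) (a0 z) (gC z) gT (up1 z) (up2 z) (g0 z)
      bigcount nn okg (okc z) env)).
Proof.
move=> hs; rewrite /WFOMC.
transitivity (\sum_(w : world ar n) (\prod_(g : gatom ar n) (if g \in w then W (tag g) else Wb (tag g))) *
   (sat_all Gamma cards cnts ecnts w)%:R).
  rewrite big_mkcond; apply: eq_bigr => w _; rewrite weightE.
  by case: sat_all; rewrite ?mulr1 ?mulr0.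
rewrite -(SB_world W Wb (fun w => (sat_all Gamma cards cnts ecnts w)%:R)).
rewrite setT_split SB_U ?disj_split1 // SB_blk0; apply: eq_bigr => z _; congr (_ * _).
rewrite wval_result_sum; [|exact: up2C|exact: gTC]; rewrite nnE.
have hc R : bigcount R env = cI R (BigY n) by rewrite countE cI_Big.
rewrite -(z_part uWE vWE rWE rWbE hc hs); last by move=> Om hn h0; exact: ev0P.
by apply: eq_SB => X _; rewrite -natrM mulnb.
Qed.

End Total.

End Setup.
End Counting.

(** * The algorithm *)

Section WfomcProgram.
Import GRing.Theory Num.Theory.

Definition encz (k : int) : seq bool :=
  match k with Posz j => false :: bin j | Negz j => true :: bin j.+1 end.

Lemma enc_intE k : enc_int k = map bitS (encz k).
Proof. by case: k. Qed.

Lemma encz_head k : head false (encz k) = (k < 0)%R.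
Proof. by case: k. Qed.

Lemma encz_val k : valb (behead (encz k)) = `|k|%N.
Proof. by case: k => j; rewrite [behead _]/= valb_bin ?abszN. Qed.

Section Algorithm.
Variables (r : nat) (ar : 'I_r -> nat) (Gamma : fo2 ar)
  (cards : seq ('I_r * cmp * nat)) (cnts ecnts : seq (nat * fo2 ar)).

(* The domain size and, for each predicate in turn, the numerators (sign first) and denominators
   of its two weights. *)
Definition input := (nat * seq (seq bool))%type.

Definition fld (j : nat) (x : input) : seq bool := nth [::] x.2 j.
Definition mag j x := BN (valb (behead (fld j x))).
Definition den j x := BN (valb (fld j x)).
Definition swgt (s : bool) (m : bnat) : wgt := if s then (BN 0, m) else (m, BN 0).
(** The four fields of [R] are numerator and denominator of its two weights, in this order. Each
    numerator is multiplied by the denominator of the other weight, so that [dR R] is a common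
    denominator. *)
Definition rW (R : 'I_r) x := swgt (head false (fld (4 * R) x)) (bmul (mag (4 * R) x) (den (4 * R + 3) x)).
Definition rWb (R : 'I_r) x :=
  swgt (head false (fld (4 * R + 2) x)) (bmul (mag (4 * R + 2) x) (den (4 * R + 1) x)).
Definition dR (R : 'I_r) x := bmul (den (4 * R + 1) x) (den (4 * R + 3) x).
Definition wprod (I : Type) (F : I -> input -> wgt) (l : seq I) x := foldr wmul wone [seq F i x | i <- l].
Definition uW (c : colT Gamma cnts ecnts) x : wgt :=
  if c.1 \subset Pos ar then wprod (fun R => if R \in c.1 then rW R else rWb R) (enum (Pos ar)) x
  else (BN 0, BN 0).
Definition vW (t : {set vatom ar}) x : wgt :=
  wprod (fun u => if u \in t then rW (tag u) else rWb (tag u)) (enum (NC ar)) x.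
Definition zW (z : {set U0 ar}) x : wgt :=
  wprod (fun R : U0 ar => if R \in z then rW (val R) else rWb (val R)) (enum (U0 ar)) x.
(** The sum of the numbers below [n], as an iteration in order to be covered by [PT_iter]. *)
Definition tri (n : nat) : nat := (iter n (fun p : nat * nat => (p.1.+1, p.2 + p.1)) (0, 0)).2.
Definition bcount (R : 'I_r) (x : input) : nat :=
  x.1 ^ ar R - ((ar R == 0) + (x.1 * (0 < ar R) + tri x.1 * ncR ar R)).
Definition res (z : {set U0 ar}) (x : input) : wgt :=
  result (enum (powerset (NC ar))) uW vW (bstep rW rWb) (a0 cards z) (gC z) (@gT _ _ cards cnts ecnts) (up1 z) (up2 z)
    (g0 cards cnts ecnts z) bcount (fun x => x.1) (@okg _ _ cards cnts ecnts) (okc z) x.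
Definition wsum (I : Type) (F : I -> input -> wgt) (l : seq I) x := foldr wadd (BN 0, BN 0) [seq F i x | i <- l].
Definition num : input -> wgt :=
  wsum (fun z x => wmul (zW z x) (if (x.1 != 0) || ev0 z Gamma then res z x else (BN 0, BN 0))) (enum {set U0 ar}).
Definition bprod (I : Type) (F : I -> input -> bnat) (l : seq I) x := foldr bmul (BN 1) [seq F i x | i <- l].
(** Each world takes [n ^ ar R] factors from [R], so this is the common denominator of the whole
    sum. *)
Definition Dn : input -> bnat :=
  bprod (fun R x => iter (x.1 ^ ar R) (bmul (dR R x)) (BN 1)) (enum 'I_r).
(** The difference is split into sign and absolute value and reduced. For numerator 0 and a positive
    denominator the gcd is that denominator, which gives 0 / 1, the normal form of 0. *)
Definition fin (p : wgt * bnat) : seq bool * seq bool :=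
  let s := ~~ bleq p.1.2 p.1.1 in
  let m := if s then bsub p.1.2 p.1.1 else bsub p.1.1 p.1.2 in
  let g := bgcd m p.2 in (s :: bin (bval (bdiv m g)), bin (bval (bdiv p.2 g))).
Definition out (x : input) := fin (num x, Dn x).

Lemma PT_fld j : PT (fld j).
Proof. by rewrite /fld; pt. Qed.
Lemma PT_mag j : PT (mag j).
Proof. by have h := PT_fld j; apply: PT_valb; pt. Qed.
Lemma PT_den j : PT (den j).
Proof. by have h := PT_fld j; apply: PT_valb; pt. Qed.
Lemma PT_head_fld j : PT (fun x => head false (fld j x)).
Proof.
by apply: (@PT_ext _ _ _ _ (fun x => nth false (fld j x) 0)) => [x|]; [case: (fld j x) | apply: PT_nth; exact: PT_fld].
Qed.
Lemma PT_swgt j m : PT m -> PT (fun x => swgt (head false (fld j x)) (m x)).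
Proof. by move=> h; have hh := PT_head_fld j; rewrite /swgt; apply: PT_ifc; pt. Qed.
Lemma PT_rW R : PT (rW R).
Proof. by have h1 := PT_mag (4 * R); have h2 := PT_den (4 * R + 3); apply: PT_swgt; pt. Qed.
Lemma PT_rWb R : PT (rWb R).
Proof. by have h1 := PT_mag (4 * R + 2); have h2 := PT_den (4 * R + 1); apply: PT_swgt; pt. Qed.
Lemma PT_dR R : PT (dR R).
Proof. by have h1 := PT_den (4 * R + 1); have h2 := PT_den (4 * R + 3); rewrite /dR; pt. Qed.
Lemma PT_wprod (I : Type) (F : I -> input -> wgt) l : (forall i, PT (F i)) -> PT (wprod F l).
Proof.
move=> h; elim: l => [|i l IH]; first exact: (PT_const wone).
by have hi := h i; apply: (PT_wmul (u := F i) (v := wprod F l)).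
Qed.
Lemma PT_wsum (I : Type) (F : I -> input -> wgt) l : (forall i, PT (F i)) -> PT (wsum F l).
Proof.
move=> h; elim: l => [|i l IH]; first exact: (PT_const ((BN 0, BN 0) : wgt)).
by have hi := h i; apply: (PT_wadd (u := F i) (v := wsum F l)).
Qed.
Lemma PT_bprod (I : Type) (F : I -> input -> bnat) l : (forall i, PT (F i)) -> PT (bprod F l).
Proof.
move=> h; elim: l => [|i l IH]; first exact: (PT_const (BN 1)).
by have hi := h i; apply: (PT_bmul (a := F i) (b := bprod F l)).
Qed.
Lemma PT_uW c : PT (uW c).
Proof.
rewrite /uW; case: (_ \subset _); last by pt.
by apply: PT_wprod => R; case: (_ \in _); [exact: PT_rW | exact: PT_rWb].
Qed.
Lemma PT_vW t : PT (vW t).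
Proof. by apply: PT_wprod => R; case: (_ \in _); [exact: PT_rW | exact: PT_rWb]. Qed.
Lemma PT_zW t : PT (zW t).
Proof. by apply: PT_wprod => R; case: (_ \in _); [exact: PT_rW | exact: PT_rWb]. Qed.

Lemma iter_tri i : iter i (fun p : nat * nat => (p.1.+1, p.2 + p.1)) (0, 0) = (i, \sum_(0 <= j < i) j).
Proof. by elim: i => [|i IH] /=; rewrite ?IH ?[RHS]/= ?big_nil // big_nat_recr. Qed.

Lemma triE n : tri n = \sum_(0 <= j < n) j.
Proof. by rewrite /tri iter_tri. Qed.

Lemma PT_tri : PT (fun x : input => tri x.1).
Proof.
apply: PT_sndc; apply: (PT_iter (g := fun (_ : input) (p : nat * nat) => (p.1.+1, p.2 + p.1))); [by pt..|].
exists (fun n => 4 * n + 4 * n * n + 10); first by pb.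
move=> x i hi; rewrite iter_tri sz_pair !sz_nat.
have h1 : \sum_(0 <= j < i) j <= i * i.
  rewrite big_mkord; apply: (@leq_trans (\sum_(j < i) i)); last by rewrite sum_nat_const card_ord.
  by apply: leq_sum => j _; apply: ltnW.
have h2 : x.1 <= sz x.
  by case: x hi => a b /= _; rewrite sz_pair sz_nat; lia.
nia.
Qed.

Lemma PT_bcount R : PT (bcount R).
Proof.
rewrite /bcount; have h := PT_tri.
have h2 : PT (fun x : input => x.1 ^ ar R) by apply: PT_expn; pt.
by apply: PT_subn => //; apply: PT_addn; [exact: PT_const | apply: PT_addn; apply: PT_muln => //; pt].
Qed.

Lemma PT_bstep R g : PT (eB := @Enc_seq _ (@Enc_prod _ _ (@enc_fin _) _)) (@bstep _ _ cards cnts ecnts _ rW rWb R g).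
Proof. by have h1 := PT_rW R; have h2 := PT_rWb R; rewrite /bstep; apply: PT_cons; [apply: PT_pair => //; exact: PT_const | apply: PT_cons; [apply: PT_pair => //; exact: PT_const | exact: PT_const]]. Qed.

Lemma PT_res z : PT (res z).
Proof.
apply: PT_result; [exact: PT_uW|exact: PT_vW|exact: PT_bstep|exact: PT_bcount|by pt].
Qed.

Lemma PT_num : PT num.
Proof.
apply: PT_wsum => z; have h1 := PT_zW z; have h2 := PT_res z.
apply: PT_wmul => //; apply: PT_ifc => //; last by pt.
apply: PT_orb; last by pt.
by apply: PT_negb; apply: (PT_eqc enc_inj_nat); pt.
Qed.

Lemma iter_bmul d i : iter i (bmul d) (BN 1) = BN (bval d ^ i).
Proof. by elim: i => //= i ->; rewrite /bmul /= -expnS. Qed.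

(** The exponent is polynomial in the domain size, which the input gives in unary; so the power has
    polynomially many bits and repeated multiplication suffices. *)
Lemma PT_Dn : PT Dn.
Proof.
apply: PT_bprod => R; have h := PT_dR R; have [p pp hp] := PT_size h.
have h2 : PT (fun x : input => x.1 ^ ar R) by apply: PT_expn; pt.
apply: (PT_iter (g := fun x => bmul (dR R x))) => //; [by pt | by pt |].
exists (fun n => 4 * (p n * n ^ ar R).+1 + 1); first by pb.
move=> x i hi; rewrite iter_bmul; apply: sz_bnat.
have hn : x.1 ^ ar R <= sz x ^ ar R.
  by apply: leq_expb; case: (x) => a b; rewrite sz_pair sz_nat /=; lia.
have hk : sz (dR R x) * i <= p (sz x) * sz x ^ ar R by apply: leq_mul; [exact: hp | exact: leq_trans hi hn].
apply: (@leq_ltn_trans ((2 ^ sz (dR R x)) ^ i)); last by rewrite -expnM ltn_exp2l.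
by apply: leq_expb; apply: ltnW; exact: bin_lt_sz.
Qed.

Lemma PT_fin : PT fin.
Proof.
have h1 : PT (fun p : wgt * bnat => ~~ bleq p.1.2 p.1.1) by apply: PT_negb; apply: PT_bleq; pt.
have h2 : PT (fun p : wgt * bnat => if ~~ bleq p.1.2 p.1.1 then bsub p.1.2 p.1.1 else bsub p.1.1 p.1.2).
  by apply: PT_ifc => //; apply: PT_bsub; pt.
have h3 := PT_bgcd h2 (PT_snd : PT (fun p : wgt * bnat => p.2)).
apply: PT_pair; last by apply: PT_bin; apply: PT_bdiv => //; pt.
by apply: PT_cons => //; apply: PT_bin; apply: PT_bdiv.
Qed.

Lemma PT_out : PT out.
Proof. by apply: PT_comp PT_fin _; apply: PT_pair; [exact: PT_num | exact: PT_Dn]. Qed.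
End Algorithm.
End WfomcProgram.

(** * Correctness of the output *)

Section WfomcCorrect.
Import GRing.Theory Num.Theory.
Local Open Scope ring_scope.

Lemma encz_neg m : (0 < m)%N -> encz (- m%:Z) = true :: bin m.
Proof. by case: m. Qed.

(** Lowest terms are unique: a quotient with coprime parts and positive denominator has [numq] and
    [denq] as its parts. *)
Lemma finE (w : wgt) (D : bnat) (q : rat) : (0 < bval D)%N -> wval w / (bval D)%:R = q ->
  fin (w, D) = (encz (numq q), bin `|denq q|%N).
Proof.
case: w D => [[a] [b]] [D] /= hD hq; rewrite /fin /bleq /= -ltnNge bgcdE /bdiv.
set m := (if _ then _ else _); set s := (a < b)%N.
have em : bval m = `|a%:Z - b%:Z|%N by rewrite /m /bsub; case: ifP => /=; lia.
have eq1 : wval (BN a, BN b) = (-1) ^+ s * (bval m)%:R :> rat.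
  rewrite /wval /m /bsub /= /s; case: ltnP => h /=.
    by rewrite mulN1r natrB ?opprB // ltnW.
  by rewrite mul1r natrB.
set g := gcdn (bval m) D.
have g0 : (0 < g)%N by rewrite gcdn_gt0 hD orbT.
rewrite !bedivnE //=; set m' := (bval m %/ g)%N; set D' := (D %/ g)%N.
have e1 : bval m = (m' * g)%N by rewrite divnK // dvdn_gcdl.
have e2 : D = (D' * g)%N by rewrite divnK // dvdn_gcdr.
have D'0 : (0 < D')%N by move: hD; rewrite e2 muln_gt0 => /andP[].
have cop : coprime m' D'.
  by rewrite /coprime -(eqn_pmul2r g0) mul1n muln_gcdl -e1 -e2.
(* The sign bit may be set only for a nonzero numerator, as integers have a single code for 0. *)
have s0 : s -> (0 < m')%N.
  have : (0 < bval m)%N = (0 < m')%N by rewrite e1 muln_gt0 g0 andbT.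
  by move=> <-; rewrite em /s; lia.
have eq2 : q = (if s then - m'%:Z else m'%:Z)%:~R / (D'%:Z)%:~R.
  rewrite -hq eq1 e1 [in X in _ / X]e2 !natrM.
  have gn : g%:R != 0 :> rat by rewrite pnatr_eq0 -lt0n.
  rewrite (mulrA (_ ^+ _)) -mulf_div divff // mulr1; congr (_ / _).
  by case: (s); rewrite ?mulN1r ?mul1r ?rmorphN.
have cop2 : coprime `|if s then - m'%:Z else m'%:Z| `|D'%:Z| by case: (s); rewrite ?abszN.
rewrite eq2 coprimeq_num // coprimeq_den // gtr0_sg ?ltz_nat // mul1r.
rewrite eqz_nat (gtn_eqF D'0) !absz_nat.
by case: (s) s0 => [/(_ isT) h|_]; rewrite ?encz_neg.
Qed.

Section Scale.
Variables (r : nat) (ar : 'I_r -> nat) (Gamma : fo2 ar)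
  (cards : seq ('I_r * cmp * nat)) (cnts ecnts : seq (nat * fo2 ar)).
Variables (n : nat).

Lemma leq_Ncount (R : 'I_r) (w : world ar n) : (Ncount R w <= n ^ ar R)%N.
Proof.
rewrite -(card_tag ar n R) /Ncount; apply: subset_leq_card; apply/subsetP => g.
by rewrite !inE => /andP[].
Qed.

(** Both weights of [R] are scaled by the same factor, and every world uses exactly [n ^ ar R] of
    them, whichever atoms are true; so the factor comes out of the sum. *)
Lemma WFOMC_scale (W Wb d : 'I_r -> rat) :
  WFOMC n Gamma cards cnts ecnts (fun R => W R * d R) (fun R => Wb R * d R) =
  WFOMC n Gamma cards cnts ecnts W Wb * \prod_R d R ^+ (n ^ ar R).
Proof.
rewrite /WFOMC big_distrl; apply: eq_bigr => w _ /=; rewrite /weight -big_split; apply: eq_bigr => R _ /=.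
by rewrite 2!exprMn mulrACA -exprD subnKC ?leq_Ncount.
Qed.
End Scale.

Lemma nth_flatten4 (A B : Type) (x : B) (g : A -> seq B) (l : seq A) a0 j i :
  (forall a, size (g a) = 4) -> (i < 4)%N -> (j < size l)%N ->
  nth x (flatten [seq g a | a <- l]) (4 * j + i) = nth x (g (nth a0 l j)) i.
Proof.
move=> hg hi; elim: l j => // a l IH [|j] /= hj; rewrite nth_cat hg; first by rewrite hi.
by rewrite ifN -?IH //; [congr nth; lia | lia].
Qed.

Section Correct.
Variables (r : nat) (ar : 'I_r -> nat) (Gamma : fo2 ar)
  (cards : seq ('I_r * cmp * nat)) (cnts ecnts : seq (nat * fo2 ar)).
Variables (n : nat) (wt wb : 'I_r -> rat).

Definition wfields (R : 'I_r) : seq (seq bool) :=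
  [:: encz (numq (wt R)); bin `|denq (wt R)|%N; encz (numq (wb R)); bin `|denq (wb R)|%N].
Definition fields := flatten [seq wfields R | R <- enum 'I_r].
Let x : input := (n, fields).
Let dd R : rat := (`|denq (wt R)| * `|denq (wb R)|)%N%:R.

Lemma fldE (R : 'I_r) i : (i < 4)%N -> fld (4 * R + i) x = nth [::] (wfields R) i.
Proof.
move=> hi; rewrite /fld /= (@nth_flatten4 _ _ [::] wfields _ R) ?size_enum_ord //.
by rewrite nth_ord_enum.
Qed.
Lemma fld0 (R : 'I_r) : fld (4 * R) x = encz (numq (wt R)).
Proof. by rewrite -[(4 * R)%N]addn0 fldE. Qed.

Lemma wval_swgt (k : int) (d : nat) : wval (swgt (k < 0) (BN (`|k| * d))) = k%:~R * d%:R.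
Proof.
rewrite /wval /swgt; case: k => k /=; first by rewrite subr0 natrM.
by rewrite sub0r natrM NegzE rmorphN mulNr.
Qed.

Lemma denK (q : rat) : q * `|denq q|%N%:R = (numq q)%:~R.
Proof. by rewrite numqE -[in RHS](gez0_abs (denq_ge0 q)). Qed.

Lemma rW_val R : wval (rW R x) = wt R * dd R.
Proof.
rewrite /rW /mag /den fld0 fldE // /= encz_head /bmul /= encz_val valb_bin wval_swgt.
by rewrite -denK /dd natrM mulrA.
Qed.
Lemma rWb_val R : wval (rWb R x) = wb R * dd R.
Proof.
rewrite /rWb /mag /den !fldE // /= encz_head /bmul /= encz_val valb_bin wval_swgt.
by rewrite -denK /dd natrM mulrAC mulrA.
Qed.
Lemma dR_val R : bval (dR R x) = (`|denq (wt R)| * `|denq (wb R)|)%N.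
Proof. by rewrite /dR /den !fldE //= !valb_bin. Qed.

Lemma wprod_val (I : finType) (A : {set I}) (F : I -> input -> wgt) y : wval (wprod F (enum A) y) = \prod_(i in A) wval (F i y).
Proof.
rewrite -big_enum /wprod; elim: (enum A) => [|i l IH] /=; first by rewrite big_nil wval_one.
by rewrite big_cons wval_mul IH.
Qed.
Lemma wprodT_val (I : finType) (F : I -> input -> wgt) y : wval (wprod F (enum I) y) = \prod_i wval (F i y).
Proof.
rewrite -big_enum /wprod; elim: (enum I) => [|i l IH] /=; first by rewrite big_nil wval_one.
by rewrite big_cons wval_mul IH.
Qed.
Lemma wsum_val (I : finType) (F : I -> input -> wgt) y : wval (wsum F (enum I) y) = \sum_i wval (F i y).
Proof.
rewrite -big_enum /wsum; elim: (enum I) => [|i l IH] /=; first by rewrite big_nil /wval subrr.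
by rewrite big_cons wval_add IH.
Qed.

Lemma num_val : sentence Gamma -> wval (num Gamma cards cnts ecnts x) =
  WFOMC n Gamma cards cnts ecnts (fun R => wt R * dd R) (fun R => wb R * dd R).
Proof.
move=> hs; rewrite /num wsum_val.
have ifE (b : bool) R : wval (if b then rW R x else rWb R x) = if b then wt R * dd R else wb R * dd R.
  by case: b; rewrite ?rW_val ?rWb_val.
rewrite (@total_sum r ar Gamma cards cnts ecnts n _ _ input x (@uW r ar Gamma cnts ecnts) (@vW r ar)
  (@rW r) (@rWb r) (@bcount r ar) (fun x => x.1)) //.
- apply: eq_bigr => z _; rewrite wval_mul; congr (_ * _).
    by rewrite wprodT_val; apply: eq_bigr => R _; case: (R \in z); rewrite ?rW_val ?rWb_val.
  by rewrite /=; case: (_ || _); rewrite ?mul1r ?mul0r // /wval subrr.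
- move=> c; rewrite /uW /wC; case: (_ \subset _); last by rewrite /wval subrr.
  by rewrite wprod_val; apply: eq_bigr => R _; case: (R \in _); rewrite ?rW_val ?rWb_val.
- by move=> t; rewrite wprod_val; apply: eq_bigr => R _; case: (R \in _); rewrite ?rW_val ?rWb_val.
- exact: rW_val.
- exact: rWb_val.
- by move=> R; rewrite /bcount /= triE.
Qed.

Lemma Dn_val : bval (Dn ar x) = (\prod_R (`|denq (wt R)| * `|denq (wb R)|) ^ (n ^ ar R))%N.
Proof.
rewrite /Dn -big_enum /bprod; elim: (enum 'I_r) => [|i l IH] /=; first by rewrite big_nil.
by rewrite big_cons IH iter_bmul -dR_val.
Qed.

Lemma outE : sentence Gamma -> let q := WFOMC n Gamma cards cnts ecnts wt wb in
  out Gamma cards cnts ecnts x = (encz (numq q), bin `|denq q|%N).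
Proof.
move=> hs q; have d0 R : (0 < `|denq (wt R)| * `|denq (wb R)|)%N by rewrite muln_gt0 !absz_gt0 !denq_eq0.
have eD : (bval (Dn ar x))%:R = \prod_R dd R ^+ (n ^ ar R).
  by rewrite Dn_val natr_prod; apply: eq_bigr => R _; rewrite natrX.
have D0 : (0 < bval (Dn ar x))%N by rewrite Dn_val prodn_gt0 // => R; rewrite expn_gt0 d0.
apply: finE => //; rewrite num_val // WFOMC_scale -eD mulfK //.
by rewrite pnatr_eq0 -lt0n.
Qed.
End Correct.
End WfomcCorrect.

(** * Assembly of the machine *)

Definition pre (L : seq (seq bool)) : input :=
  let S := rev (map rev L) in (size (head [::] S), behead S).

Lemma PT_pre : PT pre.
Proof.
have hS : PT (fun L : seq (seq bool) => rev (map rev L)).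
  by apply: PT_rev; apply: (PT_map (f := fun _ => rev)); pt.
apply: PT_pair; last by apply: PT_behead.
apply: PT_lsize; apply: (@PT_ext _ _ _ _ (fun L : seq (seq bool) => nth [::] (rev (map rev L)) 0)) => [L|].
  by rewrite nth0.
exact: PT_nth.
Qed.

(** This undoes the reversals made while the fields were absorbed. The first field is the domain
    size in unary, so its length is what counts. *)
Lemma pre_catrev segs : pre (catrev (map rev segs) [::]) = (size (head [::] segs), behead segs).
Proof. by rewrite /pre -[catrev _ _]/(rev _) map_rev mapK ?revK //; exact: revK. Qed.

(** The input format is itself a layout of stacks: the unary domain size, then numerators and
    denominators, with separators between them. *)
Lemma lay_input r n (wt wbar : 'I_r -> rat) :
  wfomc_input n wt wbar = lay (nseq n true :: fields wt wbar).
Proof.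
rewrite lay_cons map_nseq /wfomc_input; congr (_ ++ _).
rewrite /lay' /fields; elim: (enum 'I_r) => //= R l <-.
by rewrite /enc_rat !enc_intE /= -!catA /= -!catA.
Qed.

Theorem theorem2 :
  forall (r : nat) (ar : 'I_r -> nat) (Gamma : fo2 ar)
         (cards : seq ('I_r * cmp * nat)) (cnts ecnts : seq (nat * fo2 ar)),
    sentence Gamma ->
    exists (M : TM) (c d : nat),
      forall (n : nat) (wt wbar : 'I_r -> rat),
        let inp := wfomc_input n wt wbar in
        computes_within M inp
          (enc_rat (WFOMC n Gamma cards cnts ecnts wt wbar))
          (c * (size inp).+1 ^ d).
Proof.
move=> r ar Gamma cards cnts ecnts hs.
pose main L := out Gamma cards cnts ecnts (pre L).
have hmain : PT main by apply: PT_comp (PT_out _ _ _ _) PT_pre.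
(* Four fields for each predicate, and one for the domain size. *)
have [M [c [d hM]]] := @PT_machine (4 * r).+1 main isT hmain.
exists M, c, d => n wt wbar inp.
have hsz : size (nseq n true :: fields wt wbar) = (4 * r).+1.
  rewrite /= /fields -[in RHS](size_enum_ord r); congr S.
  by elim: (enum 'I_r) => //= R l ->; rewrite mulnS.
have := hM _ hsz; rewrite /main pre_catrev [head _ _]/= [behead _]/= size_nseq outE //= -lay_input.
by rewrite /enc_rat enc_intE.
Qed.
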